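(* Let $w=(w(k))_{k\ge1}$ with $w>0$ be such that there exist $c>0$ and $d>0$ with $$c\,w(k+1)\le w(k)\le d\,\rho^{-2L^k}w(k+1),\qquad k\ge1.$$ (a) In $L_2(w)$, the operator $\mathcal{K}$ is bounded; the equation $\dot z_t=\mathcal{K}z_t$, $t\ge0$, has a unique solution $z_t=e^{\mathcal{K}t}z_0$, where $e^{\mathcal{K}t}=(p^*_t(i,j))_{i,j\ge1}$ has the spectral representation $$p^*_t(i,j)=\pi(i)\int_0^\infty e^{-xt}Q_i(x)Q_j(x)\,\psi(dx),\qquad i,j\ge1;$$ and there is uniqueness of solutions for the SDE $$Z_t=Z_0+\int_0^t\mathcal{K}Z_s\,ds+B_t,\qquad t\ge0.$$ The assumptions and conclusions hold for $w=\pi$ and for $w=g_\theta$ with $\theta>0$. (b) Suppose in addition that $w$ satisfies $\sum_{k\ge1}\tilde u(k)w(k)^{-1}<\infty$. Then the SDE $Z_t=Z_0+\int_0^t\mathcal{K}Z_s\,ds+B_t$, $t\ge0$, has a unique solution in $L_2(w)$, given by $$Z_t=e^{\mathcal{K}t}Z_0+\int_0^t e^{\mathcal{K}(t-s)}\,dB_s,$$ which in matrix notation can be written $$Z_t=\mathrm{diag}(\pi)\int_S e^{-xt}\,Q(x)^*\left(Z_0+\int_0^t e^{xs}\,dB_s\right)Q(x)\,\psi(dx).$$ The assumptions and conclusions hold for $w=\pi$ and $w=g_\theta$ with $\theta>0$ when $L\ge2$, or for $w=g_\theta$ with $\theta>\rho$ when $L=1$.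
   Context: $\alpha,\beta>0$ with $\rho=\alpha/\beta<1$, $L\ge1$ an integer, $\mathbb{N}=\{0,1,\dots\}$. For a positive sequence $w=(w(k))_{k\ge1}$, $L_2(w)$ is the Hilbert space of real sequences $x=(x(k))_{k\in\mathbb{N}}$ with $x(0)=0$ and $\|x\|_{L_2(w)}^2=\sum_{k\ge1}x(k)^2w(k)^{-1}<\infty$. $g_\theta=(\theta^k)_{k\ge1}$, $\tilde u(k)=\rho^{1+L+\cdots+L^{k-1}}=\rho^{(L^k-1)/(L-1)}$, and $\pi(k)=L^{k-1}\rho^{L+\cdots+L^{k-1}}=L^{k-1}\rho^{(L^k-L)/(L-1)}$ for $k\ge1$ (for $L=1$: $\tilde u(k)=\rho^k$, $\pi(k)=\rho^{k-1}$). Sequences vanishing at $0$ are identified with column vectors indexed by $k\ge1$, $^*$ is transposition, and $\mathrm{diag}(a)$ is the diagonal matrix with diagonal $a$. $\mathcal{K}x(k)=\beta L\rho^{L^{k-1}}x(k-1)-(\beta L\rho^{L^k}+\beta)x(k)+\beta x(k+1)$, $k\ge1$ (with $x(0)=0$), identified with its infinite matrix. $B=(B(k))_{k\in\mathbb{N}}$ is a family of independent real centered Brownian motions with $B(0)=0$ and $\mathbb{E}(B_1(k)^2)=\tilde v(k)=2\beta(\tilde u(k)-\tilde u(k+1))$ for $k\ge1$, independent of $Z_0$. Solutions of the SDE in $L_2(w)$ have values in $L_2(w)$. $Q(x)=(Q_n(x))_{n\ge1}$ are the polynomials ($\deg Q_n=n-1$) defined by $Q_0=0$, $Q_1=1$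 and $-xQ_n(x)=\beta Q_{n-1}(x)-(\beta L\rho^{L^n}+\beta)Q_n(x)+\beta L\rho^{L^n}Q_{n+1}(x)$, $n\ge1$. $\psi$ (the spectral measure) is the probability measure on $\mathbb{R}_+$ with respect to which they are orthogonal: $\int_0^\infty Q_i(x)^2\,\psi(dx)=\pi(i)^{-1}$ and $\int_0^\infty Q_i(x)Q_j(x)\,\psi(dx)=0$ for $i\ne j$. $S$ is the support of $\psi$.
   Formalization: In the last formula of (b) the sum over j in the product Q(x)^*(Z_0+∫e^{xs}dB_s) is taken outside the ψ-integral, entry by entry, since inside it the series can diverge (e.g. L=1, w=g_θ with θ≥1, Z_0(k)=θ^{k/2}/k). *)

(* Defs.v *)
From HB Require Import structures.
From mathcomp Require Import all_boot all_order all_algebra.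
From mathcomp Require Import all_classical all_reals all_analysis.
From mathcomp Require Import ring.
Set Implicit Arguments.
Unset Strict Implicit.
Unset Printing Implicit Defensive.
Import Order.TTheory GRing.Theory Num.Theory.
Import numFieldNormedType.Exports.
Local Open Scope classical_set_scope.
Local Open Scope ring_scope.

(* Sequences are functions nat -> R.  Those indexed by k >= 1 (weights, pi, u)
   have an irrelevant value at 0; elements of L_2(w) vanish at 0. *)

Definition L2sqnorm (R : realType) (w x : nat -> R) : \bar R :=
  (\sum_(1 <= k <oo) (x k ^+ 2 / w k)%:E)%E.

Definition L2 (R : realType) (w : nat -> R) : set (nat -> R) :=
  [set x | x 0%N = 0 /\ (L2sqnorm w x < +oo)%E].

(* Meaningful on L2 w only: [fine] sends +oo to 0. *)
Definition L2norm (R : realType) (w x : nat -> R) : R :=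
  Num.sqrt (fine (L2sqnorm w x)).

Definition unit_seq (R : realType) (j : nat) : nat -> R :=
  fun k => (k == j)%:R.

Definition geom_seq (R : realType) (theta : R) : nat -> R :=
  fun k => theta ^+ k.

(* Operators are total maps on sequences, of which only the restriction to
   L2 w matters. *)
Definition bounded_op (R : realType) (w : nat -> R)
    (A : (nat -> R) -> nat -> R) : Prop :=
  [/\ (forall x, L2 w x -> L2 w (A x)),
      (forall (a : R) x y, L2 w x -> L2 w y ->
         A (fun k => a * x k + y k) = (fun k => a * A x k + A y k)) &
      exists C : R, forall x, L2 w x -> L2norm w (A x) <= C * L2norm w x].

Definition exp_partial (R : realType) (A : (nat -> R) -> nat -> R) (N : nat) :
    (nat -> R) -> nat -> R :=
  fun x k => \sum_(n < N) (n`!%:R)^-1 * iter n A x k.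

(* e^A, coordinate by coordinate; [exp_cvg] expresses that the exponential
   series converges to it in the operator norm of L2 w. *)
Definition op_exp (R : realType) (A : (nat -> R) -> nat -> R) :
    (nat -> R) -> nat -> R :=
  fun x k => limn (fun N => exp_partial A N x k).

Definition exp_cvg (R : realType) (w : nat -> R)
    (A : (nat -> R) -> nat -> R) : Prop :=
  bounded_op w (op_exp A) /\
  forall eps : R, 0 < eps -> \forall N \near \oo,
    forall x, L2 w x ->
      L2norm w (fun k => op_exp A x k - exp_partial A N x k)
        <= eps * L2norm w x.

(* z' = A z on [0, +oo[, the derivative (one-sided at 0) being taken in the
   norm of L2 w. *)
Definition ode_solution (R : realType) (w : nat -> R)
    (A : (nat -> R) -> nat -> R) (z : R -> nat -> R) : Prop :=
  forall t : R, 0 <= t ->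
    L2 w (z t) /\
    (fun h : R => L2norm w (fun k => (z (t + h) k - z t k) / h - A (z t) k))
      @ within [set h : R | 0 <= t + h] (0 : R)^' --> (0 : R).

(* Bochner integrability: since L2 w is separable, strong measurability is
   measurability of the coordinates, and the Bochner integral is the
   coordinatewise Lebesgue integral. *)
Definition L2_integrable (R : realType) (w : nat -> R) (D : set R)
    (f : R -> nat -> R) : Prop :=
  [/\ (forall s, D s -> L2 w (f s)),
      (forall k, measurable_fun D (fun s => f s k)) &
      (\int[lebesgue_measure]_(s in D) (L2norm w (f s))%:E < +oo)%E].

Definition L2_integral (R : realType) (D : set R) (f : R -> nat -> R) :
    nat -> R :=
  fun k => \int[lebesgue_measure]_(s in D) f s k.

Definition rho (R : realType) (alpha beta : R) : R := alpha / beta.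

Definition u_tilde (R : realType) (alpha beta : R) (L k : nat) : R :=
  rho alpha beta ^+ (\sum_(0 <= j < k) L ^ j)%N.

Definition pi_seq (R : realType) (alpha beta : R) (L k : nat) : R :=
  (L ^ k.-1)%:R * rho alpha beta ^+ (\sum_(1 <= j < k) L ^ j)%N.

Definition v_tilde (R : realType) (alpha beta : R) (L k : nat) : R :=
  2 * beta * (u_tilde alpha beta L k - u_tilde alpha beta L k.+1).

Definition brate (R : realType) (alpha beta : R) (L k : nat) : R :=
  beta * L%:R * rho alpha beta ^+ (L ^ k)%N.

Definition Kop (R : realType) (alpha beta : R) (L : nat) (x : nat -> R) :
    nat -> R :=
  fun k => if k is j.+1 then
    brate alpha beta L j * x j - (brate alpha beta L k + beta) * x k
      + beta * x k.+1
  else 0.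

Definition expK (R : realType) (alpha beta : R) (L : nat) (t : R) :
    (nat -> R) -> nat -> R :=
  op_exp (fun x k => t * Kop alpha beta L x k).

(* The pair (Q_n, Q_{n+1}). *)
Fixpoint Qpair (R : realType) (alpha beta : R) (L n : nat) :
    {poly R} * {poly R} :=
  if n is m.+1 then
    let: (p, q) := Qpair alpha beta L m in
    (q, (brate alpha beta L n)^-1 *:
          (((brate alpha beta L n + beta)%:P - 'X) * q - beta *: p))
  else (0, 1).

Definition Qpoly (R : realType) (alpha beta : R) (L n : nat) : {poly R} :=
  (Qpair alpha beta L n).1.

Lemma Qpoly0 (R : realType) (alpha beta : R) (L : nat) :
  Qpoly alpha beta L 0 = 0.
Proof. by []. Qed.

Lemma Qpoly1 (R : realType) (alpha beta : R) (L : nat) :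
  Qpoly alpha beta L 1 = 1.
Proof. by []. Qed.

Lemma Qpoly_rec (R : realType) (alpha beta : R) (L n : nat) :
  0 < alpha -> 0 < beta -> (1 <= L)%N -> (1 <= n)%N ->
  - 'X * Qpoly alpha beta L n =
    beta *: Qpoly alpha beta L n.-1
    - (brate alpha beta L n + beta) *: Qpoly alpha beta L n
    + brate alpha beta L n *: Qpoly alpha beta L n.+1.
Proof.
move=> a0 b0 L0; case: n => [//|n] _ /=.
have l0 : brate alpha beta L n.+1 != 0.
  by rewrite !mulf_neq0 ?expf_neq0 ?mulf_neq0 ?invr_eq0 ?gt_eqF ?ltr0n.
rewrite /Qpoly /=; case: (Qpair alpha beta L n) => p q /=.
rewrite scalerA divff// scale1r -!mul_polyC polyCD; ring.
Qed.

Definition orthogonality_measure (R : realType) (alpha beta : R) (L : nat)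
    (psi : probability (measurableTypeR R) R) : Prop :=
  [/\ psi `[0%R, +oo[%classic = 1%E,
      (forall i, (1 <= i)%N ->
        (\int[psi]_(x in `[0%R, +oo[) ((Qpoly alpha beta L i).[x] ^+ 2)%:E
           = ((pi_seq alpha beta L i)^-1)%:E)%E) &
      (forall i j, (1 <= i)%N -> (1 <= j)%N -> i <> j ->
        (\int[psi]_(x in `[0%R, +oo[)
            ((Qpoly alpha beta L i).[x] * (Qpoly alpha beta L j).[x])%:E
           = 0)%E)].

Definition measure_support (R : realType)
    (mu : {measure set (measurableTypeR R) -> \bar R}) : set R :=
  [set x | forall e : R, 0 < e -> (0 < mu (ball x e))%E].

Definition pstar_fun (R : realType) (alpha beta : R) (L : nat) (t : R)
    (i j : nat) (x : R) : R :=
  expR (- (x * t)) * (Qpoly alpha beta L i).[x] * (Qpoly alpha beta L j).[x].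

Definition pstar (R : realType) (alpha beta : R) (L : nat)
    (psi : probability (measurableTypeR R) R) (t : R) (i j : nat) : R :=
  pi_seq alpha beta L i *
    \int[psi]_(x in `[0, +oo[) pstar_fun alpha beta L t i j x.

Definition sigma_gen (R : realType) (d : measure_display)
    (Omega : measurableType d) (I : Type) (D : set I) (X : I -> Omega -> R) :
    set (set Omega) :=
  <<s [set E | exists i A, [/\ D i, measurable A & E = X i @^-1` A]] >>.

Definition indep_family (R : realType) (d : measure_display)
    (Omega : measurableType d) (P : probability Omega R) (I : choiceType)
    (F : I -> set (set Omega)) : Prop :=
  forall (s : seq I) (E : I -> set Omega), uniq s ->
    (forall i, i \in s -> F i (E i)) ->
    (P (\bigcap_(i in [set` s]) E i) = \prod_(i <- s) P (E i))%E.

(* (W_t)_{t >= 0} is a centered Brownian motion with E(W_1^2) = v, for v > 0. *)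
Definition brownian (R : realType) (d : measure_display)
    (Omega : measurableType d) (P : probability Omega R) (v : R)
    (W : R -> Omega -> R) : Prop :=
  [/\ (forall t, 0 <= t -> measurable_fun setT (W t)),
      {ae P, forall om, W 0 om = 0},
      {ae P, forall om, {within `[0, +oo[, continuous (fun t => W t om)}},
      (forall s t (A : set (measurableTypeR R)), 0 <= s -> s < t ->
         measurable A ->
         P ((fun om => W t om - W s om) @^-1` A)
           = normal_prob 0 (Num.sqrt (v * (t - s))) A) &
      (forall s : nat -> R, 0 <= s 0%N -> {homo s : m n / (m <= n)%N >-> m <= n} ->
         indep_family P (fun m : nat => sigma_gen [set: unit]
           (fun _ om => W (s m.+1) om - W (s m) om)))].

(* Independent Brownian motions B(k), k >= 1, with variances v(k), and
   B(0) = 0; the family B is independent of Z0. *)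
Definition driving_noise (R : realType) (d : measure_display)
    (Omega : measurableType d) (P : probability Omega R) (v : nat -> R)
    (B : nat -> R -> Omega -> R) (Z0 : Omega -> nat -> R) : Prop :=
  [/\ (forall t om, 0 <= t -> B 0%N t om = 0),
      (forall k, (1 <= k)%N -> brownian P (v k) (B k)),
      indep_family P (fun k : nat => sigma_gen [set t : R | 0 <= t] (B k)),
      (forall k, measurable_fun setT (fun om => Z0 om k)) &
      forall E F : set Omega,
        sigma_gen [set p : nat * R | 0 <= p.2] (fun p => B p.1 p.2) E ->
        sigma_gen [set: nat] (fun k om => Z0 om k) F ->
        P (E `&` F) = (P E * P F)%E].

Definition sde_solution (R : realType) (d : measure_display)
    (Omega : measurableType d) (P : probability Omega R) (w : nat -> R)
    (A : (nat -> R) -> nat -> R) (B : nat -> R -> Omega -> R)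
    (Z0 : Omega -> nat -> R) (Z : R -> Omega -> nat -> R) : Prop :=
  (forall t k, 0 <= t -> measurable_fun setT (fun om => Z t om k)) /\
  {ae P, forall om, forall t : R, 0 <= t ->
    [/\ L2 w (Z t om),
        L2_integrable w `[0, t] (fun s => A (Z s om)) &
        forall k, Z t om k =
          Z0 om k + L2_integral `[0, t] (fun s => A (Z s om)) k + B k t om]}.

Definition sde_uniqueness (R : realType) (d : measure_display)
    (Omega : measurableType d) (P : probability Omega R) (w : nat -> R)
    (A : (nat -> R) -> nat -> R) (B : nat -> R -> Omega -> R)
    (Z0 : Omega -> nat -> R) : Prop :=
  forall Z Z' : R -> Omega -> nat -> R,
    sde_solution P w A B Z0 Z -> sde_solution P w A B Z0 Z' ->
    {ae P, forall om, forall t : R, 0 <= t -> Z t om = Z' t om}.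

(* The step function equal to A m on ]s m, s m.+1], m < N. *)
Definition step_op (R : realType) (N : nat) (s : nat -> R)
    (A : nat -> (nat -> R) -> nat -> R) (r : R) : (nat -> R) -> nat -> R :=
  fun x k => \sum_(m < N) \1_(`]s m, s m.+1]) r * A m x k.

Definition step_integral (R : realType) (Omega : Type)
    (B : nat -> R -> Omega -> R) (N : nat) (s : nat -> R)
    (A : nat -> (nat -> R) -> nat -> R) (om : Omega) : nat -> R :=
  fun k => \sum_(m < N) A m (fun j => B j (s m.+1) om - B j (s m) om) k.

(* The squared Hilbert-Schmidt norm of (Phi - Psi) C^(1/2) on L_2(w), where C
   is the covariance of B_1. *)
Definition HS_sqdist (R : realType) (w v : nat -> R)
    (Phi Psi : (nat -> R) -> nat -> R) : \bar R :=
  (\sum_(1 <= j <oo) (v j)%:E *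
     L2sqnorm w (fun k => Phi (unit_seq R j) k - Psi (unit_seq R j) k)%R)%E.

(* Y is (a version of) int_0^t Phi(s) dB_s: the limit in L^2(P; L_2(w)) of the
   integrals of step functions approximating Phi in the norm of the Ito
   isometry.  This determines Y up to a P-null set. *)
Definition stochastic_integral (R : realType) (d : measure_display)
    (Omega : measurableType d) (P : probability Omega R) (w v : nat -> R)
    (B : nat -> R -> Omega -> R) (t : R)
    (Phi : R -> (nat -> R) -> nat -> R) (Y : Omega -> nat -> R) : Prop :=
  [/\ (forall k, measurable_fun setT (fun om => Y om k)),
      {ae P, forall om, L2 w (Y om)} &
      exists (N : nat -> nat) (s : nat -> nat -> R)
             (A : nat -> nat -> (nat -> R) -> nat -> R),
        [/\ (forall n, [/\ s n 0%N = 0, s n (N n) = t &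
                {homo s n : m p / (m <= p)%N >-> m <= p}]),
            (forall n m, bounded_op w (A n m)),
            (fun n => \int[lebesgue_measure]_(r in `[0%R, t])
               HS_sqdist w v (step_op (N n) (s n) (A n) r) (Phi r))%E
              @ \oo --> (0 : \bar R)%E &
            (fun n => \int[P]_om
               L2sqnorm w (fun k =>
                 step_integral B (N n) (s n) (A n) om k - Y om k)%R)%E
              @ \oo --> (0 : \bar R)%E]].

Definition weight_growth (R : realType) (alpha beta : R) (L : nat)
    (w : nat -> R) : Prop :=
  (forall k, (1 <= k)%N -> 0 < w k) /\
  exists c d : R, [/\ 0 < c, 0 < d &
    forall k, (1 <= k)%N ->
      c * w k.+1 <= w k <= d * rho alpha beta ^- (2 * L ^ k) * w k.+1].

Definition weight_summable (R : realType) (alpha beta : R) (L : nat)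
    (w : nat -> R) : Prop :=
  (\sum_(1 <= k <oo) (u_tilde alpha beta L k / w k)%:E < +oo)%E.

Definition conclusion_a (R : realType) (alpha beta : R) (L : nat)
    (psi : probability (measurableTypeR R) R) (d : measure_display)
    (Omega : measurableType d) (P : probability Omega R)
    (B : nat -> R -> Omega -> R) (Z0 : Omega -> nat -> R)
    (w : nat -> R) : Prop :=
  [/\ bounded_op w (Kop alpha beta L),
      (forall t, 0 <= t -> exp_cvg w (fun x k => t * Kop alpha beta L x k)),
      (forall z0, L2 w z0 ->
         [/\ ode_solution w (Kop alpha beta L)
               (fun t => expK alpha beta L t z0),
             expK alpha beta L 0 z0 = z0 &
             forall z : R -> nat -> R,
               ode_solution w (Kop alpha beta L) z -> z 0 = z0 ->
               forall t, 0 <= t -> z t = expK alpha beta L t z0]),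
      (forall t, 0 <= t ->
         (forall i j, (1 <= i)%N -> (1 <= j)%N ->
            psi.-integrable `[0, +oo[
              (EFin \o pstar_fun alpha beta L t i j)) /\
         (forall x i, L2 w x -> (1 <= i)%N ->
            (fun n => \sum_(1 <= j < n) pstar alpha beta L psi t i j * x j)
              @ \oo --> expK alpha beta L t x i)) &
      sde_uniqueness P w (Kop alpha beta L) B Z0].

(* The matrix formula is read as matrix times vector: for each i the sum over
   j is taken outside of the integral in x.  J x is int_0^t e^{xs} dB_s, in a
   version which is jointly measurable in (x, om), so that it can be
   integrated in x. *)
Definition spectral_formula (R : realType) (alpha beta : R) (L : nat)
    (psi : probability (measurableTypeR R) R) (d : measure_display)
    (Omega : measurableType d) (P : probability Omega R)
    (B : nat -> R -> Omega -> R) (Z0 : Omega -> nat -> R)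
    (w : nat -> R) (t : R) (Zt : Omega -> nat -> R) : Prop :=
  let S := measure_support psi in
  exists J : R -> Omega -> nat -> R,
    [/\ (forall j, measurable_fun [set: (measurableTypeR R * Omega)%type]
                     (fun p => J p.1 p.2 j)),
        (forall x, S x ->
           stochastic_integral P w (v_tilde alpha beta L) B t
             (fun s y k => expR (x * s) * y k) (J x)) &
        {ae P, forall om, forall i, (1 <= i)%N ->
           (forall j, (1 <= j)%N ->
              psi.-integrable S (EFin \o fun x : R =>
                pstar_fun alpha beta L t i j x * (Z0 om j + J x om j))) /\
           (fun n => \sum_(1 <= j < n) pi_seq alpha beta L i *
              \int[psi]_(x in S)
                (pstar_fun alpha beta L t i j x * (Z0 om j + J x om j)))
             @ \oo --> Zt om i}].

Definition conclusion_b (R : realType) (alpha beta : R) (L : nat)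
    (psi : probability (measurableTypeR R) R) (d : measure_display)
    (Omega : measurableType d) (P : probability Omega R)
    (B : nat -> R -> Omega -> R) (Z0 : Omega -> nat -> R)
    (w : nat -> R) : Prop :=
  {ae P, forall om, L2 w (Z0 om)} ->
  [/\ (exists Z, sde_solution P w (Kop alpha beta L) B Z0 Z),
      sde_uniqueness P w (Kop alpha beta L) B Z0 &
      forall Z, sde_solution P w (Kop alpha beta L) B Z0 Z ->
      forall t, 0 <= t ->
        (exists Y, stochastic_integral P w (v_tilde alpha beta L) B t
                     (fun s => expK alpha beta L (t - s)) Y /\
           {ae P, forall om,
              Z t om = (fun k => expK alpha beta L t (Z0 om) k + Y om k)}) /\
        spectral_formula alpha beta L psi P B Z0 w t (Z t)].

(* Main.v *)
Require Import Defs.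
From HB Require Import structures.
From mathcomp Require Import all_boot all_order all_algebra.
From mathcomp Require Import all_classical all_reals all_analysis.
From mathcomp Require Import measurable_realfun.
From mathcomp Require Import zify ring lra.
Import Order.TTheory GRing.Theory Num.Theory.
Import numFieldNormedType.Exports.
Set Implicit Arguments.
Unset Strict Implicit.
Unset Printing Implicit Defensive.
Local Open Scope classical_set_scope.
Local Open Scope ring_scope.

(* Since K is tridiagonal and the weights vary at a controlled rate, every element of L2(w) is
   dominated by a sequence m of L2(w) with |K| m <= lam m coordinatewise.  Iterating the integral
   equation z = F + int K z then gives |z_t| <= e^(lam t) m as soon as |F| <= m, hence Picard
   existence, uniqueness, the exponential and the differential equation, all coordinate by
   coordinate.  For the spectral formula, pi_i int Q_i Q_j O_t dpsi solves, by the recurrence of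
   Q and orthogonality, the equation with forcing F(j) at j whenever O = F - x int O; one sums
   over j with the domination estimate, taking for O an Ornstein-Uhlenbeck path.  Almost all
   noise paths are dominated in L2(w) on bounded intervals by chaining over dyadic times with
   fourth moments, and the SDE is solved path by path.  The step function approximations of
   int e^(K(t-s)) dB_s are values of solutions driven by the noise frozen on dyadic intervals, so
   their convergence follows from the same estimate and the dyadic chaining bound. *)

(** Two features shape the argument. First, the rate [lam] depends on the weight only: a sequence of
    L2(w) is replaced by [sqrt (w N)] with N varying by a factor at most 2 per step, and the
    exponent 2L^k in the upper growth bound is the one for which [sqrt (w k / w k.+1)] is
    compensated by the birth rate, a multiple of rho^(L^k). Hence one [lam] serves all sequences,
    and estimates can be superposed and summed. Second, the equation is always read as an integral
    equation with a forcing F that may be rough in time, even a step function: initial values, noise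
    paths, frozen noise and truncation errors are all forcings, and comparing two solutions is an
    application of one stability bound. Probability enters mainly through the expected squared norm
    of the path dominations, which must be linear in v(k) so that the sum of v(k)/w(k) controls it,
    and through the choice of versions measurable in all variables. The spectral entries are bounded
    in the weight pi instead of w, so pi must be known to be tame whatever w is. *)

(** The integral of a nonnegative function is a supremum over the simple functions below it, so
    enlarging the function enlarges the set of competitors. *)
Lemma le_integral_nomeas d (T : measurableType d) (R : realType)
    (mu : {measure set T -> \bar R}) (D : set T) (f g : T -> \bar R) :
  (forall x, D x -> (0 <= f x)%E) -> (forall x, D x -> (f x <= g x)%E) ->
  (\int[mu]_(x in D) f x <= \int[mu]_(x in D) g x)%E.
Proof.
move=> f0 fg.
have g0 x : D x -> (0 <= g x)%E by move=> Dx; exact: le_trans (f0 _ Dx) (fg _ Dx).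
rewrite !ge0_integralE//; apply: le_ereal_sup => _ [h hf <-]; exists h => // x.
apply: le_trans (hf x) _; rewrite /patch; case: ifPn => //; rewrite inE; exact: fg.
Qed.

(** Tonelli applied to the positive and negative parts, then [fine]; the statement therefore covers
    parameters at which the section is not integrable. *)
Lemma measurable_Rintegral d d' (T : measurableType d) (T' : measurableType d')
    (R : realType) (m : {sigma_finite_measure set T' -> \bar R}) (f : T * T' -> R) :
  measurable_fun setT f ->
  measurable_fun setT (fun x : T => \int[m]_y f (x, y)).
Proof.
move=> mf.
rewrite [X in measurable_fun _ X](_ : _ = fun x : T =>
   fine ((\int[m]_y ((EFin \o f)^\+ (x, y))) - (\int[m]_y ((EFin \o f)^\- (x, y))))); last first.
  apply/funext => x; rewrite /Rintegral integralE; congr (fine (_ - _)%E).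
    by apply: eq_integral => y _; rewrite !funeposE.
  by apply: eq_integral => y _; rewrite !funenegE.
apply: measurableT_comp => //; apply: emeasurable_funB.
  apply: (@measurable_fun_fubini_tonelli_F _ _ _ _ _ m) => //.
  by apply: measurable_funepos; apply: measurableT_comp.
apply: (@measurable_fun_fubini_tonelli_F _ _ _ _ _ m) => //.
by apply: measurable_funeneg; apply: measurableT_comp.
Qed.

Lemma measurable_Rintegral_itv d (T : measurableType d) (R : realType)
    (f : T * R -> R) :
  measurable_fun setT f ->
  measurable_fun setT
    (fun p : T * R => \int[lebesgue_measure]_(s in `[0, p.2]) f (p.1, s)).
Proof.
move=> mf.
(* The variable upper endpoint becomes an indicator that is jointly measurable in the endpoint and
   the integration variable. *)
pose g (q : (T * R) * R) : R := f (q.1.1, q.2) * ((0 <= q.2) && (q.2 <= q.1.2))%:R.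
have mg : measurable_fun setT g.
  apply: measurable_funM.
    apply: measurableT_comp => //; apply/measurable_fun_pair => //.
    exact: measurableT_comp.
  apply: (@measurableT_comp _ _ _ _ _ _ (fun b : bool => b%:R : R)) => //.
  apply: measurable_and.
    by apply: measurable_fun_ler => //.
  by apply: measurable_fun_ler => //; exact: measurableT_comp.
rewrite [X in measurable_fun _ X](_ : _ = fun p : T * R =>
    \int[lebesgue_measure]_s g (p, s)); last first.
  apply/funext => p; rewrite Rintegral_mkcond; apply: eq_Rintegral => s _.
  rewrite patchE /g /=; case: ifPn; rewrite ?inE/= ?in_itv/= ?notin_setE/= ?in_itv/=;
    by [move=> ->; rewrite mulr1 | move=> /negP/negbTE ->; rewrite mulr0].
exact: (measurable_Rintegral lebesgue_measure mg).
Qed.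

(** The second variable is rounded down to a multiple of 2^-n: each approximation is a countable
    gluing of products, and continuity in s gives the pointwise limit. This is how noise paths
    become jointly measurable in time and chance. *)
Lemma measurable_caratheodory d (T : measurableType d) (R : realType)
    (f : T -> R -> R) :
  (forall s, measurable_fun setT (fun x => f x s)) ->
  (forall x, continuous (f x)) ->
  measurable_fun setT (fun p : T * R => f p.1 p.2).
Proof.
move=> mf cf.
pose z (n : nat) (s : R) : int := Num.floor (2 ^+ n * s).
pose g n (p : T * R) := f p.1 ((z n p.2)%:~R / 2 ^+ n).
apply: (@measurable_fun_cvg _ _ _ _ g) => [n|[x s] _ /=]; last first.
  apply: cvg_comp; last exact: cf.
  apply/cvgrPdist_le => e e0; near=> n.
  have p2 : 0 < (2 ^+ n : R) by rewrite exprn_gt0.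
  have /andP[h1 h2] := floor_itv (2 ^+ n * s).
  rewrite -(@ler_pM2r _ (2 ^+ n))// -[X in `|_| * X]gtr0_norm// -normrM mulrBl divfK ?gt_eqF//.
  rewrite mulrC ger0_norm ?subr_ge0//.
  apply: (@le_trans _ _ 1); first by move: h2; rewrite intrD /z; lra.
  rewrite -ler_pdivrMl// mulr1.
  have : n%:R <= (2 ^+ n : R) by rewrite -natrX ler_nat ltnW// ltn_expl.
  apply: le_trans.
  by near: n; apply: nbhs_infty_ger.
move=> _ Y mY; rewrite setTI.
rewrite (_ : _ @^-1` _ = \bigcup_(k in [set: int])
   (((fun x => f x (k%:~R / 2 ^+ n)) @^-1` Y) `*` (z n @^-1` [set k]))); last first.
  apply/seteqP; split => [[x s] /= Yg|[x s] [k _] [/= Yg zk]].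
    by exists (z n s).
  by rewrite /preimage/= /g /= zk.
apply: countable_bigcupT_measurable => // k; apply: measurableX.
  by rewrite -[X in measurable X]setTI; exact: mf.
rewrite (_ : _ @^-1` _ = `[k%:~R / 2 ^+ n, (k + 1)%:~R / 2 ^+ n[%classic)//.
have p2 : 0 < (2 ^+ n : R) by rewrite exprn_gt0.
apply/seteqP; split => s /=; rewrite in_itv/= /z ler_pdivrMr// ltr_pdivlMr// ![s * _]mulrC.
  by move=> <-; exact: floor_itv.
by move=> ?; exact: floor_def.
Unshelve. all: by end_near. Qed.

Lemma continuous_derive1 (R : realType) (F : R -> R) (x df : R) :
  is_derive x (1 : R) F df -> {for x, continuous F}.
Proof. by move=> [dF _]; apply/differentiable_continuous/derivable1_diffP. Qed.

Lemma Rintegral_FTC2 (R : realType) (F f : R -> R) (t : R) : 0 <= t ->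
  (forall x, 0 <= x <= t -> is_derive x (1 : R) F (f x)) ->
  (forall x, 0 <= x <= t -> {for x, continuous f}) ->
  \int[lebesgue_measure]_(s in `[0, t]) f s = F t - F 0.
Proof.
rewrite le_eqVlt => /predU1P[<- _ _|t0 dF cf].
  by rewrite set_itv1 Rintegral_set1 subrr.
have tt : 0 <= t <= t by rewrite (ltW t0) lexx.
have z0 : 0 <= (0 : R) <= t by rewrite lexx (ltW t0).
have oo x : x \in `]0, t[ -> is_derive x (1 : R) F (f x).
  by rewrite in_itv/= => /andP[h1 h2]; apply: dF; rewrite (ltW h1) (ltW h2).
rewrite /Rintegral (@continuous_FTC2 _ _ F)//=.
- by apply: continuous_in_subspaceT => x; rewrite inE/= in_itv/=; exact: cf.
- split.
  + by move=> x /oo[].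
  + by apply: cvg_at_right_filter; exact: continuous_derive1 (dF _ z0).
  + by apply: cvg_at_left_filter; exact: continuous_derive1 (dF _ tt).
- by move=> x /oo D; rewrite derive1E; apply: derive_val.
Qed.

Lemma continuous_integrable (R : realType) (f : R -> R) (a b : R) :
  continuous f -> lebesgue_measure.-integrable `[a, b] (EFin \o f).
Proof.
move=> cf; apply: continuous_compact_integrable; first exact: segment_compact.
exact: continuous_subspaceT.
Qed.

Lemma integrable_le_cst (R : realType) (f : R -> R) (M a b : R) :
  measurable_fun `[a, b] f -> (forall s, a <= s <= b -> `|f s| <= M) ->
  lebesgue_measure.-integrable `[a, b] (EFin \o f).
Proof.
move=> mf fM; apply: (@le_integrable _ _ _ _ _ _ _ (EFin \o cst M)) => //.
- exact/measurable_EFinP.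
- move=> s /=; rewrite in_itv/= => sab.
  by rewrite lee_fin (le_trans (fM _ sab))// ler_norm.
- by apply: continuous_integrable => ?; exact: cvg_cst.
Qed.

Lemma norm_Rintegral_le (R : realType) (f h : R -> R) (t : R) :
  measurable_fun `[0, t] f -> continuous h ->
  (forall s, 0 <= s <= t -> `|f s| <= h s) ->
  `|\int[lebesgue_measure]_(s in `[0, t]) f s| <=
    \int[lebesgue_measure]_(s in `[0, t]) h s.
Proof.
move=> mf ch fh.
have ih := @continuous_integrable _ h 0 t ch.
have if_ : lebesgue_measure.-integrable `[0, t] (EFin \o f).
  apply: (le_integrable _ _ _ ih) => //; first exact/measurable_EFinP.
  move=> s /=; rewrite in_itv/= => st; rewrite lee_fin.
  by rewrite (le_trans (fh _ st))// ler_norm.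
apply: (le_trans (le_normr_Rintegral _ if_)) => //.
by apply: le_Rintegral => //; exact: integrable_norm.
Qed.

Lemma is_derive_exp_sum (R : realType) (lam : R) (n : nat) (x : R) :
  is_derive x (1 : R) (fun s => \sum_(i < n.+1) (lam * s) ^+ i / i`!%:R)
    (lam * \sum_(i < n) (lam * x) ^+ i / i`!%:R).
Proof.
pose p : {poly R} := \sum_(i < n.+1) ((lam ^+ i / i`!%:R) *: 'X^i).
rewrite [X in is_derive _ _ X](_ : _ = horner p); last first.
  apply/funext => s; rewrite /p horner_sum; apply: eq_bigr => i _.
  by rewrite !hornerE exprMn mulrAC.
apply: is_derive_eq.
rewrite /p raddf_sum horner_sum big_ord_recl/= expr0 derivZ derivC scaler0 horner0 add0r.
rewrite mulr_sumr; apply: eq_bigr => i _.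
rewrite derivZ derivXn/= !hornerE /bump/= add1n factS natrM exprS exprMn.
by rewrite hornerMn hornerXn -mulr_natr; field; rewrite ?pnatr_eq0 ?nat1r ?pnatr_eq0 -?lt0n ?fact_gt0.
Qed.

(** One substitution of the integral equation into itself turns the n-th exponential sum into the
    next one; this and [Rintegral_exp_coeff] keep the iterated bounds in closed form. *)
Lemma Rintegral_exp_sum (R : realType) (lam t : R) (n : nat) : 0 <= t ->
  \int[lebesgue_measure]_(s in `[0, t]) (lam * \sum_(i < n) (lam * s) ^+ i / i`!%:R)
  = \sum_(i < n.+1) (lam * t) ^+ i / i`!%:R - 1.
Proof.
move=> t0; rewrite (Rintegral_FTC2 t0 (fun x _ => is_derive_exp_sum lam n x)).
  congr (_ - _); rewrite big_ord_recl/= expr0 divr1 big1 ?addr0// => i _.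
  by rewrite mulr0 expr0n mul0r.
case: n => [|n].
  have c0 : continuous (fun s : R => lam * \sum_(i < 0) (lam * s) ^+ i / i`!%:R).
    by under eq_fun do rewrite big_ord0 mulr0; move=> ?; exact: cvg_cst.
  by move=> x _; exact: c0.
move=> x _; apply: cvgM; first exact: cvg_cst.
exact: (continuous_derive1 (is_derive_exp_sum lam n x)).
Qed.

Lemma Rintegral_exp_coeff (R : realType) (lam t : R) (n : nat) : 0 <= t ->
  \int[lebesgue_measure]_(s in `[0, t]) (lam * ((lam * s) ^+ n / n`!%:R))
  = (lam * t) ^+ n.+1 / n.+1`!%:R.
Proof.
move=> t0.
have D m x : is_derive x (1 : R) (fun s => (lam * s) ^+ m.+1 / m.+1`!%:R)
    (lam * ((lam * x) ^+ m / m`!%:R)).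
  have := is_derive_exp_sum lam m.+1 x; have := is_derive_exp_sum lam m x.
  move=> D1 D2; have := is_deriveB D2 D1.
  rewrite (_ : _ - _ = (fun s => (lam * s) ^+ m.+1 / m.+1`!%:R)); last first.
    by apply/funext => s; rewrite addrfctE opprfctE big_ord_recr/= addrAC subrr add0r.
  by rewrite -mulrBr big_ord_recr/= addrAC subrr add0r.
rewrite (Rintegral_FTC2 t0 (fun x _ => D n x)).
  by rewrite mulr0 expr0n mul0r subr0.
move=> x _; apply: cvgM; first exact: cvg_cst.
case: n => [|n]; last exact: (continuous_derive1 (D n x)).
have c0 : continuous (fun s : R => (lam * s) ^+ 0 / 0`!%:R).
  by under eq_fun do rewrite expr0; move=> ?; exact: cvg_cst.
exact: c0.
Qed.

Lemma Rintegral_itv_cst (R : realType) (r t : R) : 0 <= t ->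
  \int[lebesgue_measure]_(s in `[0, t]) (cst r) s = r * t.
Proof.
move=> t0; have := Rintegral_exp_coeff r 0 t0.
by under eq_Rintegral do rewrite expr0 divr1 mulr1; rewrite expr1 divr1.
Qed.

Lemma continuous_exp_coeff (R : realType) (lam : R) (n : nat) :
  continuous (fun s : R => lam * ((lam * s) ^+ n / n`!%:R)).
Proof.
move=> x; apply: cvgM; first exact: cvg_cst.
apply: cvgM; last exact: cvg_cst.
apply: (@continuous_comp _ _ _ (fun s => lam * s) (fun x => x ^+ n)).
  by apply: cvgM; [exact: cvg_cst|exact: cvg_id].
exact: exprn_continuous.
Qed.

(** * Tridiagonal systems and tame bounds *)

Definition exp_tail (R : realType) (N : nat) (x : R) : R :=
  expR x - \sum_(i < N) x ^+ i / i`!%:R.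

Lemma cvg_exp_sum (R : realType) (x : R) :
  (fun N => \sum_(i < N) x ^+ i / i`!%:R) @ \oo --> expR x.
Proof.
rewrite /expR (_ : (fun N => _) = series (exp_coeff x)).
  exact: is_cvg_series_exp_coeff.
by apply/funext => N; rewrite /series/= big_mkord.
Qed.

Lemma exp_sum_le (R : realType) (x : R) N : 0 <= x ->
  \sum_(i < N) x ^+ i / i`!%:R <= expR x.
Proof.
move=> x0; rewrite -(cvg_lim _ (@cvg_exp_sum _ x))//.
apply: (@nondecreasing_cvgn_le _ (fun N => \sum_(i < N) x ^+ i / i`!%:R)); last first.
  exact: cvgP (@cvg_exp_sum _ x).
move=> n m nm; rewrite -!(big_mkord xpredT (fun i => x ^+ i / i`!%:R)).
rewrite (big_cat_nat (leq0n n) nm)//= lerDl sumr_ge0// => i _.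
by rewrite divr_ge0// exprn_ge0.
Qed.

Lemma cvg_exp_tail (R : realType) (x : R) :
  (fun N => exp_tail N x) @ \oo --> (0 : R).
Proof.
rewrite -[X in _ --> X](subrr (expR x)); apply: cvgB; first exact: cvg_cst.
exact: cvg_exp_sum.
Qed.

Lemma exp_tail_ge0 (R : realType) (x : R) N : 0 <= x -> 0 <= exp_tail N x.
Proof. by move=> x0; rewrite subr_ge0 exp_sum_le. Qed.

Section exp_dominated.
Variables (R : realType) (u : nat -> R) (c x : R).
Hypotheses (x0 : 0 <= x) (c0 : 0 <= c).
Hypothesis ux : forall n, `|u n| <= c * (x ^+ n / n`!%:R).

Lemma exp_dominated_cvg : cvgn (fun N => \sum_(n < N) u n).
Proof.
rewrite (_ : (fun N => _) = series u); last first.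
  by apply/funext => N; rewrite /series/= big_mkord.
apply: normed_cvg; apply: (@series_le_cvg _ _ (fun n => c * (x ^+ n / n`!%:R))) => //.
  by move=> n /=.
  by move=> n; rewrite mulr_ge0// divr_ge0// exprn_ge0.
apply: is_cvg_seriesZ; rewrite (_ : (fun n => _) = exp_coeff x)//.
exact: is_cvg_series_exp_coeff.
Qed.

(** Termwise comparison with the exponential series, shared by the Picard series and the operator
    exponential. With N = 0 it bounds the whole sum. *)
Lemma exp_dominated_tail N :
  `|limn (fun N => \sum_(n < N) u n) - \sum_(n < N) u n| <= c * exp_tail N x.
Proof.
have cu := exp_dominated_cvg.
have C : (fun m => `|\sum_(n < m) u n - \sum_(n < N) u n|) @ \oo -->
    `|limn (fun N => \sum_(n < N) u n) - \sum_(n < N) u n|.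
  by apply: cvg_norm; apply: cvgB => //; exact: cvg_cst.
rewrite -(cvg_lim _ C)//; apply: limr_le; first exact: cvgP C.
near=> m.
have Nm : (N <= m)%N by near: m; exact: nbhs_infty_ge.
rewrite -!(big_mkord xpredT u) (big_cat_nat (leq0n N) Nm)//= addrAC subrr add0r.
rewrite (le_trans (ler_norm_sum _ _ _))//.
rewrite (le_trans (ler_sum _ (fun i _ => ux i)))// -mulr_sumr ler_wpM2l//.
have := exp_sum_le m x0; rewrite /exp_tail.
rewrite -!(big_mkord xpredT (fun i => x ^+ i / i`!%:R)) (big_cat_nat (leq0n N) Nm)//=.
by rewrite lerBrDl.
Unshelve. all: by end_near. Qed.

End exp_dominated.

(** The lower diagonal is indexed by its column: [a j] is the entry (j+1, j). The coefficients are
    general because two operators are used: K itself, and -x times the identity for the scalar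
    integrals of e^(xs). *)
Definition tri (R : realType) (a c e : nat -> R) (x : nat -> R) : nat -> R :=
  fun k => if k is j.+1 then a j * x j + c k * x k + e k * x k.+1 else 0.

Section tridiagonal.
Variables (R : realType) (a c e : nat -> R).
Notation A := (tri a c e).
Notation absA := (tri (fun k => `|a k|) (fun k => `|c k|) (fun k => `|e k|)).

(* Such pointwise bounds replace operator norms on L2 w: if |x| <= m with m tame,
   then |e^(tA) x| <= e^(lam t) m in every coordinate. *)
Definition tame (lam : R) (m : nat -> R) : Prop :=
  (forall k, 0 <= m k) /\ (forall k, absA m k <= lam * m k).

Lemma tri_norm (x m : nat -> R) k : (forall k, `|x k| <= m k) ->
  `|A x k| <= absA m k.
Proof.
move=> xm; case: k => [|k] /=; first by rewrite normr0.
rewrite (le_trans (ler_normD _ _))// lerD//; last by rewrite normrM ler_wpM2l.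
by rewrite (le_trans (ler_normD _ _))// !normrM lerD// ler_wpM2l.
Qed.

Lemma tri_lin (r s : R) (x y : nat -> R) k :
  A (fun k => r * x k + s * y k) k = r * A x k + s * A y k.
Proof. by case: k => [|k] /=; ring. Qed.

Lemma triZ (r : R) (x : nat -> R) k : A (fun k => r * x k) k = r * A x k.
Proof. by case: k => [|k] /=; ring. Qed.

Lemma triB (x y : nat -> R) k : A (fun k => x k - y k) k = A x k - A y k.
Proof. by case: k => [|k] /=; ring. Qed.

Lemma tri_sum (N : nat) (x : nat -> nat -> R) k :
  A (fun k => \sum_(n < N) x n k) k = \sum_(n < N) A (x n) k.
Proof.
case: k => [|k] /=; first by rewrite big1.
by rewrite !big_split/= !mulr_sumr.
Qed.

Lemma tri_measurable d (T : measurableType d) (D : set T) (x : T -> nat -> R) k :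
  (forall k, measurable_fun D (fun p => x p k)) ->
  measurable_fun D (fun p => A (x p) k).
Proof.
move=> mx; case: k => [|k] /=; first exact: measurable_cst.
by apply: measurable_funD; [apply: measurable_funD|]; apply: measurable_funM.
Qed.

Lemma tame_lin lam m1 m2 r1 r2 : 0 <= r1 -> 0 <= r2 ->
  tame lam m1 -> tame lam m2 -> tame lam (fun k => r1 * m1 k + r2 * m2 k).
Proof.
move=> r10 r20 [m10 t1] [m20 t2]; split => [k|k].
  by rewrite addr_ge0// mulr_ge0.
have -> : absA (fun k => r1 * m1 k + r2 * m2 k) k = r1 * absA m1 k + r2 * absA m2 k.
  by case: k => [|k] /=; ring.
by rewrite mulrDr !(mulrCA lam) lerD// ler_wpM2l.
Qed.

Lemma tame_ge lam lam' m : lam <= lam' -> tame lam m -> tame lam' m.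
Proof.
move=> ll [m0 t]; split => // k; apply: (le_trans (t k)).
by rewrite ler_wpM2r.
Qed.

Lemma tame_norm lam m x k : tame lam m -> (forall k, `|x k| <= m k) ->
  `|A x k| <= lam * m k.
Proof. by move=> [_ t] xm; rewrite (le_trans (tri_norm k xm)). Qed.

Lemma tame_normZ lam m x k r : 0 <= r -> tame lam m -> (forall k, `|x k| <= r * m k) ->
  `|A x k| <= lam * r * m k.
Proof.
move=> r0 tm xm; rewrite -mulrA; apply: (@tame_norm lam (fun k => r * m k)) => //.
have := tame_lin r0 (lexx 0) tm tm.
by rewrite (_ : (fun k => _) = (fun k => r * m k))//; apply/funext => j; rewrite mul0r addr0.
Qed.

Definition solves (T : R) (F z : R -> nat -> R) : Prop :=
  forall k, measurable_fun `[0, T] (fun s => A (z s) k) /\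
    forall t, 0 <= t <= T ->
      z t k = F t k + \int[lebesgue_measure]_(s in `[0, t]) A (z s) k.

(* Substituting the equation n times into itself bounds the difference to the wanted
   estimate by a multiple of (lam t)^n / n! W: any tame a priori bound W will do. *)
Lemma stability (T lam M : R) (m W : nat -> R) (F z : R -> nat -> R) :
  0 <= lam -> 0 <= M -> tame lam m -> tame lam W -> solves T F z ->
  (forall t k, 0 <= t <= T -> `|F t k| <= m k) ->
  (forall t k, 0 <= t <= T -> `|z t k| <= M * W k) ->
  forall t k, 0 <= t <= T -> `|z t k| <= expR (lam * t) * m k.
Proof.
move=> l0 M0 tm tW sz Fm zW.
pose es n t := \sum_(i < n) (lam * t) ^+ i / i`!%:R.
have es0 n t : 0 <= t -> 0 <= es n t.
  move=> t0; apply: sumr_ge0 => i _.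
  by rewrite divr_ge0// exprn_ge0// mulr_ge0.
have H n : forall t k, 0 <= t <= T ->
    `|z t k| <= es n t * m k + M * ((lam * t) ^+ n / n`!%:R) * W k.
  elim: n => [|n IH] t k /andP[t0 tT].
    by rewrite /es big_ord0 mul0r add0r expr0 divr1 mulr1 zW// t0.
  have [mz ->] := sz k; last by rewrite t0.
  pose h s := m k * (lam * es n s) + M * W k * (lam * ((lam * s) ^+ n / n`!%:R)).
  have c1 : continuous (fun s => lam * es n s).
    case: n @h {IH} => [|n] h x; last first.
      apply: cvgM; first exact: cvg_cst.
      exact: (continuous_derive1 (is_derive_exp_sum lam n x)).
    by rewrite /es; under eq_fun do rewrite big_ord0; exact: cvg_cst.
  have c2 := @continuous_exp_coeff R lam n.
  have ch1 : continuous (fun s => m k * (lam * es n s)).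
    by move=> x; apply: cvgM; [exact: cvg_cst|exact: c1].
  have ch2 : continuous (fun s => M * W k * (lam * ((lam * s) ^+ n / n`!%:R))).
    by move=> x; apply: cvgM; [exact: cvg_cst|exact: c2].
  have ch : continuous h by move=> x; apply: cvgD; [exact: ch1|exact: ch2].
  have mzt : measurable_fun `[0, t] (fun s => A (z s) k).
    apply: measurable_funS mz => //.
    by apply: subset_itvl; rewrite bnd_simp.
  have hz s : 0 <= s <= t -> `|A (z s) k| <= h s.
    move=> /andP[s0 st]; have sT : 0 <= s <= T by rewrite s0 (le_trans st).
    have q0 : 0 <= (lam * s) ^+ n / n`!%:R.
      by rewrite divr_ge0// exprn_ge0// mulr_ge0.
    apply: (le_trans (tame_norm k (tame_lin (es0 n s s0) (mulr_ge0 M0 q0) tm tW) _)).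
      by move=> j; rewrite IH.
    by rewrite /h le_eqVlt; apply/orP; left; apply/eqP; ring.
  rewrite (le_trans (ler_normD _ _))//.
  apply: (le_trans (lerD (Fm _ _ _) (norm_Rintegral_le mzt ch hz))).
    by rewrite t0.
  rewrite /h RintegralD//; [|exact: continuous_integrable|exact: continuous_integrable].
  rewrite [X in _ + (X + _)]RintegralZl//; last exact: continuous_integrable.
  rewrite [X in _ + (_ + X)]RintegralZl//; last exact: continuous_integrable.
  rewrite Rintegral_exp_sum// Rintegral_exp_coeff//.
  by rewrite le_eqVlt; apply/orP; left; apply/eqP; rewrite /es; ring.
move=> t k tT; have /andP[t0 _] := tT; have [m0 _] := tm; have [W0 _] := tW.
apply/ler_addgt0Pr => eps eps0.
have C : (fun n => M * ((lam * t) ^+ n / n`!%:R) * W k) @ \oo --> (0 : R).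
  rewrite [X in _ --> X](_ : 0 = M * 0 * W k); last by rewrite mulr0 mul0r.
  apply: cvgM; last exact: cvg_cst.
  apply: cvgM; first exact: cvg_cst.
  exact: cvg_exp_coeff.
move/cvgrPdist_le : C => /(_ _ eps0)[n _ /(_ n (leqnn n))/= hn].
rewrite (le_trans (H n t k tT))// lerD//.
  by rewrite ler_wpM2r// exp_sum_le// mulr_ge0.
by move: hn; rewrite sub0r normrN; apply: le_trans; exact: ler_norm.
Qed.

End tridiagonal.

(** * Picard iteration, jointly measurable in time and a parameter *)

Section picard.
Context d (T : measurableType d) (R : realType).
Variables (a c e : nat -> R) (lam : R) (F : T -> R -> nat -> R).
Notation A := (tri a c e).
Hypothesis lam0 : 0 <= lam.
Hypothesis mF : forall k, measurable_fun setT (fun p : T * R => F p.1 p.2 k).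
Hypothesis Fbd : forall x (tau : R), exists2 m,
  tame a c e lam m & forall t k, 0 <= t <= tau -> `|F x t k| <= m k.

(** The parameter [x] runs over a measurable space, the probability space for the SDE and [unit] for
    the exponential, so that solutions come out measurable in the parameter. *)
Fixpoint picard_term (n : nat) (x : T) (t : R) (k : nat) : R :=
  if n is n'.+1 then \int[lebesgue_measure]_(s in `[0, t]) A (picard_term n' x s) k
  else F x t k.

Definition picard (x : T) (t : R) (k : nat) : R :=
  limn (fun N => \sum_(n < N) picard_term n x t k).

Lemma picard_term_measurable n k :
  measurable_fun setT (fun p : T * R => picard_term n p.1 p.2 k).
Proof.
elim: n k => [//|n IH] k /=.
by apply: (measurable_Rintegral_itv (f := fun p : T * R => A (picard_term n p.1 p.2) k));
  apply: tri_measurable.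
Qed.

Lemma measurable_picard_term_t n x k (D : set R) :
  measurable_fun D (fun t => picard_term n x t k).
Proof.
apply: (@measurable_funS _ _ _ _ setT) => //.
exact: (measurable_fun_pair2 x (picard_term_measurable n k)).
Qed.

Lemma picard_term_le x (tau : R) m : tame a c e lam m ->
  (forall t k, 0 <= t <= tau -> `|F x t k| <= m k) ->
  forall n t k, 0 <= t <= tau ->
    `|picard_term n x t k| <= m k * ((lam * t) ^+ n / n`!%:R).
Proof.
move=> tm Fm; elim=> [|n IH] t k /andP[t0 tT] /=.
  by rewrite expr0 divr1 mulr1 Fm// t0.
have c2 := @continuous_exp_coeff R lam n.
have c3 : continuous (fun s => m k * (lam * ((lam * s) ^+ n / n`!%:R))).
  by move=> y; apply: cvgM; [exact: cvg_cst|exact: c2].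
apply: (le_trans (norm_Rintegral_le _ c3 _)).
- by apply: tri_measurable => j; exact: measurable_picard_term_t.
- move=> s /andP[s0 st].
  have q0 : 0 <= (lam * s) ^+ n / n`!%:R.
    by rewrite divr_ge0// exprn_ge0// mulr_ge0.
  apply: (le_trans (tame_normZ k q0 tm _)); last by rewrite mulrC.
  by move=> j; rewrite mulrC IH// s0 (le_trans st).
rewrite RintegralZl//; last exact: continuous_integrable.
by rewrite Rintegral_exp_coeff.
Qed.

Lemma picard_term_le_uniform x (tau : R) m : tame a c e lam m ->
  (forall t k, 0 <= t <= tau -> `|F x t k| <= m k) ->
  forall n t k, 0 <= t <= tau ->
    `|picard_term n x t k| <= m k * ((lam * tau) ^+ n / n`!%:R).
Proof.
move=> tm Fm n t k /[dup] /andP[t0 tT] ht; have [m0 _] := tm.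
apply: (le_trans (picard_term_le tm Fm _ _ ht)); rewrite ler_wpM2l//.
by rewrite ler_pM2r ?invr_gt0 ?ltr0n ?fact_gt0// lerXn2r ?nnegrE ?mulr_ge0 ?ler_wpM2l// (le_trans t0).
Qed.

(** For negative t the interval [[0, t]] is empty, all terms but the first vanish and the limit is
    the forcing. Convergence at every time is what makes [picard] measurable on the whole
    product. *)
Lemma picard_cvg x t k :
  (fun N => \sum_(n < N) picard_term n x t k) @ \oo --> picard x t k.
Proof.
have [t0|t0] := leP 0 t.
  have [m tm Fm] := Fbd x t; have [m0 _] := tm.
  have ht : 0 <= t <= t by rewrite t0 lexx.
  exact: (exp_dominated_cvg (mulr_ge0 lam0 t0) (m0 k)
    (fun n => picard_term_le_uniform tm Fm n k ht)).
apply: (@cvgP _ _ (F x t k)); apply/cvg_ballP => eps eps0.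
near=> N.
have N0 : (0 < N)%N by near: N; exact: nbhs_infty_gt.
rewrite -(prednK N0) big_ord_recl/= big1 ?addr0; first exact: ballxx.
move=> i _; rewrite set_itv_ge ?bnd_simp -?ltNge//.
by rewrite Rintegral_set0.
Unshelve. all: by end_near. Qed.

Lemma picard_measurable k :
  measurable_fun setT (fun p : T * R => picard p.1 p.2 k).
Proof.
apply: (@measurable_fun_cvg _ _ _ _
  (fun N (p : T * R) => \sum_(n < N) picard_term n p.1 p.2 k)).
  by move=> N; apply: measurable_sum => i; exact: picard_term_measurable.
by move=> p _; exact: picard_cvg.
Qed.

Lemma picard_tail x (tau : R) m : tame a c e lam m ->
  (forall t k, 0 <= t <= tau -> `|F x t k| <= m k) ->
  forall N t k, 0 <= t <= tau ->
    `|picard x t k - \sum_(n < N) picard_term n x t k| <= m k * exp_tail N (lam * tau).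
Proof.
move=> tm Fm N t k ht; have [m0 _] := tm; have /andP[t0 tT] := ht.
apply: (exp_dominated_tail (u := fun n => picard_term n x t k)) => //.
  by rewrite mulr_ge0// (le_trans t0).
by move=> n; exact: picard_term_le_uniform.
Qed.

Lemma picard_le x (tau : R) m : tame a c e lam m ->
  (forall t k, 0 <= t <= tau -> `|F x t k| <= m k) ->
  forall t k, 0 <= t <= tau -> `|picard x t k| <= expR (lam * tau) * m k.
Proof.
move=> tm Fm t k ht; have := picard_tail tm Fm 0 k ht.
by rewrite /exp_tail !big_ord0 !subr0 mulrC.
Qed.

(** The partial sums satisfy S(N+1) = F + int A S(N). Both sides converge, the integral because the
    tail bound is uniform on [[0, tau]] and A maps m to at most [lam] m. *)
Lemma picard_solves x (tau : R) : solves a c e tau (F x) (picard x).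
Proof.
have [m tm Fm] := Fbd x tau; have [m0 _] := tm.
have mp (j : nat) (D : set R) : measurable_fun D (fun t => picard x t j).
  apply: (@measurable_funS _ _ _ _ setT) => //.
  exact: (measurable_fun_pair2 x (picard_measurable j)).
move=> k; split; first by apply: tri_measurable => j; exact: mp.
move=> t ht; have /andP[t0 tT] := ht; have tau0 := le_trans t0 tT.
pose S N s j := \sum_(n < N) picard_term n x s j.
have trS N s : A (S N s) k = \sum_(n < N) A (picard_term n x s) k.
  exact: (tri_sum a c e N (fun n j => picard_term n x s j) k).
have iT n : lebesgue_measure.-integrable `[0, t] (EFin \o fun s => A (picard_term n x s) k).
  apply: (@integrable_le_cst _ _ (lam * ((lam * tau) ^+ n / n`!%:R) * m k)).
    by apply: tri_measurable => j; exact: measurable_picard_term_t.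
  move=> s /andP[s0 st]; apply: tame_normZ => //.
    by rewrite divr_ge0// exprn_ge0// mulr_ge0.
  by move=> j; rewrite mulrC (picard_term_le_uniform tm Fm)// s0 (le_trans st).
have SE N : S N.+1 t k = F x t k + \int[lebesgue_measure]_(s in `[0, t]) A (S N s) k.
  rewrite {1}/S big_ord_recl; congr (_ + _).
  elim: N => [|N IH].
    rewrite big_ord0 (_ : (fun s => _) = cst 0).
      by rewrite Rintegral_cst// mul0r.
    by apply/funext => s; rewrite trS big_ord0.
  rewrite big_ord_recr IH /=.
  rewrite -RintegralD//; last first.
    rewrite (_ : _ \o _ = fun s => (\sum_(n < N) (A (picard_term n x s) k)%:E)%E).
      by apply: integrable_sum => // i _; exact: iT.
    by apply/funext => s /=; rewrite trS sumEFin.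
  by apply: eq_Rintegral => s _; rewrite !trS big_ord_recr.
have C1 : (fun N => S N.+1 t k) @ \oo --> picard x t k.
  have := @picard_cvg x t k.
  by rewrite -(cvg_shiftS (fun N => \sum_(n < N) picard_term n x t k)).
have C2 : (fun N => S N.+1 t k) @ \oo -->
    F x t k + \int[lebesgue_measure]_(s in `[0, t]) A (picard x s) k.
  under eq_fun do rewrite SE.
  apply: cvgD; first exact: cvg_cst.
  apply/cvgrPdist_le => eps eps0.
  have C : (fun N => lam * exp_tail N (lam * tau) * m k * t) @ \oo --> (0 : R).
    rewrite [X in _ --> X](_ : 0 = lam * 0 * m k * t); last by rewrite mulr0 !mul0r.
    do 2 (apply: cvgM; last exact: cvg_cst).
    by apply: cvgM; [exact: cvg_cst|exact: cvg_exp_tail].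
  move/cvgrPdist_le : C => /(_ _ eps0); apply: filterS => N hN.
  have bS s : 0 <= s <= t -> forall j, `|picard x s j - S N s j| <= exp_tail N (lam * tau) * m j.
    by move=> /andP[s0 st] j; rewrite mulrC (picard_tail tm Fm)// s0 (le_trans st).
  have mS j (D : set R) : measurable_fun D (fun s => S N s j).
    by apply: measurable_sum => i; exact: measurable_picard_term_t.
  rewrite -RintegralB//; last 2 first.
    apply: (@integrable_le_cst _ _ (lam * expR (lam * tau) * m k)).
      by apply: tri_measurable => j; exact: mp.
    move=> s /andP[s0 st]; apply: tame_normZ => //.
    by move=> j; apply: (picard_le tm Fm); rewrite s0 (le_trans st).
    rewrite (_ : _ \o _ = fun s => (\sum_(n < N) (A (picard_term n x s) k)%:E)%E).
      by apply: integrable_sum => // i _; exact: iT.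
    by apply/funext => s /=; rewrite trS sumEFin.
  have ch : continuous (fun _ : R => lam * exp_tail N (lam * tau) * m k).
    by move=> ?; exact: cvg_cst.
  have e0 : 0 <= exp_tail N (lam * tau) by rewrite exp_tail_ge0// mulr_ge0.
  apply: (le_trans (norm_Rintegral_le _ ch _)).
  - apply: measurable_funB; apply: tri_measurable => j; [exact: mp|exact: mS].
  - move=> s hs; rewrite -triB; apply: tame_normZ => //; exact: bS.
  rewrite Rintegral_itv_cst//.
  move: hN; rewrite sub0r normrN; apply: le_trans.
  exact: ler_norm.
exact: (cvg_unique _ C1 C2).
Qed.

End picard.

(** * Weighted square-summable sequences *)

Section weighted_l2.
Variables (R : realType) (w : nat -> R).
Hypothesis w_gt0 : forall k, (1 <= k)%N -> 0 < w k.

(** The value [w 0] is arbitrary; forcing the term at 0 to vanish allows series indexed by all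
    naturals. *)
Definition L2term (x : nat -> R) (k : nat) : R :=
  if k is 0%N then 0 else x k ^+ 2 / w k.

Lemma L2term_ge0 x k : 0 <= L2term x k.
Proof. by case: k => [//|k] /=; rewrite divr_ge0 ?sqr_ge0// ltW// w_gt0. Qed.

Lemma L2sqnormE x : L2sqnorm w x = (\sum_(k <oo) (L2term x k)%:E)%E.
Proof.
rewrite /L2sqnorm eseries_cond eseries_mkcond; apply: eq_eseriesr => k _.
by case: k.
Qed.

Lemma L2sqnorm_ge0 x : (0 <= L2sqnorm w x)%E.
Proof. by rewrite L2sqnormE; apply: nneseries_ge0 => k _ _; rewrite lee_fin L2term_ge0. Qed.

Lemma L2sqnorm_le x y (C : R) : 0 <= C ->
  (forall k, (1 <= k)%N -> `|x k| <= C * y k) ->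
  (L2sqnorm w x <= (C ^+ 2)%:E * L2sqnorm w y)%E.
Proof.
move=> C0 xy; rewrite !L2sqnormE -nneseriesZl; last first.
  by move=> k _; rewrite lee_fin L2term_ge0.
apply: lee_nneseries => k _ /=; first by rewrite lee_fin L2term_ge0.
rewrite -EFinM lee_fin; case: k => [|k] /=; first by rewrite mulr0.
rewrite mulrA ler_pM2r ?invr_gt0 ?w_gt0// -exprMn -real_normK ?num_real//.
by rewrite lerXn2r ?nnegrE ?xy// (le_trans _ (xy k.+1 _)).
Qed.

Lemma L2_dom x y (C : R) : 0 <= C -> x 0%N = 0 ->
  (forall k, (1 <= k)%N -> `|x k| <= C * y k) -> (L2sqnorm w y < +oo)%E -> L2 w x.
Proof.
move=> C0 x0 xy yoo; split => //; apply: le_lt_trans (L2sqnorm_le C0 xy) _.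
by rewrite lte_mul_pinfty// lee_fin sqr_ge0.
Qed.

Lemma L2sqnorm_fin x : (L2sqnorm w x < +oo)%E -> L2sqnorm w x = (L2norm w x ^+ 2)%:E.
Proof.
move=> h; rewrite /L2norm sqr_sqrtr; first by rewrite fineK// ge0_fin_numE// L2sqnorm_ge0.
by rewrite fine_ge0// L2sqnorm_ge0.
Qed.

Lemma L2norm_le x (C : R) : 0 <= C -> (L2sqnorm w x <= (C ^+ 2)%:E)%E -> L2norm w x <= C.
Proof.
move=> C0 h; have := le_lt_trans h (ltry _) => /L2sqnorm_fin e.
by move: h; rewrite e lee_fin ler_sqr// nnegrE// sqrtr_ge0.
Qed.

Lemma L2norm_dom x y z (C D : R) : 0 <= C -> 0 <= D ->
  (forall k, (1 <= k)%N -> `|x k| <= C * y k) ->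
  (L2sqnorm w y <= (D ^+ 2)%:E * L2sqnorm w z)%E -> (L2sqnorm w z < +oo)%E ->
  L2norm w x <= C * D * L2norm w z.
Proof.
move=> C0 D0 xy yz zoo; apply: L2norm_le.
  by rewrite !mulr_ge0// sqrtr_ge0.
apply: (le_trans (L2sqnorm_le C0 xy)).
rewrite [X in (_ <= X)%E](_ : _ = (C ^+ 2)%:E * ((D ^+ 2)%:E * L2sqnorm w z))%E.
  by rewrite lee_wpmul2l// lee_fin sqr_ge0.
by rewrite (L2sqnorm_fin zoo) -!EFinM !exprMn mulrA.
Qed.

Lemma L2_coord x k : L2 w x -> (1 <= k)%N ->
  `|x k| <= Num.sqrt (w k) * L2norm w x.
Proof.
move=> [x0 xoo] k1; have wk := w_gt0 k1.
rewrite /L2norm -sqrtrM ?(ltW wk)// -sqrtr_sqr ler_wsqrtr// mulrC -ler_pdivrMr//.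
rewrite -lee_fin fineK ?ge0_fin_numE ?L2sqnorm_ge0//.
rewrite L2sqnormE; have := @nneseries_lim_ge R (fun k => (L2term x k)%:E) xpredT 0 k.+1.
rewrite big_nat_recr//= => h; apply: le_trans (h _); last first.
  by move=> *; rewrite lee_fin L2term_ge0.
rewrite -[leLHS]add0e leeD//.
  by apply: sume_ge0 => i _; rewrite lee_fin L2term_ge0.
by case: k k1 {wk h}.
Qed.

Lemma L2_lin (r s : R) x y : L2 w x -> L2 w y -> L2 w (fun k => r * x k + s * y k).
Proof.
move=> [x0 xoo] [y0 yoo]; split; first by rewrite x0 y0 !mulr0 addr0.
apply: (@le_lt_trans _ _ ((2 * r ^+ 2)%:E * L2sqnorm w x + (2 * s ^+ 2)%:E * L2sqnorm w y)%E).
  rewrite !L2sqnormE -!nneseriesZl; try by move=> k _; rewrite lee_fin L2term_ge0.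
  have q0 (a : R) : 0 <= 2 * a ^+ 2 by rewrite mulr_ge0// sqr_ge0.
  rewrite -nneseriesD; try by move=> k _ _; rewrite mule_ge0// lee_fin ?L2term_ge0.
  apply: lee_nneseries => k _ /=; first by rewrite lee_fin L2term_ge0.
  rewrite -!EFinM -EFinD lee_fin; case: k => [|k] /=; first by rewrite !mulr0 addr0.
  rewrite !mulrA -mulrDl ler_pM2r ?invr_gt0 ?w_gt0//.
  by have := sqr_ge0 (r * x k.+1 - s * y k.+1); nra.
by rewrite lte_add_pinfty// lte_mul_pinfty// lee_fin mulr_ge0// sqr_ge0.
Qed.

Lemma L2_sub x y : L2 w x -> L2 w y -> L2 w (fun k => x k - y k).
Proof.
move=> Lx Ly; have := L2_lin 1 (-1) Lx Ly.
by under eq_fun do rewrite mul1r mulN1r.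
Qed.

Lemma L2_add x y : L2 w x -> L2 w y -> L2 w (fun k => x k + y k).
Proof.
move=> Lx Ly; have := L2_lin 1 1 Lx Ly.
by under eq_fun do rewrite !mul1r.
Qed.

(* Truncated subtraction: the exponent is |k - j|. *)
Let g (k j : nat) : R := (2 ^+ (k - j + (j - k)))^-1.

Let g_ge0 k j : 0 <= g k j.
Proof. by rewrite invr_ge0 exprn_ge0. Qed.

Let gS k j : g k.+1 j <= 2 * g k j /\ g k j <= 2 * g k.+1 j.
Proof.
rewrite /g; have p (n : nat) : 0 < (2 ^+ n : R) by rewrite exprn_gt0.
have e (n : nat) : 2 * (2 ^+ n.+1 : R)^-1 = (2 ^+ n)^-1.
  by rewrite exprS; field; rewrite gt_eqF.
have l (n : nat) : (2 ^+ n.+1 : R)^-1 <= 2 * (2 ^+ n)^-1.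
  by have := p n.+1; rewrite -invr_gt0 -(e n); lra.
have [kj|jk] := ltnP k j.
  have -> : (k - j + (j - k) = (k.+1 - j + (j - k.+1)).+1)%N by lia.
  by rewrite e l.
have -> : (k.+1 - j + (j - k.+1) = (k - j + (j - k)).+1)%N by lia.
by rewrite e l.
Qed.

Let sum_g j n : \sum_(0 <= k < n) g k j <= 3.
Proof.
(* [h n] is the partial sum of the two-sided geometric series plus 2^-j, which gives one induction
   hypothesis valid on both sides of j. *)
pose h n := if (n <= j)%N then (2 ^+ (j - n))^-1 else 3 - 2 * (2 ^+ (n - j))^-1 : R.
have p (m : nat) : 0 < (2 ^+ m : R)^-1 by rewrite invr_gt0 exprn_gt0.
have e (m : nat) : 2 * (2 ^+ m.+1 : R)^-1 = (2 ^+ m)^-1.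
  by rewrite exprS; field; rewrite gt_eqF// exprn_gt0.
apply: (@le_trans _ _ (h n)); last first.
  rewrite /h; case: ifPn => _; last by have := p (n - j)%N; lra.
  by rewrite (@le_trans _ _ 1)//; [rewrite invf_le1 ?exprn_gt0// exprn_ege1// ler1n|lra].
elim: n => [|n IH].
  by rewrite big_nil /h leq0n ltW.
rewrite big_nat_recr//= (le_trans (lerD IH (lexx _)))// /h /g.
have [nj|jn] := ltnP n j.
  rewrite (ltnW nj).
  have -> : (n - j + (j - n) = (j - n.+1).+1)%N by lia.
  have -> : (j - n = (j - n.+1).+1)%N by lia.
  by have := e (j - n.+1)%N; lra.
have -> : (n.+1 - j = (n - j).+1)%N by lia.
have -> : (n - j + (j - n) = n - j)%N by lia.
have := e (n - j)%N; case: ifPn => [nj|_]; last by lra.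
have -> : (j - n = 0)%N by lia.
have -> : (n - j = 0)%N by lia.
by rewrite !expr0; lra.
Qed.

(* Smoothing x j ^+ 2 / w j by the kernel g costs a factor 3 in squared norm and yields a
   profile varying by a factor at most 2, which weight_growth turns into a tame bound. *)
Definition majorant (x : nat -> R) (k : nat) : R :=
  if k is 0%N then 0 else
    Num.sqrt (w k * fine (\sum_(j <oo) (g k j * L2term x j)%:E)%E).

Let G x k := (\sum_(j <oo) (g k j * L2term x j)%:E)%E.

Let G_le x k C : 0 <= C -> (forall j, g k j <= C) ->
  (G x k <= C%:E * L2sqnorm w x)%E.
Proof.
move=> C0 gC; rewrite L2sqnormE -nneseriesZl; last first.
  by move=> j _; rewrite lee_fin L2term_ge0.
apply: lee_nneseries => j _ /=; rewrite lee_fin.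
  by rewrite mulr_ge0// L2term_ge0.
by rewrite ler_wpM2r// L2term_ge0.
Qed.

Let G_ge0 x k : (0 <= G x k)%E.
Proof. by apply: nneseries_ge0 => j _ _; rewrite lee_fin mulr_ge0// L2term_ge0. Qed.

Let G_fin x k : (L2sqnorm w x < +oo)%E -> G x k = (fine (G x k))%:E.
Proof.
move=> xoo; rewrite fineK// ge0_fin_numE ?G_ge0//.
apply: le_lt_trans (G_le x ler01 _) _; last by rewrite mul1e.
by move=> j; rewrite /g invf_le1 ?exprn_gt0// exprn_ege1// ler1n.
Qed.

Let GS x k : (L2sqnorm w x < +oo)%E ->
  fine (G x k.+1) <= 2 * fine (G x k) /\ fine (G x k) <= 2 * fine (G x k.+1).
Proof.
move=> xoo; have G2 a b : (forall j, g a j <= 2 * g b j) -> fine (G x a) <= 2 * fine (G x b).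
  move=> h; rewrite -lee_fin EFinM -!G_fin// -nneseriesZl; last first.
    by move=> j _; rewrite lee_fin mulr_ge0// L2term_ge0.
  apply: lee_nneseries => j _ /=; first by rewrite lee_fin mulr_ge0// L2term_ge0.
  by rewrite lee_fin mulrA ler_wpM2r// L2term_ge0.
by split; apply: G2 => j; have [] := gS k j.
Qed.

Lemma majorant_ge x k : L2 w x -> `|x k| <= majorant x k.
Proof.
move=> [x0 xoo]; case: k => [|k] /=; first by rewrite x0 normr0.
rewrite -sqrtr_sqr ler_wsqrtr// mulrC -ler_pdivrMr ?w_gt0//.
rewrite -lee_fin -G_fin//.
have := @nneseries_lim_ge R (fun j => (g k.+1 j * L2term x j)%:E) xpredT 0 k.+2.
rewrite big_nat_recr//= => h; apply: le_trans (h _); last first.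
  by move=> *; rewrite lee_fin mulr_ge0// L2term_ge0.
rewrite -[leLHS]add0e leeD//.
  by apply: sume_ge0 => i _; rewrite lee_fin mulr_ge0// L2term_ge0.
by rewrite /g subnn expr0 invr1 mul1r.
Qed.

(** After exchanging the two sums, each [L2term x j] is collected with total weight at most 3, by
    [sum_g]. *)
Lemma majorant_sqnorm x : (L2sqnorm w x < +oo)%E ->
  (L2sqnorm w (majorant x) <= 3%:E * L2sqnorm w x)%E.
Proof.
move=> xoo; rewrite L2sqnormE; apply: lime_le.
  by apply: is_cvg_nneseries => *; rewrite lee_fin L2term_ge0.
apply: nearW => n.
apply: (@le_trans _ _ (\sum_(0 <= k < n) G x k)%E).
  apply: lee_sum => k _; rewrite G_fin// lee_fin; case: k => [|k] /=.
    by rewrite fine_ge0.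
  rewrite sqr_sqrtr; last by rewrite mulr_ge0 ?fine_ge0 ?G_ge0// ltW// w_gt0.
  by rewrite mulrAC divff ?mul1r// gt_eqF// w_gt0.
rewrite -nneseries_sum_nat; last by move=> *; rewrite lee_fin mulr_ge0// L2term_ge0.
rewrite L2sqnormE -nneseriesZl; last by move=> k _; rewrite lee_fin L2term_ge0.
apply: lee_nneseries => j _ /=.
  by move=> _; apply: sume_ge0 => *; rewrite lee_fin mulr_ge0// L2term_ge0.
by rewrite sumEFin lee_fin -mulr_suml ler_wpM2r// L2term_ge0.
Qed.

(** Writing a majorant as the root of w N separates the weight from the sequence: the rate of
    tameness depends on w and the factor 2 only. The constant N = 1 is slow too and dominates every
    element of L2(w) up to its norm. *)
Definition slow (N : nat -> R) : Prop :=
  forall k, [/\ 0 <= N k, N k.+1 <= 2 * N k & N k <= 2 * N k.+1].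

Definition sqrt_weight (N : nat -> R) (k : nat) : R :=
  if k is 0%N then 0 else Num.sqrt (w k * N k).

Lemma majorantE x : (L2sqnorm w x < +oo)%E ->
  exists2 N, slow N & majorant x = sqrt_weight N.
Proof.
move=> xoo; exists (fun k => fine (G x k)) => [k|]; last by apply/funext; case.
by have [? ?] := GS k xoo; split => //; rewrite fine_ge0.
Qed.

End weighted_l2.

(** * Bounded solutions: superposition, comparison and uniqueness *)

Section solutions.
Variables (R : realType) (a c e : nat -> R) (lam : R).
Notation A := (tri a c e).
Notation tame := (tame a c e lam).
Hypothesis lam0 : 0 <= lam.

Definition bounded_on (T : R) (z : R -> nat -> R) : Prop :=
  exists M W, [/\ 0 <= M, tame W & forall t k, 0 <= t <= T -> `|z t k| <= M * W k].

(** The a priori bound that [stability] asks for travels with the equation, and the pair is closed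
    under linear combinations; comparing two solutions then means applying [bsolves_le] to their
    difference. *)
Definition bsolves (T : R) (F z : R -> nat -> R) : Prop :=
  solves a c e T F z /\ bounded_on T z.

Lemma bsolves_integrable T F z k t : bsolves T F z -> t <= T ->
  lebesgue_measure.-integrable `[0, t] (EFin \o fun s => A (z s) k).
Proof.
move=> [sz [M [W [M0 tW zW]]]] tT; have [mz _] := sz k.
apply: (@integrable_le_cst _ _ (lam * M * W k)).
  by apply: measurable_funS mz => //; apply: subset_itvl; rewrite bnd_simp.
move=> s /andP[s0 st]; apply: tame_normZ => // j.
by rewrite zW// s0 (le_trans st).
Qed.

Lemma bsolves_lin T r1 r2 F1 F2 z1 z2 : bsolves T F1 z1 -> bsolves T F2 z2 ->
  bsolves T (fun t k => r1 * F1 t k + r2 * F2 t k) (fun t k => r1 * z1 t k + r2 * z2 t k).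
Proof.
move=> b1 b2; have [s1 [M1 [W1 [M10 tW1 zW1]]]] := b1; have [s2 [M2 [W2 [M20 tW2 zW2]]]] := b2.
split; last first.
  exists 1, (fun k => (`|r1| * M1) * W1 k + (`|r2| * M2) * W2 k); split=> [//||t k ht].
    by apply: tame_lin => //; rewrite mulr_ge0.
  rewrite mul1r (le_trans (ler_normD _ _))// !normrM -!mulrA.
  by rewrite lerD// ler_wpM2l// ?zW1 ?zW2.
move=> k; have [m1 e1] := s1 k; have [m2 e2] := s2 k.
have AE s : A (fun k => r1 * z1 s k + r2 * z2 s k) k = r1 * A (z1 s) k + r2 * A (z2 s) k.
  exact: tri_lin.
split.
  rewrite (_ : (fun s => _) = (fun s => r1 * A (z1 s) k + r2 * A (z2 s) k)); last exact/funext.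
  by apply: measurable_funD; apply: measurable_funM.
move=> t ht; have /andP[t0 tT] := ht; rewrite e1// e2//.
rewrite [X in _ = _ + X](_ : _ = \int[lebesgue_measure]_(s in `[0, t])
  (r1 * A (z1 s) k + r2 * A (z2 s) k)); last by apply: eq_Rintegral => s _; exact: AE.
have i1 := bsolves_integrable k b1 tT; have i2 := bsolves_integrable k b2 tT.
have i1' : lebesgue_measure.-integrable `[0, t] (EFin \o fun s => r1 * A (z1 s) k).
  exact: (integrableZl _ r1 i1).
have i2' : lebesgue_measure.-integrable `[0, t] (EFin \o fun s => r2 * A (z2 s) k).
  exact: (integrableZl _ r2 i2).
rewrite RintegralD// !RintegralZl//; ring.
Qed.

Lemma bsolves_sum (N : nat) T (F z : nat -> R -> nat -> R) : (exists W, tame W) ->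
  (forall n, bsolves T (F n) (z n)) ->
  bsolves T (fun t k => \sum_(n < N) F n t k) (fun t k => \sum_(n < N) z n t k).
Proof.
move=> [W tW] bz; elim: N => [|N IH].
  split; last first.
    exists 0, W; split=> // t k _; by rewrite big_ord0 normr0 mul0r.
  have A0 (s : R) k : A (fun k => \sum_(n < 0) z n s k) k = 0.
    by rewrite (tri_sum a c e 0 (fun n k => z n s k)) big_ord0.
  move=> k; split; first by rewrite (_ : (fun s => _) = cst 0)//; apply/funext => s; exact: A0.
  move=> t /andP[t0 _]; rewrite [X in _ = _ + X](_ : _ = \int[lebesgue_measure]_(s in `[0, t])
    (cst 0) s); last by apply: eq_Rintegral => s _; exact: A0.
  by rewrite !big_ord0 (Rintegral_itv_cst 0 t0) mul0r addr0.
have := bsolves_lin 1 1 IH (bz N).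
rewrite (_ : (fun t k => _) = (fun t k => \sum_(n < N.+1) F n t k)); last first.
  by apply/funext => t; apply/funext => k; rewrite big_ord_recr/= !mul1r.
rewrite [X in bsolves _ _ X -> _](_ : _ = (fun t k => \sum_(n < N.+1) z n t k))//.
by apply/funext => t; apply/funext => k; rewrite big_ord_recr/= !mul1r.
Qed.

Lemma bsolves_sub T F1 F2 z1 z2 : bsolves T F1 z1 -> bsolves T F2 z2 ->
  bsolves T (fun t k => F1 t k - F2 t k) (fun t k => z1 t k - z2 t k).
Proof.
move=> b1 b2; have := bsolves_lin 1 (-1) b1 b2.
by under eq_fun do under eq_fun do rewrite mul1r mulN1r;
   under [X in bsolves _ _ X]eq_fun do under eq_fun do rewrite mul1r mulN1r.
Qed.

Lemma bsolves_le T F z m : bsolves T F z -> tame m ->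
  (forall t k, 0 <= t <= T -> `|F t k| <= m k) ->
  forall t k, 0 <= t <= T -> `|z t k| <= expR (lam * t) * m k.
Proof.
move=> [sz [M [W [M0 tW zW]]]] tm Fm.
exact: (stability lam0 M0 tm tW sz Fm zW).
Qed.

Lemma bsolves_eq T F1 F2 z1 z2 : bsolves T F1 z1 -> bsolves T F2 z2 ->
  (forall t k, 0 <= t <= T -> F1 t k = F2 t k) ->
  forall t k, 0 <= t <= T -> z1 t k = z2 t k.
Proof.
move=> b1 b2 F12 t k ht; apply/eqP; rewrite -subr_eq0 -normr_le0.
have t0 : tame (fun=> 0) by split=> [//|] [|j] /=; rewrite ?mulr0 ?addr0.
have := bsolves_le (bsolves_sub b1 b2) t0 _ k ht; rewrite mulr0; apply=> s j hs.
by rewrite F12// subrr normr0.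
Qed.

Lemma picard_bsolves d (X : measurableType d) (F : X -> R -> nat -> R) (x : X) T :
  (forall k, measurable_fun setT (fun p : X * R => F p.1 p.2 k)) ->
  (forall x (tau : R), exists2 m,
    tame m & forall t k, 0 <= t <= tau -> `|F x t k| <= m k) ->
  bsolves T (F x) (picard a c e F x).
Proof.
move=> mF FB; split; first exact: (picard_solves lam0 mF FB).
have [m tm Fm] := FB x T.
exists (expR (lam * T)), m; split=> // t k ht.
exact: (picard_le lam0 mF tm Fm).
Qed.

(** Used with r = 0 for Lipschitz bounds in time and with r the value of the integrand at an
    endpoint for the first order expansion. *)
Lemma Rintegral_increment (g : R -> R) (s0 s1 r C : R) : 0 <= s0 -> s0 <= s1 ->
  lebesgue_measure.-integrable `[0, s1] (EFin \o g) ->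
  (forall s, s0 <= s <= s1 -> `|g s - r| <= C) ->
  `|\int[lebesgue_measure]_(s in `[0, s1]) g s
    - \int[lebesgue_measure]_(s in `[0, s0]) g s - (s1 - s0) * r| <= (s1 - s0) * C.
Proof.
move=> s00 s01 ig gC; have s10 := le_trans s00 s01.
have ic (q : R) : lebesgue_measure.-integrable `[0, s1] (EFin \o cst q).
  by apply: continuous_integrable => ?; exact: cvg_cst.
have S : `]s0, s1] `<=` `[0, s1].
  by move=> s /=; rewrite !in_itv/= => /andP[h ->]; rewrite (le_trans s00 (ltW h)).
have E (f : R -> R) : lebesgue_measure.-integrable `[0, s1] (EFin \o f) ->
    \int[lebesgue_measure]_(s in `[0, s1]) f s - \int[lebesgue_measure]_(s in `[0, s0]) f s
    = \int[lebesgue_measure]_(s in `]s0, s1]) f s.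
  by move=> if_; rewrite Rintegral_itvB// ?bnd_simp.
have Ec (q : R) : (s1 - s0) * q = \int[lebesgue_measure]_(s in `]s0, s1]) (cst q) s.
  by rewrite -E// !Rintegral_itv_cst//; ring.
have iS (f : R -> R) : lebesgue_measure.-integrable `[0, s1] (EFin \o f) ->
    lebesgue_measure.-integrable `]s0, s1] (EFin \o f).
  by apply: integrableS.
rewrite E// Ec -RintegralB//; [|exact: iS|exact: iS].
have iB : lebesgue_measure.-integrable `]s0, s1] (EFin \o (fun s => g s - cst r s)).
  rewrite (_ : _ \o _ = ((EFin \o g) \- (EFin \o cst r))%E)//.
  by apply: integrableB => //; exact: iS.
rewrite (le_trans (le_normr_Rintegral _ iB))// Ec.
apply: le_Rintegral => //; [exact: integrable_norm|exact: iS|].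
by move=> s /=; rewrite in_itv/= => /andP[h1 h2]; rewrite gC// ltW.
Qed.

End solutions.

(** * The semigroup of a tridiagonal operator *)

Section generator.
Variables (R : realType) (w a c e : nat -> R) (lam : R).
Notation A := (tri a c e).
Notation tame := (tame a c e lam).
Hypothesis lam0 : 0 <= lam.
Hypothesis w_gt0 : forall k, (1 <= k)%N -> 0 < w k.
Hypothesis slow_tame : forall N, slow N -> tame (sqrt_weight w N).

Let E (t : R) (x : nat -> R) : nat -> R := op_exp (fun y k => t * A y k) x.
Let sw := sqrt_weight w (fun=> 1).

Lemma sqrt_weight_tame : tame sw.
Proof. by apply: slow_tame => k; split; lra. Qed.

Lemma majorant_tame x : L2 w x -> tame (majorant w x).
Proof. by move=> [_ xoo]; have [N sN ->] := majorantE w_gt0 xoo; exact: slow_tame. Qed.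

Lemma L2_le_weight x k : L2 w x -> `|x k| <= L2norm w x * sw k.
Proof.
move=> Lx; case: k => [|k]; first by case: Lx => -> _; rewrite normr0 mulr0.
by rewrite mulrC /sw /= mulr1; exact: L2_coord.
Qed.

Lemma majorant_L2 x y (C : R) : 0 <= C -> L2 w x -> y 0%N = 0 ->
  (forall k, `|y k| <= C * majorant w x k) -> L2 w y.
Proof.
move=> C0 [_ xoo] y0 yx; apply: (L2_dom w_gt0 C0 y0) => //.
apply: le_lt_trans (majorant_sqnorm w_gt0 xoo) _.
by rewrite lte_mul_pinfty// lee_fin.
Qed.

Lemma majorant_norm x y (C : R) : 0 <= C -> L2 w x ->
  (forall k, `|y k| <= C * majorant w x k) ->
  L2norm w y <= C * Num.sqrt 3 * L2norm w x.
Proof.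
move=> C0 [_ xoo] yx; apply: (L2norm_dom w_gt0 C0 (sqrtr_ge0 _) (y := majorant w x)) => //.
by rewrite sqr_sqrtr//; exact: majorant_sqnorm.
Qed.

Lemma tri_majorant x k : L2 w x -> `|A x k| <= lam * majorant w x k.
Proof.
move=> Lx; apply: (tame_norm k (majorant_tame Lx)) => j; exact: majorant_ge.
Qed.

Lemma tri_bounded : bounded_op w A.
Proof.
split.
- by move=> x Lx; apply: (majorant_L2 lam0 Lx) => // k; exact: tri_majorant.
- move=> r x y _ _; apply/funext => k.
  have := tri_lin a c e r 1 x y k; rewrite mul1r => <-; congr (A _ k).
  by apply/funext => j; rewrite mul1r.
- exists (lam * Num.sqrt 3) => x Lx.
  by apply: majorant_norm => // k; exact: tri_majorant.
Qed.

Lemma iter_tri (t : R) n x k :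
  iter n (fun y k => t * A y k) x k = t ^+ n * iter n A x k.
Proof.
elim: n k => [|n IH] k /=; first by rewrite mul1r.
rewrite (_ : iter n _ x = fun k => t ^+ n * iter n A x k); last exact/funext.
by rewrite triZ mulrA exprS.
Qed.

Lemma iter_tri_le x m n k : tame m -> (forall k, `|x k| <= m k) ->
  `|iter n A x k| <= lam ^+ n * m k.
Proof.
move=> tm xm; elim: n k => [|n IH] k /=; first by rewrite mul1r.
by rewrite exprS; apply: tame_normZ => //; rewrite exprn_ge0.
Qed.

Lemma exp_term_le t x m n k : 0 <= t -> tame m -> (forall k, `|x k| <= m k) ->
  `|(n`!%:R)^-1 * iter n (fun y k => t * A y k) x k| <= m k * ((lam * t) ^+ n / n`!%:R).
Proof.
move=> t0 tm xm; have [m0 _] := tm.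
rewrite iter_tri !normrM gtr0_norm ?invr_gt0 ?ltr0n ?fact_gt0//.
rewrite [`|t ^+ n|]ger0_norm ?exprn_ge0// exprMn.
have -> : m k * (lam ^+ n * t ^+ n / n`!%:R) = (n`!%:R)^-1 * (t ^+ n * (lam ^+ n * m k)).
  by ring.
rewrite ler_wpM2l// ler_wpM2l ?exprn_ge0//; exact: iter_tri_le.
Qed.

Lemma exp_cvg_coord t x k : 0 <= t -> L2 w x ->
  (fun N => exp_partial (fun y k => t * A y k) N x k) @ \oo --> E t x k.
Proof.
move=> t0 Lx; have tm := majorant_tame Lx; have [m0 _] := tm.
exact: (exp_dominated_cvg (mulr_ge0 lam0 t0) (m0 k)
  (fun n => exp_term_le n k t0 tm (fun j => majorant_ge w_gt0 j Lx))).
Qed.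

Lemma exp_partial_le t x N k : 0 <= t -> L2 w x ->
  `|E t x k - exp_partial (fun y k => t * A y k) N x k|
    <= exp_tail N (lam * t) * majorant w x k.
Proof.
move=> t0 Lx; have tm := majorant_tame Lx; have [m0 _] := tm.
rewrite mulrC; exact: (exp_dominated_tail (mulr_ge0 lam0 t0) (m0 k)
  (fun n => exp_term_le n k t0 tm (fun j => majorant_ge w_gt0 j Lx))).
Qed.

Lemma exp_majorant t x k : 0 <= t -> L2 w x ->
  `|E t x k| <= expR (lam * t) * majorant w x k.
Proof.
move=> t0 Lx; have := exp_partial_le 0 k t0 Lx.
by rewrite /exp_partial /exp_tail !big_ord0 !subr0.
Qed.

Lemma exp_lin t (r s : R) x y k : 0 <= t -> L2 w x -> L2 w y ->
  E t (fun k => r * x k + s * y k) k = r * E t x k + s * E t y k.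
Proof.
move=> t0 Lx Ly.
have C : (fun N => exp_partial (fun y k => t * A y k) N (fun k => r * x k + s * y k) k)
    @ \oo --> r * E t x k + s * E t y k.
  rewrite (_ : (fun N => _) = fun N => r * exp_partial (fun y k => t * A y k) N x k +
      s * exp_partial (fun y k => t * A y k) N y k); last first.
    apply/funext => N; rewrite /exp_partial !mulr_sumr -big_split/=.
    apply: eq_bigr => n _; rewrite !iter_tri.
    have -> : iter n A (fun k => r * x k + s * y k) k = r * iter n A x k + s * iter n A y k.
      elim: (nat_of_ord n) k => [//|m IH] k /=.
      rewrite (_ : iter m A _ = fun k => r * iter m A x k + s * iter m A y k); last exact/funext.
      exact: tri_lin.
    by ring.
  by apply: cvgD; (apply: cvgM; first exact: cvg_cst); exact: exp_cvg_coord.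
have C' := @exp_cvg_coord t _ k t0 (L2_lin w_gt0 r s Lx Ly).
exact: (cvg_unique _ C' C).
Qed.

Lemma exp0_coord t x : 0 <= t -> L2 w x -> E t x 0%N = 0.
Proof.
move=> t0 Lx; apply/eqP; rewrite -normr_le0.
by have := exp_majorant 0 t0 Lx; rewrite mulr0.
Qed.

Lemma exp_L2 t x : 0 <= t -> L2 w x -> L2 w (E t x).
Proof.
move=> t0 Lx; apply: (majorant_L2 (expR_ge0 (lam * t)) Lx); first exact: exp0_coord.
by move=> k; exact: exp_majorant.
Qed.

Lemma exp_bounded t : 0 <= t -> bounded_op w (E t).
Proof.
move=> t0; split.
- by move=> x Lx; exact: exp_L2.
- move=> r x y Lx Ly; apply/funext => k.
  have := exp_lin r 1 k t0 Lx Ly; rewrite mul1r => <-; congr (E _ _ k).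
  by apply/funext => j; rewrite mul1r.
- exists (expR (lam * t) * Num.sqrt 3) => x Lx.
  by apply: majorant_norm => // k; exact: exp_majorant.
Qed.

Lemma exp_norm_cvg t : 0 <= t -> exp_cvg w (fun y k => t * A y k).
Proof.
move=> t0; split; first exact: exp_bounded.
move=> eps eps0.
have C : (fun N => exp_tail N (lam * t) * Num.sqrt 3) @ \oo --> (0 : R).
  rewrite [X in _ --> X](_ : 0 = 0 * Num.sqrt 3); last by rewrite mul0r.
  by apply: cvgM; [exact: cvg_exp_tail|exact: cvg_cst].
move/cvgrPdist_le : C => /(_ _ eps0); apply: filterS => N hN x Lx.
have e0 : 0 <= exp_tail N (lam * t) by rewrite exp_tail_ge0// mulr_ge0.
apply: (le_trans (majorant_norm e0 Lx _)); first by move=> k; exact: exp_partial_le.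
rewrite ler_wpM2r ?sqrtr_ge0//; apply: le_trans hN.
by rewrite sub0r normrN ler_norm.
Qed.

(** For constant forcing x the n-th Picard term is t^n / n! A^n x, so the exponential series is the
    Picard series, here with the one-point parameter space. *)
Lemma exp_bsolves T x : L2 w x -> bsolves a c e lam T (fun=> x) (fun t => E t x).
Proof.
move=> Lx; pose F (_ : unit) (_ : R) := x.
have tm := majorant_tame Lx; have [m0 _] := tm.
have mF k : measurable_fun setT (fun p : unit * R => F p.1 p.2 k) by exact: measurable_cst.
have FB (u : unit) (tau : R) : exists2 m,
    tame m & forall t k, 0 <= t <= tau -> `|F u t k| <= m k.
  by exists (majorant w x) => // t k _; exact: majorant_ge.
have pE n t k : 0 <= t -> picard_term a c e F n tt t k = t ^+ n / n`!%:R * iter n A x k.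
  elim: n t k => [|n IH] t k t0; first by rewrite /= divr1 mul1r.
  rewrite /=.
  (* The factors 1 bring the integrand to the form of [Rintegral_exp_coeff] with rate 1. *)
  transitivity (\int[lebesgue_measure]_(s in `[0, t])
      (A (iter n A x) k * (1 * ((1 * s) ^+ n / n`!%:R)))).
    apply: eq_Rintegral => s; rewrite inE/= in_itv/= => /andP[s0 st].
    rewrite (_ : picard_term _ _ _ _ _ _ _ = fun k => s ^+ n / n`!%:R * iter n A x k).
      by rewrite triZ !mul1r mulrC.
    by apply/funext => j; exact: IH.
  have c2 := @continuous_exp_coeff R 1 n.
  rewrite RintegralZl//; last exact: continuous_integrable.
  by rewrite Rintegral_exp_coeff// mul1r mulrC.
have EP t : 0 <= t -> E t x = picard a c e F tt t.
  move=> t0; apply/funext => k; rewrite /E /op_exp /picard.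
  congr (limn _); apply/funext => N; apply: eq_bigr => n _.
  by rewrite iter_tri pE//; ring.
have [sp bp] := picard_bsolves lam0 tt T mF FB.
split.
  move=> k; have [mk ek] := sp k; split.
    apply: eq_measurable_fun mk => s; rewrite inE/= in_itv/= => /andP[s0 _].
    by rewrite EP.
  move=> t ht; have /andP[t0 tT] := ht; rewrite EP// ek//; congr (_ + _).
  apply: eq_Rintegral => s; rewrite inE/= in_itv/= => /andP[s0 _].
  by rewrite EP.
have [M [W [M0 tW zW]]] := bp; exists M, W; split => // t k ht.
by have /andP[t0 _] := ht; rewrite EP// zW.
Qed.

Lemma exp0 x : L2 w x -> E 0 x = x.
Proof.
move=> Lx; apply/funext => k; have [s _] := exp_bsolves 0 Lx.
have [_ ->] := s k; last by rewrite lexx.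
by rewrite set_itv1 Rintegral_set1 addr0.
Qed.

End generator.

Lemma tri_cvg (R : realType) (a c e : nat -> R) (T : Type) (F : set_system T)
    {FF : Filter F} (x : T -> nat -> R) (l : nat -> R) k :
  (forall j, (fun s => x s j) @ F --> l j) -> (fun s => tri a c e (x s) k) @ F --> tri a c e l k.
Proof.
move=> xl; case: k => [|k] /=; first exact: cvg_cst.
by apply: cvgD; [apply: cvgD|]; (apply: cvgM; first exact: cvg_cst); exact: xl.
Qed.

(** * The exponential solves the differential equation in norm *)

Section ode.
Variables (R : realType) (w a c e : nat -> R) (lam : R).
Notation A := (tri a c e).
Notation tame := (tame a c e lam).
Hypothesis lam0 : 0 <= lam.
Hypothesis w_gt0 : forall k, (1 <= k)%N -> 0 < w k.
Hypothesis slow_tame : forall N, slow N -> tame (sqrt_weight w N).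

Let E (t : R) (x : nat -> R) : nat -> R := op_exp (fun y k => t * A y k) x.
Let sw := sqrt_weight w (fun=> 1).

Lemma exp_increment (s0 s1 tau r C : R) x k : L2 w x ->
  0 <= s0 -> s0 <= s1 -> s1 <= tau ->
  (forall s, s0 <= s <= s1 -> `|A (E s x) k - r| <= C) ->
  `|E s1 x k - E s0 x k - (s1 - s0) * r| <= (s1 - s0) * C.
Proof.
move=> Lx s00 s01 s1tau rC; have s10 := le_trans s00 s01.
have b := exp_bsolves lam0 w_gt0 slow_tame tau Lx; have [s _] := b.
have [_ ek] := s k.
have -> : E s1 x k - E s0 x k = \int[lebesgue_measure]_(s in `[0, s1]) A (E s x) k
    - \int[lebesgue_measure]_(s in `[0, s0]) A (E s x) k.
  by rewrite /E ek ?s10// ek ?s00 ?(le_trans s01)//; ring.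
by apply: Rintegral_increment => //; exact: (bsolves_integrable k b s1tau).
Qed.

Lemma exp_lipschitz (s t tau : R) x k : L2 w x -> 0 <= s <= tau -> 0 <= t <= tau ->
  `|E s x k - E t x k| <= (`|s - t| * (lam * expR (lam * tau))) * majorant w x k.
Proof.
move=> Lx hs ht.
wlog st : s t hs ht / s <= t.
  move=> H; have [st|/ltW ts] := leP s t; first exact: H.
  by rewrite distrC [`|s - t|]distrC; exact: H.
have /andP[s0 _] := hs; have /andP[_ ttau] := ht.
rewrite distrC [`|s - t|]distrC [`|t - s|]ger0_norm ?subr_ge0//.
have H r : s <= r <= t -> `|A (E r x) k - 0| <= lam * expR (lam * tau) * majorant w x k.
  move=> /andP[sr rt]; rewrite subr0.
  have tm := majorant_tame w_gt0 slow_tame Lx.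
  apply: tame_normZ => // j; have r0 := le_trans s0 sr.
  apply: (le_trans (exp_majorant lam0 w_gt0 slow_tame j r0 Lx)).
  have [m0 _] := tm; rewrite ler_wpM2r// ler_expR ler_wpM2l//.
  exact: le_trans ttau.
have := exp_increment Lx s0 st ttau H.
by rewrite mulr0 subr0 !mulrA.
Qed.

(** Integrating the Lipschitz bound gives an error quadratic in the time step and proportional to
    the single sequence [majorant w x], so the coordinate estimates add up to one in the norm of
    L2(w). *)
Lemma exp_taylor (s t tau : R) x k : L2 w x -> 0 <= s <= tau -> 0 <= t <= tau ->
  `|E s x k - E t x k - (s - t) * A (E t x) k|
    <= `|s - t| * (`|s - t| * (lam * (lam * expR (lam * tau))) * majorant w x k).
Proof.
move=> Lx hs ht; have tm := majorant_tame w_gt0 slow_tame Lx.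
have H q : 0 <= q <= tau -> `|q - t| <= `|s - t| ->
    `|A (E q x) k - A (E t x) k| <= `|s - t| * (lam * (lam * expR (lam * tau))) * majorant w x k.
  move=> hq qt; rewrite -triB.
  have -> : `|s - t| * (lam * (lam * expR (lam * tau))) =
    lam * (`|s - t| * (lam * expR (lam * tau))) by ring.
  apply: tame_normZ => //; first by rewrite !mulr_ge0// expR_ge0.
  move=> j; apply: (le_trans (exp_lipschitz j Lx hq ht)).
  have [m0 _] := tm; rewrite ler_wpM2r// ler_wpM2r// mulr_ge0// expR_ge0.
have /andP[s0 stau] := hs; have /andP[t0 ttau] := ht.
have [st|/ltW ts] := leP s t.
  have Hq q : s <= q <= t -> `|A (E q x) k - A (E t x) k| <=
      `|s - t| * (lam * (lam * expR (lam * tau))) * majorant w x k.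
    move=> /andP[sq qt]; apply: H; first by rewrite (le_trans s0 sq) (le_trans qt).
    by rewrite ![`|_ - t|]distrC !ger0_norm ?subr_ge0//; lra.
  have := exp_increment Lx s0 st ttau Hq; rewrite -normrN.
  have -> : - (E t x k - E s x k - (t - s) * A (E t x) k) =
     E s x k - E t x k - (s - t) * A (E t x) k by ring.
  by have -> : t - s = `|s - t| by rewrite distrC ger0_norm// subr_ge0.
have Hq q : t <= q <= s -> `|A (E q x) k - A (E t x) k| <=
    `|s - t| * (lam * (lam * expR (lam * tau))) * majorant w x k.
  move=> /andP[tq qs]; apply: H; first by rewrite (le_trans t0 tq) (le_trans qs).
  by rewrite !ger0_norm ?subr_ge0//; lra.
have := exp_increment Lx t0 ts stau Hq.
by rewrite !(ger0_norm (_ : 0 <= s - t)) ?subr_ge0.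
Qed.

Lemma exp_ode z0 : L2 w z0 -> ode_solution w A (fun t => E t z0).
Proof.
move=> Lz t t0; split; first exact: (exp_L2 lam0 w_gt0 slow_tame).
apply/cvgrPdist_le => eps eps0; rewrite near_withinE.
(* Increments of size at most 1 keep t + h below [tau], so one constant serves all small h. *)
pose tau := t + 1.
pose C := lam * (lam * expR (lam * tau)).
have C0 : 0 <= C by rewrite !mulr_ge0// expR_ge0.
pose D := C * Num.sqrt 3 * L2norm w z0.
have D0 : 0 <= D by rewrite !mulr_ge0// sqrtr_ge0.
rewrite near_withinE.
near=> h; move=> h0 th.
have h1 : `|h| <= 1.
  near: h; apply/nbhs_normP; exists 1 => //= h; rewrite /ball_/= sub0r normrN; exact: ltW.
have hD : `|h| * (D + 1) <= eps.
  near: h; apply/nbhs_normP; exists (eps / (D + 1)); first by rewrite /= divr_gt0//; lra.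
  by move=> h; rewrite /ball_/= sub0r normrN ltr_pdivlMr; [exact: ltW|lra].
rewrite sub0r normrN ger0_norm ?sqrtr_ge0//.
apply: (le_trans (majorant_norm w_gt0 (C := `|h| * C) _ Lz _)).
- by rewrite mulr_ge0.
- move=> k; have h0' : `|h| != 0 by rewrite normr_eq0.
  have := @exp_taylor (t + h) t tau z0 k Lz.
  have -> : t + h - t = h by ring.
  rewrite th t0 /tau; move: (h1); rewrite ler_norml => /andP[h2 h3] H.
  have {}H := H _ _; rewrite -(ler_pM2l (_ : 0 < `|h|)) ?normr_gt0//.
  rewrite -normrM; apply: (le_trans _ (le_trans (H _ _) _)).
  + rewrite le_eqVlt; apply/orP; left; apply/eqP; congr (`|_|).
    by rewrite mulrBr mulrCA divff// mulr1.
  + by rewrite lerD2l h3.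
  + by rewrite lerDl ler01.
  + by rewrite /C /tau !mulrA.
- apply: le_trans hD; rewrite [leLHS](_ : _ = `|h| * D); last by rewrite /D; ring.
  by rewrite ler_wpM2l// lerDl.
Unshelve. all: by end_near. Qed.

End ode.

(** * Uniqueness for the differential equation *)

Section ode_uniqueness.
Variables (R : realType) (w a c e : nat -> R) (lam : R).
Notation A := (tri a c e).
Notation tame := (tame a c e lam).
Hypothesis lam0 : 0 <= lam.
Hypothesis w_gt0 : forall k, (1 <= k)%N -> 0 < w k.
Hypothesis slow_tame : forall N, slow N -> tame (sqrt_weight w N).

Let sw := sqrt_weight w (fun=> 1).

Variable z : R -> nat -> R.
Hypothesis zode : ode_solution w A z.

Lemma ode_local (t eps : R) : 0 <= t -> 0 < eps -> \forall h \near (0 : R)^', 0 <= t + h ->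
  forall k, `|(z (t + h) k - z t k) / h - A (z t) k| <= eps * sw k.
Proof.
move=> t0 eps0; have [Lz] := zode t0.
move/cvgrPdist_le => /(_ _ eps0); rewrite near_withinE; apply: filterS => h H th k.
have {H} := H th; rewrite sub0r normrN ger0_norm ?sqrtr_ge0// => H.
have [Lzh _] := zode th; have [AL _ _] := tri_bounded lam0 w_gt0 slow_tame.
have LD : L2 w (fun k => (z (t + h) k - z t k) / h - A (z t) k).
  apply: L2_sub => //; last exact: AL.
  have := L2_lin w_gt0 h^-1 (- h^-1) Lzh Lz.
  rewrite [X in L2 _ X](_ : _ = (fun k => (z (t + h) k - z t k) / h))//.
  by apply/funext => j; ring.
have [sw0 _] := sqrt_weight_tame slow_tame.
apply: (le_trans (L2_le_weight w_gt0 k LD)); exact: ler_wpM2r.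
Qed.

Lemma ode_derive (t : R) k : 0 < t -> is_derive t (1 : R) (fun s => z s k) (A (z t) k).
Proof.
move=> t0; have [sw0 _] := sqrt_weight_tame slow_tame.
have C : (fun h : R => h^-1 *: ((fun s => z s k) (h *: (1 : R) + t) - z t k)) @ (0 : R)^'
    --> A (z t) k.
  apply/cvgrPdist_le => eps eps0.
  pose eps' := eps / (sw k + 1).
  have s1 : 0 < sw k + 1 by rewrite ltr_wpDl.
  have e0 : 0 < eps' by rewrite divr_gt0.
  have := ode_local (ltW t0) e0; apply: filterS2; last first.
    apply: (_ : \forall h \near (0:R)^', 0 <= t + h).
    rewrite near_withinE; apply/nbhs_ballP; exists t => //= h.
    by rewrite /ball/= sub0r normrN ltr_norml => /andP[ht _] _; lra.
  move=> h H th; rewrite distrC /GRing.scale/= mulr1 [h + t]addrC mulrC.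
  apply: (le_trans (th H k)); rewrite /eps' mulrAC ler_pdivrMr//.
  by rewrite ler_pM2l// lerDl ler01.
by apply: DeriveDef; [exact: cvgP C|exact: cvg_lim C].
Qed.

(** The difference quotient is within 1 of A z in norm near t, and the norm controls coordinate k
    with factor [sw k], uniformly in k. *)
Lemma ode_local_bound (t : R) : 0 <= t ->
  exists2 del, 0 < del & forall s, 0 <= s -> `|s - t| < del -> forall k,
    `|z s k - z t k| <= `|s - t| * (`|A (z t) k| + sw k).
Proof.
move=> t0; have := ode_local t0 ltr01.
move=> /(nbhs_ballP _ _)[del /= del0 H]; exists del => // s s0 st k.
have [->|sNt] := eqVneq s t; first by rewrite !subrr normr0 mul0r.
have h0 : s - t != 0 by rewrite subr_eq0.
have := H (s - t); rewrite /ball/= sub0r normrN => /(_ st h0).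
rewrite addrC subrK => /(_ s0 k); rewrite mul1r => {}H.
have -> : z s k - z t k = (s - t) * (((z s k - z t k) / (s - t) - A (z t) k) + A (z t) k).
  by field.
rewrite normrM ler_wpM2l// (le_trans (ler_normD _ _))// addrC lerD//.
Qed.

(** A norm-differentiable solution comes without a bound uniform in time. Compactness of [[0, T]]
    extracts one from the local bounds, with the root of the weight as tame sequence. *)
Lemma ode_bounded_on (T : R) : bounded_on a c e lam T z.
Proof.
have [sw0 _] := sqrt_weight_tame slow_tame.
(* Compactness is used in its near-covering form, with M tending to infinity as second variable; the
   guard on t discards the negative times inside balls around points near 0. *)
pose P (M t : R) := 0 <= t -> forall k, `|z t k| <= M * sw k.
have : \forall M \near +oo%R, `[0, T] `<=` P M.
  apply: ((compact_near_coveringP _).1 (@segment_compact R 0 T)) => t /=.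
  rewrite in_itv/= => /andP[t0 tT].
  have [del del0 H] := ode_local_bound t0.
  have [Lz _] := zode t0; have [AL _ _] := tri_bounded lam0 w_gt0 slow_tame.
  pose M0 := L2norm w (z t) + del * (L2norm w (A (z t)) + 1).
  exists (ball t del, [set M | M0 <= M]) => /=.
    split; first exact: nbhsx_ballx.
    by apply: nbhs_pinfty_ge; exact: num_real.
  move=> [s M] /= [ts MM] s0 k.
  have st : `|s - t| < del by move: ts; rewrite /ball/= distrC.
  rewrite -(subrK (z t k) (z s k)) (le_trans (ler_normD _ _))//.
  apply: (le_trans _ (ler_wpM2r (sw0 k) MM)).
  rewrite /M0 mulrDl addrC lerD//; first exact: L2_le_weight.
  apply: (le_trans (H s s0 st k)); rewrite -mulrA ler_pM ?addr_ge0 ?(ltW st)//.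
  rewrite mulrDl mul1r lerD2r; apply: L2_le_weight => //; exact: AL.
move=> [M [_ /(_ (Num.max M 0 + 1)) HM]].
exists (Num.max M 0 + 1), sw; split.
- by rewrite addr_ge0// le_max lexx orbT.
- exact: sqrt_weight_tame.
- move=> t k ht; have /andP[t0 _] := ht; apply: HM => //=.
    by rewrite ltr_pwDr// le_max lexx.
Qed.

(** The fundamental theorem of calculus is applied to each coordinate: differentiability at positive
    times and right continuity at 0, the latter from [ode_local_bound]. *)
Lemma ode_bsolves (T : R) : bsolves a c e lam T (fun=> z 0) z.
Proof.
split; last exact: ode_bounded_on.
have cz (t : R) k : 0 < t -> (fun s => z s k) @ t --> z t k.
  move=> t0; have D := ode_derive k t0.
  by apply/differentiable_continuous/derivable1_diffP; have [] := D.
have cr k : (fun s => z s k) @ (0 : R)^'+ --> z 0 k.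
  apply/cvgrPdist_le => eps eps0.
  have [del del0 H] := ode_local_bound (lexx 0).
  pose C := `|A (z 0) k| + sw k.
  have [sw0 _] := sqrt_weight_tame slow_tame.
  have C0 : 0 <= C by rewrite addr_ge0.
  near=> s; have s0 : 0 < s by [].
  have sdel : `|s - 0| < del.
    rewrite subr0 gtr0_norm//; near: s; exact: nbhs_right_lt.
  rewrite distrC; apply: (le_trans (H s (ltW s0) sdel k)).
  rewrite subr0 gtr0_norm// -/C.
  have : s <= eps / (C + 1).
    near: s; apply: nbhs_right_le; rewrite divr_gt0//; lra.
  rewrite ler_pdivlMr; last lra.
  by apply: le_trans; rewrite ler_wpM2l ?(ltW s0)//; lra.
have cA (t : R) k : 0 < t -> (fun s => A (z s) k) @ t --> A (z t) k.
  by move=> t0; apply: tri_cvg => j; exact: cz.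
have cl (t : R) (f : R -> R) : f @ t --> f t -> f @ t^'- --> f t by exact: cvg_at_left_filter.
have wc (t : R) k : 0 < t -> {within `[0, t], continuous (fun s => A (z s) k)}.
  move=> t0; apply/continuous_within_itvP => //; split.
  - by move=> s; rewrite in_itv/= => /andP[s0 _]; exact: cA.
  - by apply: tri_cvg => j; exact: cr.
  - by apply: cl; exact: cA.
move=> k; split.
  have [T0|T0] := ltP 0 T; first by apply: subspace_continuous_measurable_fun => //; exact: wc.
  move: T0; rewrite le_eqVlt => /predU1P[->|T0].
    by rewrite set_itv1; exact: measurable_fun_set1.
  by rewrite set_itv_ge ?bnd_simp -?ltNge//; exact: measurable_fun_set0.
move=> t /andP[]; rewrite le_eqVlt => /predU1P[<- _|t0 tT].
  by rewrite set_itv1 Rintegral_set1 addr0.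
rewrite /Rintegral (@continuous_FTC2 _ _ (fun s => z s k))//=; last 3 first.
- exact: wc.
- split; [|exact: cr|by apply: cl; exact: cz].
  by move=> s; rewrite in_itv/= => /andP[s0 _]; have [] := ode_derive k s0.
- move=> s; rewrite in_itv/= => /andP[s0 _]; rewrite derive1E.
  by have D := ode_derive k s0; exact: derive_val.
by ring.
Unshelve. all: by end_near. Qed.

Lemma ode_unique (t : R) : 0 <= t -> z t = op_exp (fun y k => t * A y k) (z 0).
Proof.
move=> t0; apply/funext => k; have [Lz _] := zode (lexx 0).
have b := exp_bsolves lam0 w_gt0 slow_tame t Lz.
by apply: (bsolves_eq lam0 (ode_bsolves t) b) => //; rewrite t0 lexx.
Qed.

End ode_uniqueness.

(** * Uniqueness for Bochner integrable solutions *)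

Section L2_paths.
Variables (R : realType) (w a c e : nat -> R) (lam : R).
Notation A := (tri a c e).
Notation tame := (tame a c e lam).
Hypothesis lam0 : 0 <= lam.
Hypothesis w_gt0 : forall k, (1 <= k)%N -> 0 < w k.
Hypothesis slow_tame : forall N, slow N -> tame (sqrt_weight w N).

Let sw := sqrt_weight w (fun=> 1).

Lemma measurable_L2sqnorm d (T : measurableType d) (D : set T) (f : T -> nat -> R) :
  measurable D -> (forall k, measurable_fun D (fun s => f s k)) ->
  measurable_fun D (fun s => L2sqnorm w (f s)).
Proof.
move=> mD mf; under eq_fun do rewrite L2sqnormE//.
apply: ge0_emeasurable_sum => [k s _ _|k _]; first by rewrite lee_fin L2term_ge0.
apply/measurable_EFinP; case: k => [|k] /=; first exact: measurable_cst.
by apply: measurable_funM => //; exact: measurable_funX.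
Qed.

Lemma measurable_L2norm d (T : measurableType d) (D : set T) (f : T -> nat -> R) :
  measurable D -> (forall k, measurable_fun D (fun s => f s k)) ->
  measurable_fun D (fun s => L2norm w (f s)).
Proof.
move=> mD mf; apply: measurableT_comp => //.
  by apply: continuous_measurable_fun; exact: sqrt_continuous.
by apply: measurableT_comp => //; exact: measurable_L2sqnorm.
Qed.

Definition L2_path (F z : R -> nat -> R) : Prop :=
  forall t, 0 <= t -> [/\ L2 w (z t), L2_integrable w `[0, t] (fun s => A (z s)) &
    forall k, z t k = F t k + L2_integral `[0, t] (fun s => A (z s)) k].

(** A coordinate is at most [sw k] times the norm, so the integral of the norm, a single number M,
    bounds the coordinate integrals by M [sw]. *)
Lemma L2_integrable_coord (g : R -> nat -> R) T : L2_integrable w `[0, T] g ->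
  exists2 M, 0 <= M & forall t k, t <= T ->
    lebesgue_measure.-integrable `[0, t] (EFin \o fun s => g s k) /\
    `|\int[lebesgue_measure]_(s in `[0, t]) g s k| <= M * sw k.
Proof.
move=> [Lg mg goo].
have mN : measurable_fun `[0, T] (fun s => L2norm w (g s)) by exact: measurable_L2norm.
pose I := (\int[lebesgue_measure]_(s in `[0%R, T]) (L2norm w (g s))%:E)%E.
have I0 : (0 <= I)%E by apply: integral_ge0 => s _; rewrite lee_fin sqrtr_ge0.
have IE : (fine I)%:E = I by rewrite fineK// ge0_fin_numE.
exists (fine I); first exact: fine_ge0.
move=> t k tT; have [sw0 _] := sqrt_weight_tame slow_tame.
have B : (\int[lebesgue_measure]_(s in `[0%R, T]) (`|g s k|)%:E <= (fine I * sw k)%:E)%E.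
  rewrite mulrC EFinM IE -ge0_integralZl//; last 3 first.
  - by apply/measurable_EFinP.
  - by move=> s _; rewrite lee_fin sqrtr_ge0.
  - by rewrite lee_fin.
  apply: ge0_le_integral => //.
  - by apply/measurable_EFinP; apply: measurableT_comp => //; exact: mg.
  - apply: (_ : measurable_fun _ (EFin \o (fun s => sw k * L2norm w (g s)))).
    by apply/measurable_EFinP; apply: measurable_funM.
  by move=> s sT; rewrite -EFinM lee_fin mulrC; apply: L2_le_weight => //; exact: Lg.
have mgt : measurable_fun `[0, t] (fun s => g s k).
  by apply: measurable_funS (mg k) => //; apply: subset_itvl; rewrite bnd_simp.
have Bt : (\int[lebesgue_measure]_(s in `[0%R, t]) (`|g s k|)%:E <= (fine I * sw k)%:E)%E.
  apply: le_trans B; apply: ge0_subset_integral => //.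
  - by apply/measurable_EFinP; apply: measurableT_comp => //; exact: mg.
  - by apply: subset_itvl; rewrite bnd_simp.
have ig : lebesgue_measure.-integrable `[0, t] (EFin \o fun s => g s k).
  apply/integrableP; split; first exact/measurable_EFinP.
  exact: le_lt_trans Bt (ltry _).
split=> //; rewrite -lee_fin; apply: le_trans Bt.
rewrite -[leLHS]/(`|(\int[lebesgue_measure]_(s in `[0, t]) g s k)%:E|)%E.
have fi : (\int[lebesgue_measure]_(s in `[0%R, t]) (g s k)%:E)%E \is a fin_num.
  by apply: (integrable_fin_num _ ig).
rewrite /Rintegral fineK//.
by apply: le_abse_integral => //; exact/measurable_EFinP.
Qed.

(** Nothing dominates F, hence neither solution alone. In the difference F cancels, and what remains
    is a difference of two integrals, bounded by [L2_integrable_coord]; its forcing is 0. *)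
Lemma L2_path_unique F z1 z2 : L2_path F z1 -> L2_path F z2 ->
  forall t, 0 <= t -> z1 t = z2 t.
Proof.
move=> p1 p2 T T0; apply/funext => k.
have [_ i1 _] := p1 _ T0; have [_ i2 _] := p2 _ T0.
have [M1 M10 H1] := L2_integrable_coord i1; have [M2 M20 H2] := L2_integrable_coord i2.
have D : bsolves a c e lam T (fun _ _ => 0) (fun t k => z1 t k - z2 t k).
  have E t j : 0 <= t <= T -> z1 t j - z2 t j =
    \int[lebesgue_measure]_(s in `[0, t]) A (z1 s) j
    - \int[lebesgue_measure]_(s in `[0, t]) A (z2 s) j.
    move=> /andP[t0 tT]; have [_ _ ->] := p1 t t0; have [_ _ ->] := p2 t t0.
    by rewrite /L2_integral; ring.
  split.
    move=> j; have AE s : A (fun k => z1 s k - z2 s k) j = A (z1 s) j - A (z2 s) j.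
      exact: triB.
    split.
      rewrite (_ : (fun s => _) = (fun s => A (z1 s) j - A (z2 s) j)); last exact/funext.
      by have [_ m1 _] := i1; have [_ m2 _] := i2; apply: measurable_funB; [exact: m1|exact: m2].
    move=> t ht; have /andP[t0 tT] := ht; rewrite E// add0r.
    have [I1 _] := H1 t j tT; have [I2 _] := H2 t j tT.
    by rewrite -RintegralB//; apply: eq_Rintegral => s _; rewrite AE.
  exists (M1 + M2), sw; split; first exact: addr_ge0.
    exact: sqrt_weight_tame.
  move=> t j ht; have /andP[t0 tT] := ht; rewrite E// (le_trans (ler_normB _ _))//.
  have [_ I1] := H1 t j tT; have [_ I2] := H2 t j tT.
  by rewrite mulrDl lerD.
have z0 : tame (fun=> 0) by split=> [//|] [|j] /=; rewrite ?mulr0 ?addr0.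
have F0 s (j : nat) : 0 <= s <= T -> `|0 : R| <= 0 by rewrite normr0.
have TT : 0 <= T <= T by rewrite T0 lexx.
have := bsolves_le lam0 D z0 F0 k TT; rewrite mulr0 normr_le0 subr_eq0.
by move/eqP.
Qed.

Lemma sde_unique d (Omega : measurableType d) (P : probability Omega R)
    (B : nat -> R -> Omega -> R) (Z0 : Omega -> nat -> R) :
  sde_uniqueness P w A B Z0.
Proof.
move=> Z Z' [_ h] [_ h']; apply: filterS2 h h' => om h h' t t0.
apply: (@L2_path_unique (fun t k => Z0 om k + B k t om) (Z^~ om) (Z'^~ om)) => // s s0.
- by have [? ? E] := h s s0; split=> // k; rewrite E; ring.
- by have [? ? E] := h' s s0; split=> // k; rewrite E; ring.
Qed.

End L2_paths.

(** * The growth condition makes K tame *)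

Section birth_death.
Variables (R : realType) (alpha beta : R) (L : nat).
Hypotheses (alpha_gt0 : 0 < alpha) (beta_gt0 : 0 < beta).
Hypothesis rho_lt1 : rho alpha beta < 1.
Notation r := (rho alpha beta).

Definition diag_rate (k : nat) : R := - (brate alpha beta L k + beta).

Lemma rho_gt0 : 0 < r. Proof. exact: divr_gt0. Qed.

Lemma KopE : Kop alpha beta L = tri (brate alpha beta L) diag_rate (fun=> beta).
Proof.
apply/funext => x; apply/funext => -[//|k] /=.
by rewrite /diag_rate mulNr.
Qed.

Lemma brate_ge0 k : 0 <= brate alpha beta L k.
Proof. by rewrite !mulr_ge0 ?exprn_ge0// ltW// rho_gt0. Qed.

Lemma brate_le k : brate alpha beta L k <= beta * L%:R.
Proof.
rewrite /brate ler_piMr ?mulr_ge0 ?(ltW beta_gt0)//.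
by rewrite exprn_ile1 ?(ltW rho_gt0)// ltW.
Qed.

(** For m = sqrt (w N), the ratio of m k to m k.+1 is at most sqrt (2 d) rho^(-L^k), which the birth
    rate beta L rho^(L^k) turns into [l1]; the ratio of m k.+1 to m k is at most sqrt (2 / c),
    whence [l3]. The diagonal is at most beta L + beta. *)
Lemma growth_tame (w : nat -> R) : weight_growth alpha beta L w ->
  exists2 lam, 0 <= lam & forall N, slow N ->
    tame (brate alpha beta L) diag_rate (fun=> beta) lam (sqrt_weight w N).
Proof.
move=> [w0 [c [d [c0 d0 cd]]]]; have r0 := rho_gt0; have b0 := ltW beta_gt0.
have bL0 : 0 <= beta * L%:R by rewrite mulr_ge0.
pose l1 := beta * L%:R * Num.sqrt (2 * d); pose l3 := beta * Num.sqrt (2 / c).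
have l10 : 0 <= l1 by rewrite mulr_ge0 ?sqrtr_ge0.
have l30 : 0 <= l3 by rewrite mulr_ge0 ?sqrtr_ge0.
exists (l1 + (beta * L%:R + beta) + l3); first by rewrite !addr_ge0.
have S p q X Y : 0 <= p -> 0 <= q -> p ^+ 2 * X <= q * Y -> p * Num.sqrt X <= Num.sqrt q * Num.sqrt Y.
  move=> p0 q0 H; rewrite -sqrtrM// -{1}[p]ger0_norm// -sqrtr_sqr -sqrtrM ?sqr_ge0//.
  exact: ler_wsqrtr.
move=> N sN; split=> [[|k]|[|k]] /=; rewrite ?sqrtr_ge0 ?mulr0//.
have [N0 NS1 NS2] := sN k.+1; have wk := w0 k.+1 isT.
set mk := Num.sqrt (w k.+1 * N k.+1).
have mk0 : 0 <= mk by rewrite sqrtr_ge0.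
rewrite mulrDl mulrDl; apply: lerD; first apply: lerD.
(* In the first row the left neighbour is coordinate 0, where [sqrt_weight] vanishes; the growth
   condition only speaks of indices from 1 on. *)
- case: k @mk mk0 wk N0 NS1 NS2 => [|k] mk mk0 wk N0 NS1 NS2.
    by rewrite mulr0 mulr_ge0.
  rewrite ger0_norm ?brate_ge0// /brate -!mulrA ler_wpM2l// ler_wpM2l//.
  have [N0' NS1' _] := sN k.+1; have wk' := w0 k.+1 isT.
  apply: S; [by rewrite exprn_ge0// ltW|by rewrite mulr_ge0// ltW|].
  have /andP[_ cdk] := cd k.+1 isT.
  have [_ _ NS3] := sN k.+1.
  have H1 : r ^+ (2 * L ^ k.+1) * w k.+1 <= d * w k.+2.
    rewrite mulrC -ler_pdivlMr ?exprn_gt0// mulrAC; apply: le_trans cdk _.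
    by rewrite mulrAC.
  rewrite -exprM mulnC mulrA (le_trans (ler_wpM2r N0' H1))//.
  rewrite -!mulrA [leRHS]mulrCA ler_wpM2l ?(ltW d0)// mulrCA ler_wpM2l ?(ltW wk)//.
- rewrite ler_wpM2r// /diag_rate normrN ger0_norm ?addr_ge0 ?brate_ge0//.
  by rewrite lerD2r brate_le.
- rewrite gtr0_norm// /l3 -mulrA ler_wpM2l//.
  have wk2 := w0 k.+2 isT.
  rewrite -[leLHS]mul1r; apply: S => //; first by rewrite divr_ge0// ltW.
  have /andP[cdk _] := cd k.+1 isT; have [N2 _ _] := sN k.+2.
  rewrite expr1n mul1r -[2 / c * _]mulrA [c^-1 * _]mulrC !mulrA ler_pdivlMr//.
  rewrite -!mulrA [leLHS]mulrCA.
  have H : c * w k.+2 * N k.+2 <= w k.+1 * (2 * N k.+1).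
    by rewrite ler_pM// mulr_ge0 ?ltW.
  move: H; nra.
Qed.

End birth_death.

(** * Spectral representation *)

(** Indicators extend both factors to the full product, where the absolute value is at most |g| C on
    D1 x D2 and zero elsewhere; finiteness of [m2 D2] makes this integrable. *)
Lemma Rintegral_Fubini d d' (T1 : measurableType d) (T2 : measurableType d') (R : realType)
   (m1 : {sigma_finite_measure set T1 -> \bar R}) (m2 : {sigma_finite_measure set T2 -> \bar R})
   (D1 : set T1) (D2 : set T2) (g : T1 -> R) (O : T1 * T2 -> R) (C : R) :
  measurable D1 -> measurable D2 -> (m2 D2 < +oo)%E ->
  m1.-integrable D1 (EFin \o g) -> measurable_fun setT g -> measurable_fun setT O ->
  (forall x y, D1 x -> D2 y -> `|O (x, y)| <= C) ->
  \int[m2]_(y in D2) (\int[m1]_(x in D1) (g x * O (x, y))) =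
  \int[m1]_(x in D1) (g x * \int[m2]_(y in D2) O (x, y)).
Proof.
move=> mD1 mD2 D2oo ig mg mO OC.
have [->|/set0P[y0 Dy0]] := eqVneq D2 set0.
  rewrite Rintegral_set0; under eq_Rintegral do rewrite Rintegral_set0 mulr0.
  by rewrite (_ : (fun x => _) = cst 0)// Rintegral_cst// mul0r.
have [->|/set0P[x0 Dx0]] := eqVneq D1 set0.
  rewrite Rintegral_set0; under eq_Rintegral do rewrite Rintegral_set0.
  by rewrite (_ : (fun x => _) = cst 0)// Rintegral_cst// mul0r.
have C0 : 0 <= C := le_trans (normr_ge0 _) (OC _ _ Dx0 Dy0).
pose F (p : T1 * T2) : R := (g p.1 * \1_D1 p.1) * (O p * \1_D2 p.2).
have mF : measurable_fun setT F.
  apply: measurable_funM; apply: measurable_funM => //; apply: measurableT_comp => //;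
  exact: measurable_indic.
have iF : (m1 \x m2)%E.-integrable setT (EFin \o F).
  apply/integrable12ltyP; first exact/measurable_EFinP.
  apply: (@le_lt_trans _ _ (\int[m1]_(x in D1) ((`|g x| * C)%:E * m2 D2))%E).
    rewrite [leRHS]integral_mkcond; apply: le_integral_nomeas.
      by move=> x _; apply: integral_ge0.
    move=> x _; rewrite patchE; case: ifPn => [|] xD1.
      rewrite -integral_cst// [leRHS]integral_mkcond; apply: le_integral_nomeas => // y _ /=.
      rewrite patchE /F /= !indicE xD1; case: ifPn => yD2; rewrite lee_fin.
        rewrite !mulr1 normrM ler_wpM2l//; apply: OC; exact/set_mem.
      by rewrite !mulr0 normr0.
    rewrite integral0_eq// => y _ /=; rewrite /F /= !indicE (negbTE xD1).
    by rewrite mulr0 mul0r normr0.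
  rewrite -[m2 D2]fineK ?ge0_fin_numE//.
  under eq_integral do rewrite -EFinM -mulrA mulrC EFinM.
  have /integrableP[mg' goo] := ig.
  rewrite ge0_integralZl//; last 2 first.
    by apply/measurable_EFinP; apply: measurableT_comp => //; exact/measurable_EFinP.
    by rewrite lee_fin mulr_ge0// fine_ge0.
  by rewrite lte_mul_pinfty// lee_fin mulr_ge0// fine_ge0.
have E1 y : D2 y -> \int[m1]_(x in D1) (g x * O (x, y)) = \int[m1]_x F (x, y).
  move=> Dy; rewrite Rintegral_mkcond; apply: eq_Rintegral => x _.
  rewrite patchE /F /= !indicE (mem_set Dy) mulr1; case: ifPn => xD; first by rewrite mulr1.
  by rewrite mulr0 mul0r.
have E2 x : D1 x -> g x * \int[m2]_(y in D2) O (x, y) = \int[m2]_y F (x, y).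
  move=> Dx.
  have iO : m2.-integrable D2 (EFin \o (fun y => O (x, y))).
    apply: (@le_integrable _ _ _ _ _ _ _ (EFin \o cst C)) => //.
    - by apply/measurable_EFinP; apply: measurable_funS (measurable_fun_pair2 x mO).
    - by move=> y Dy; rewrite lee_fin (le_trans (OC _ _ Dx Dy))// ler_norm.
    - apply/integrableP; split; first exact/measurable_EFinP.
      by rewrite /= integral_cst// lte_mul_pinfty.
  rewrite -RintegralZl// Rintegral_mkcond; apply: eq_Rintegral => y _.
  rewrite patchE /F /= !indicE (mem_set Dx) mulr1; case: ifPn => yD; first by rewrite mulr1.
  by rewrite !mulr0.
rewrite (eq_Rintegral _ (fun y yD => E1 y (set_mem yD))).
rewrite (eq_Rintegral _ (fun x xD => E2 x (set_mem xD))).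
rewrite Rintegral_mkcond [RHS]Rintegral_mkcond.
transitivity (\int[m2]_y \int[m1]_x F (x, y)).
  apply: eq_Rintegral => y _; rewrite patchE; case: ifPn => // yD.
  rewrite (_ : (fun x => _) = cst 0) ?Rintegral_cst ?mul0r//.
  by apply/funext => x; rewrite /F /= [X in _ * (_ * X)]indicE (negbTE yD) !mulr0.
transitivity (\int[m1]_x \int[m2]_y F (x, y)); last first.
  apply/esym/eq_Rintegral => x _; rewrite patchE; case: ifPn => // xD.
  rewrite (_ : (fun x => _) = cst 0) ?Rintegral_cst ?mul0r//.
  by apply/funext => y; rewrite /F /= [X in (_ * X) * _]indicE (negbTE xD) mulr0 mul0r.
have i1 y : m1.-integrable setT (EFin \o (fun x => F (x, y))).
  have ig1 : m1.-integrable setT ((EFin \o g) \_ D1) by rewrite -integrable_mkcond.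
  have [Dy|nDy] := pselect (D2 y); last first.
    rewrite (_ : _ \o _ = cst 0%E); first exact: integrable0.
    by apply/funext => x; rewrite /F /= [X in _ * (_ * X)]indicE memNset// !mulr0.
  apply: (le_integrable _ _ _ (integrableZl _ C ig1)) => //.
    by apply/measurable_EFinP; exact: (measurable_fun_pair1 y mF).
  move=> x _; rewrite patchE /F /= !indicE (mem_set Dy) mulr1; case: ifPn => xD.
    rewrite mulr1 -EFinM !abse_EFin lee_fin !normrM mulrC ler_wpM2r//.
    by rewrite (ger0_norm C0) OC//; exact/set_mem.
  by rewrite mulr0 mul0r mule0 abse0 normr0.
have i2 x : m2.-integrable setT (EFin \o (fun y => F (x, y))).
  have [Dx|nDx] := pselect (D1 x); last first.
    rewrite (_ : _ \o _ = cst 0%E); first exact: integrable0.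
    by apply/funext => y; rewrite /F /= [X in (_ * X) * _]indicE memNset// mulr0 mul0r.
  have ic : m2.-integrable setT ((EFin \o cst (`|g x| * C)) \_ D2).
    rewrite -integrable_mkcond//; apply/integrableP; split; first exact/measurable_EFinP.
    by rewrite /= integral_cst// lte_mul_pinfty.
  apply: (le_integrable _ _ _ ic) => //.
    by apply/measurable_EFinP; exact: (measurable_fun_pair2 x mF).
  move=> y _; rewrite patchE /F /= !indicE (mem_set Dx) mulr1; case: ifPn => yD.
    rewrite mulr1 lee_fin normrM (le_trans _ (ler_norm _))// ler_wpM2l// OC//.
    exact/set_mem.
  by rewrite !mulr0 normr0 abse0.
rewrite /Rintegral; congr (fine _).
under eq_integral do rewrite fineK ?(integrable_fin_num _ (i1 _))//.
under [RHS]eq_integral do rewrite fineK ?(integrable_fin_num _ (i2 _))//.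
by rewrite -(Fubini iF).
Qed.

Section spectral.
Variables (R : realType) (alpha beta : R) (L : nat).
Variable psi : probability (measurableTypeR R) R.
Hypotheses (alpha_gt0 : 0 < alpha) (beta_gt0 : 0 < beta).
Hypothesis L_ge1 : (1 <= L)%N.
Hypothesis psi_spectral : orthogonality_measure alpha beta L psi.
Notation b := (brate alpha beta L).
Notation A := (tri b (diag_rate alpha beta L) (fun=> beta)).
Notation tame := (tame b (diag_rate alpha beta L) (fun=> beta)).
Notation pis := (pi_seq alpha beta L).
Let q i x := (Qpoly alpha beta L i).[x].

Lemma pi_seq_gt0 k : 0 < pis k.
Proof.
by rewrite /pi_seq mulr_gt0 ?exprn_gt0 ?rho_gt0// ltr0n expn_gt0 L_ge1.
Qed.

(** Detailed balance for birth rates [b] and death rate [beta]. It converts the recurrence of Q into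
    the action of a row of K on pi Q. *)
Lemma pi_seqS k : (1 <= k)%N -> beta * pis k.+1 = b k * pis k.
Proof.
case: k => [//|k] _; rewrite /pi_seq /brate /= big_nat_recr//= exprD.
by rewrite expnS natrM; ring.
Qed.

Lemma Qeval_rec i x : (1 <= i)%N ->
  - x * q i x = beta * q i.-1 x - (b i + beta) * q i x + b i * q i.+1 x.
Proof.
move=> i1; have := congr1 (horner^~ x) (Qpoly_rec alpha_gt0 beta_gt0 L_ge1 i1).
by rewrite !hornerE.
Qed.

Lemma Qeval_measurable i : measurable_fun setT (q i).
Proof.
apply: continuous_measurable_fun => x.
exact/differentiable_continuous/derivable1_diffP/derivable_horner.
Qed.

Let D : set (measurableTypeR R) := [set` `[(0 : R), +oo[].
Let mD : measurable D. Proof. exact: measurable_itv. Qed.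
Let D_ge0 x : D x -> 0 <= x. Proof. by rewrite /D/= in_itv/= andbT. Qed.

Lemma Qeval_sq_integrable i : (1 <= i)%N ->
  psi.-integrable D (EFin \o (fun x => q i x ^+ 2)).
Proof.
move=> i1; have [_ H _] := psi_spectral; apply/integrableP; split.
  apply/measurable_EFinP; apply: measurable_funTS.
  by apply: measurable_funX; exact: Qeval_measurable.
under eq_integral do rewrite /= ger0_norm ?sqr_ge0//.
by rewrite H// ltry.
Qed.

Lemma QQ_integrable i j : psi.-integrable D (EFin \o (fun x => q i x * q j x)).
Proof.
have mQ : measurable_fun D (EFin \o (fun x => q i x * q j x)).
  apply/measurable_EFinP; apply: measurable_funTS.
  by apply: measurable_funM; exact: Qeval_measurable.
case: i mQ => [|i] mQ.
  rewrite (_ : _ \o _ = cst 0%E); first exact: integrable0.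
  by apply/funext => x; rewrite /q /= Qpoly0 horner0 mul0r.
case: j mQ => [|j] mQ.
  rewrite (_ : _ \o _ = cst 0%E); first exact: integrable0.
  by apply/funext => x; rewrite /q /= Qpoly0 horner0 mulr0.
have I := integrableD _ (Qeval_sq_integrable (ltn0Sn i)) (Qeval_sq_integrable (ltn0Sn j)).
apply: (le_integrable _ _ _ (I _)) => // x _ /=.
rewrite lee_fin normrM [leRHS]ger0_norm ?addr_ge0 ?sqr_ge0//.
rewrite -[q i.+1 x ^+ 2]real_normK ?num_real// -[q j.+1 x ^+ 2]real_normK ?num_real//.
by have := sqr_ge0 (`|q i.+1 x| - `|q j.+1 x|); nra.
Qed.

(** The recurrence writes -x Q_i as a combination of Q_(i-1), Q_i and Q_(i+1), so the second moments
    of the Q's already give integrability with the extra factor x. *)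
Lemma xQQ_integrable i j : psi.-integrable D (EFin \o (fun x => - x * q i x * q j x)).
Proof.
case: i => [|i].
  rewrite (_ : _ \o _ = cst 0%E); first exact: integrable0.
  by apply/funext => x; rewrite /q /= Qpoly0 horner0 mulr0 mul0r.
have I i' r := integrableZl mD r (QQ_integrable i' j).
have := integrableD mD (integrableD mD (I i beta)
   (I i.+1 (- (b i.+1 + beta)))) (I i.+2 (b i.+1)).
apply: eq_integrable => // x _ /=.
by rewrite -!EFinM -!EFinD Qeval_rec//=; congr EFin; ring.
Qed.

Lemma Rintegral_QQ i j : (1 <= i)%N -> (1 <= j)%N ->
  pis i * \int[psi]_(x in D) (q i x * q j x) = (i == j)%:R.
Proof.
move=> i1 j1; have [_ H2 H] := psi_spectral.
have [<-|/eqP ij] := eqVneq i j.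
  by rewrite /Rintegral -[X in fine X]/(\int[psi]_(x in D) (q i x ^+ 2)%:E)%E H2//=
    divff// gt_eqF// pi_seq_gt0.
by rewrite /Rintegral H//= mulr0.
Qed.

Section entry.
Variables (T C : R) (j : nat) (F : R -> R) (O : R -> R -> R).
Hypothesis j1 : (1 <= j)%N.
Hypothesis mO : measurable_fun setT (fun p : R * R => O p.1 p.2).
Hypothesis OC : forall t x, 0 <= t <= T -> 0 <= x -> `|O t x| <= C.
Hypothesis OE : forall t x, 0 <= t <= T -> 0 <= x ->
  O t x = F t - x * \int[lebesgue_measure]_(s in `[0, t]) O s x.

(* Column j of the spectral representation, with e^(-xt) generalized to a bounded solution O
   of dO = dF - x O dt: it solves the tridiagonal equation with the forcing F at j. *)
Definition spectral_entry (t : R) (i : nat) : R :=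
  pis i * \int[psi]_(x in D) (q i x * q j x * O t x).

Let mO2 t : measurable_fun setT (O t).
Proof. exact: (measurable_fun_pair2 t mO). Qed.

Lemma mul_O_integrable t (g : R -> R) : 0 <= t <= T -> measurable_fun setT g ->
  psi.-integrable D (EFin \o g) -> psi.-integrable D (EFin \o (fun x => g x * O t x)).
Proof.
move=> ht mg ig; apply: (le_integrable _ _ _ (integrableZl _ C ig)) => //.
  apply/measurable_EFinP; apply: measurable_funTS; apply: measurable_funM => //.
  exact: mO2.
move=> x /D_ge0 x0; rewrite lee_fin !normrM mulrC ler_wpM2r//.
by apply: le_trans (ler_norm _); exact: OC.
Qed.

(** Detailed balance moves the factors pi of the neighbouring rows to row k; the coefficients left
    are those of the recurrence, which sums to -x Q_k under the integral. *)
Lemma tri_spectral_entry t k : 0 <= t <= T ->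
  A (spectral_entry t) k =
    if k is 0%N then 0 else
    pis k * \int[psi]_(x in D) (- x * q k x * q j x * O t x).
Proof.
move=> ht; case: k => [//|k] /=.
have mqq i : measurable_fun setT (fun x => q i x * q j x).
  by apply: measurable_funM; exact: Qeval_measurable.
have I i := mul_O_integrable ht (mqq i) (QQ_integrable i j).
have IZ r i := integrableZl mD r (I i).
rewrite /spectral_entry.
have -> : b k * (pis k * \int[psi]_(x in D) (q k x * q j x * O t x)) =
   beta * (pis k.+1 * \int[psi]_(x in D) (q k x * q j x * O t x)).
  (* In the first row [pi_seqS] does not apply, but the neighbouring integral contains Q_0 = 0. *)
  case: k => [|k]; last first. by rewrite [RHS]mulrA pi_seqS// -mulrA.
  rewrite (_ : \int[psi]_(x in D) (q 0 x * q j x * O t x) = 0) ?mulr0//.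
  rewrite (eq_Rintegral _ (g := cst 0)) ?Rintegral_cst ?mul0r//.
  by move=> x _; rewrite /q Qpoly0 horner0 !mul0r.
rewrite [beta * (pis k.+2 * _)]mulrA pi_seqS//.
transitivity (pis k.+1 * (beta * (\int[psi]_(x in D) (q k x * q j x * O t x))
    + diag_rate alpha beta L k.+1 * (\int[psi]_(x in D) (q k.+1 x * q j x * O t x))
    + b k.+1 * (\int[psi]_(x in D) (q k.+2 x * q j x * O t x)))); first by ring.
congr (_ * _).
rewrite -!RintegralZl//.
rewrite -RintegralD//; [|exact: IZ|exact: IZ].
rewrite -RintegralD//; [|exact: (integrableD _ (IZ _ _) (IZ _ _))|exact: IZ].
by apply: eq_Rintegral => x _; rewrite Qeval_rec// /diag_rate; ring.
Qed.

(** With s the root of pi_i, |Q_i Q_j| is at most s Q_i^2 + Q_j^2 / s, whose integral is 1/s + 1/(s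
    pi_j); multiplication by pi_i = s^2 leaves s. This is the a priori bound for the entries, in the
    weight pi. *)
Lemma spectral_entry_le t i : 0 <= C -> 0 <= t <= T ->
  `|spectral_entry t i| <= C * (1 + (pis j)^-1) * sqrt_weight pis (fun=> 1) i.
Proof.
move=> C0 ht; case: i => [|i].
  rewrite /spectral_entry (eq_Rintegral _ (g := cst 0)); last first.
    by move=> x _; rewrite /q Qpoly0 horner0 !mul0r.
  by rewrite Rintegral_cst// mul0r mulr0 normr0 mulr0.
have p0 := pi_seq_gt0 i.+1; have pj0 := pi_seq_gt0 j.
rewrite /= mulr1; set s := Num.sqrt (pis i.+1).
have s0 : 0 < s by rewrite sqrtr_gt0.
have sE : pis i.+1 = s * s by rewrite -expr2 sqr_sqrtr// ltW.
have mqq : measurable_fun setT (fun x => q i.+1 x * q j x).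
  by apply: measurable_funM; exact: Qeval_measurable.
have I := mul_O_integrable ht mqq (QQ_integrable i.+1 j).
have J1 := integrableZl mD (C * s) (Qeval_sq_integrable (ltn0Sn i)).
have J2 := integrableZl mD (C / s) (Qeval_sq_integrable j1).
have [_ H2 _] := psi_spectral.
rewrite /spectral_entry normrM gtr0_norm//.
have B : `|\int[psi]_(x in D) (q i.+1 x * q j x * O t x)| <=
    C * s * (pis i.+1)^-1 + C / s * (pis j)^-1.
  apply: (le_trans (le_normr_Rintegral _ I)) => //.
  have -> : (pis i.+1)^-1 = \int[psi]_(x in D) (q i.+1 x ^+ 2) by rewrite /Rintegral H2.
  have -> : (pis j)^-1 = \int[psi]_(x in D) (q j x ^+ 2) by rewrite /Rintegral H2.
  rewrite -!RintegralZl//; [|exact: Qeval_sq_integrable|exact: Qeval_sq_integrable].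
  rewrite -RintegralD//; apply: le_Rintegral => //; first exact: integrable_norm.
    exact: (integrableD mD J1 J2).
  move=> x /D_ge0 x0; rewrite !normrM.
  apply: (le_trans (ler_wpM2l _ (OC ht x0))); first by rewrite mulr_ge0.
  rewrite mulrC -!mulrA -mulrDr ler_wpM2l//.
  set u := q i.+1 x; set v := q j x.
  rewrite -[u ^+ 2]real_normK ?num_real// -[v ^+ 2]real_normK ?num_real//.
  have -> : s * `|u| ^+ 2 + s^-1 * `|v| ^+ 2 =
     `|u| * `|v| + ((s * `|u| - 2^-1 * `|v|) ^+ 2 + 3 / 4 * `|v| ^+ 2) / s.
    by field; rewrite gt_eqF.
  by rewrite lerDl divr_ge0 ?(ltW s0)// addr_ge0 ?sqr_ge0// mulr_ge0// sqr_ge0.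
apply: (le_trans (ler_wpM2l (ltW p0) B)).
rewrite sE le_eqVlt; apply/orP; left; apply/eqP.
by field; rewrite !gt_eqF.
Qed.

(** By Fubini the time integral of row k acts on O inside the spectral integral, where [OE] replaces
    -x int O by O - F. The part with O is the entry itself, and orthogonality evaluates the part
    with F. *)
Lemma spectral_entry_bsolves lam : 0 <= C -> tame lam (sqrt_weight pis (fun=> 1)) ->
  bsolves b (diag_rate alpha beta L) (fun=> beta) lam T
    (fun t i => (i == j)%:R * F t) spectral_entry.
Proof.
move=> C0 tp; split; last first.
  exists (C * (1 + (pis j)^-1)), (sqrt_weight pis (fun=> 1)); split=> //.
    by rewrite mulr_ge0// addr_ge0// invr_ge0 ltW// pi_seq_gt0.
  by move=> t i ht; exact: spectral_entry_le.
move=> k.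
have mqq i : measurable_fun setT (fun x => q i x * q j x).
  by apply: measurable_funM; exact: Qeval_measurable.
split.
  apply: tri_measurable => i; apply: measurable_funTS.
  apply: measurable_funM => //.
  under eq_fun do rewrite Rintegral_mkcond.
  apply: (measurable_Rintegral psi (f := fun p : R * R =>
    ((fun x => q i x * q j x * O p.1 x) \_ D) p.2)).
  rewrite (_ : (fun p => _) = fun p : R * R => q i p.2 * q j p.2 * O p.1 p.2 * \1_D p.2).
    apply: measurable_funM; last by apply: measurableT_comp => //; exact: measurable_indic.
    by apply: measurable_funM => //; exact: (measurableT_comp (mqq i)).
  apply/funext => p; rewrite patchE indicE; case: ifPn => _; first by rewrite mulr1.
  by rewrite mulr0.
move=> t ht; have /andP[t0 tT] := ht.
have sub s : `[0, t]%classic s -> 0 <= s <= T.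
  by rewrite /= in_itv/= => /andP[-> st]; exact: le_trans tT.
case: k => [|k].
  rewrite (eq_Rintegral _ (g := cst 0)); last by move=> s /set_mem/sub hs; rewrite tri_spectral_entry.
  rewrite (Rintegral_itv_cst 0 t0) mul0r addr0.
  have := spectral_entry_le 0 C0 ht.
  by rewrite mulr0 normr_le0 (ltn_eqF j1) mul0r => /eqP.
have mx : measurable_fun setT (fun x : R => - x * q k.+1 x * q j x).
  under eq_fun do rewrite -mulrA.
  apply: measurable_funM => //; exact: measurable_funN.
rewrite (eq_Rintegral lebesgue_measure (g := fun s => pis k.+1 *
  \int[psi]_(x in D) (- x * q k.+1 x * q j x * O s x))); last first.
  by move=> s /set_mem/sub hs; rewrite tri_spectral_entry.
have ix := xQQ_integrable k.+1 j.
have it : (lebesgue_measure `[0%R, t]%classic < +oo)%E.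
  by rewrite lebesgue_measure_itv/=; case: ifP; rewrite ?ltry.
have OC' (x s : R) : D x -> `[0, t]%classic s -> `|O s x| <= C.
  by move=> /D_ge0 x0 /sub hs; exact: OC.
have mO' : measurable_fun setT (fun p : R * R => O p.2 p.1).
  apply: (@measurableT_comp _ _ _ _ _ _ (fun p : R * R => O p.1 p.2) _ (fun p : R * R => (p.2, p.1))) => //.
  exact: measurable_fun_pair.
have FB := @Rintegral_Fubini _ _ _ _ R psi lebesgue_measure D `[0, t]%classic
  (fun x => - x * q k.+1 x * q j x) (fun p => O p.2 p.1) C mD (measurable_itv _) it
  ix mx mO' OC'.
have mI : measurable_fun setT (fun s => \int[psi]_(x in D) (- x * q k.+1 x * q j x * O s x)).
  under eq_fun do rewrite Rintegral_mkcond.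
  apply: (measurable_Rintegral psi (f := fun p : R * R =>
    ((fun x => - x * q k.+1 x * q j x * O p.1 x) \_ D) p.2)).
  rewrite (_ : (fun p => _) = fun p : R * R => - p.2 * q k.+1 p.2 * q j p.2 * O p.1 p.2 * \1_D p.2).
    apply: measurable_funM; last by apply: measurableT_comp => //; exact: measurable_indic.
    by apply: measurable_funM => //; exact: (measurableT_comp mx).
  apply/funext => p; rewrite patchE indicE; case: ifPn => _; first by rewrite mulr1.
  by rewrite mulr0.
rewrite RintegralZl//; last first.
  apply: (@integrable_le_cst _ _ (C * \int[psi]_(x in D) `|- x * q k.+1 x * q j x|)).
    exact: measurable_funTS.
  move=> s hs; have hsT : 0 <= s <= T by apply: sub; rewrite /= in_itv.
  have I := mul_O_integrable hsT mx ix.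
  apply: (le_trans (le_normr_Rintegral _ I)) => //.
  have iax := integrable_norm ix.
  rewrite -RintegralZl//; apply: le_Rintegral => //; [exact: integrable_norm|exact: (integrableZl mD C iax)|].
  by move=> x /D_ge0 x0; rewrite normrM mulrC ler_wpM2r//; exact: OC.
rewrite FB.
transitivity ((k.+1 == j)%:R * F t + pis k.+1 * (\int[psi]_(x in D)
    (q k.+1 x * q j x * O t x - F t * (q k.+1 x * q j x)))); last first.
  congr (_ + _ * _); apply: eq_Rintegral => x /set_mem/D_ge0 x0.
  by rewrite {1}(OE ht x0); ring.
rewrite RintegralB//; last 2 first.
  exact: mul_O_integrable (QQ_integrable _ _).
  exact: (integrableZl mD (F t) (QQ_integrable _ _)).
rewrite RintegralZl//; last exact: QQ_integrable.
by rewrite mulrBr [pis _ * (F t * _)]mulrCA Rintegral_QQ// /spectral_entry; ring.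
Qed.

End entry.
End spectral.

(** * Ornstein-Uhlenbeck paths driven by a continuous function *)

Section ornstein_uhlenbeck.
Variables (R : realType) (b : R -> R) (z : R).
Hypothesis cb : continuous b.

(* int_0^t e^(xs) db_s, integrated by parts so as to make sense for each path. *)
Definition exp_pairing (x t : R) : R :=
  expR (x * t) * b t - x * \int[lebesgue_measure]_(s in `[0, t]) (expR (x * s) * b s).

Definition ou (t x : R) : R := expR (- (x * t)) * (z + exp_pairing x t).

Let is_derive_expRM (x t : R) : is_derive t (1 : R) (fun s => expR (x * s)) (x * expR (x * t)).
Proof.
by apply: is_derive_eq; rewrite /GRing.scale/= !mulr1 ?mulr0 ?addr0 ?add0r; ring.
Qed.

Let continuous_expRM (x : R) : continuous (fun s : R => expR (x * s)).
Proof. by move=> t; exact: continuous_derive1 (is_derive_expRM x t). Qed.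

Let continuous_integrand (x : R) : continuous (fun s : R => expR (x * s) * b s).
Proof. by move=> t; apply: cvgM; [exact: continuous_expRM|exact: cb]. Qed.

(** The Ornstein-Uhlenbeck path minus its driving path: it is differentiable at nonnegative times
    although b is only continuous, so calculus is done on it. *)
Let drift (x t : R) : R :=
  expR (- x * t) * (z - x * \int[lebesgue_measure]_(s in `[0, t]) (expR (x * s) * b s)).

Lemma ou_drift x t : ou t x = b t + drift x t.
Proof.
rewrite /ou /drift /exp_pairing mulNr.
have e : expR (- (x * t)) * expR (x * t) = 1 by rewrite -expRD addNr expR0.
set I := \int[_]_(_ in _) _.
transitivity (expR (- (x * t)) * expR (x * t) * b t + expR (- (x * t)) * (z - x * I)).
  by ring.
by rewrite e mul1r.
Qed.

Lemma drift_integral x t : 0 <= t ->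
  drift x t = z - x * \int[lebesgue_measure]_(s in `[0, t]) ou s x.
Proof.
move=> t0.
pose g s := expR (x * s) * b s.
(* Starting the integral at -1 makes 0 an interior point, so that I has a two-sided derivative
   there. *)
pose I (t : R) := \int[lebesgue_measure]_(s in `[-1, t]) g s.
have ig u v : lebesgue_measure.-integrable `[u, v] (EFin \o g).
  by apply: continuous_integrable; exact: continuous_integrand.
have IE s : 0 <= s -> \int[lebesgue_measure]_(s in `[0, s]) g s = I s - I 0.
  move=> s0; rewrite /I Rintegral_itvB// ?bnd_simp ?lerN10//.
  rewrite Rintegral_itv_obnd_cbnd//; apply: integrableS (ig 0 s) => //.
  by apply: subset_itvr; rewrite bnd_simp.
have DI (s : R) : 0 <= s -> is_derive s (1 : R) I (g s).
  move=> s0; have [|||d1 d2] := @continuous_FTC1_closed R g (-1) s (s + 1) _ (ig _ _).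
  - by rewrite ltrDl.
  - by rewrite (lt_le_trans _ s0)// ltrN10.
  - exact: continuous_integrand.
  by apply: DeriveDef => //; rewrite -derive1E.
pose G s := expR (- x * s) * (z - x * (I s - I 0)).
have GE s : 0 <= s -> drift x s = G s by move=> s0; rewrite /drift IE.
have DG (s : R) : 0 <= s -> is_derive s (1 : R) G (- x * (b s + G s)).
  move=> s0; have D := DI s s0; have D' := is_derive_expRM (- x) s.
  have D2 : is_derive s (1 : R) (fun s => z - x * (I s - I 0)) (- (x * g s)).
    by apply: is_derive_eq; rewrite /GRing.scale/= ?mulr1 ?mulr0 ?addr0 ?add0r ?subr0 ?oppr0; ring.
  have := is_deriveM D' D2; rewrite /GRing.scale/= => D3.
  apply: is_derive_eq; rewrite /G /g.
  have e : expR (- x * s) * expR (x * s) = 1 by rewrite -expRD mulNr addNr expR0.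
  by rewrite mulrN [x * (expR _ * _)]mulrCA !mulrA e mul1r; ring.
have H := @Rintegral_FTC2 R G (fun s => - x * (b s + G s)) t t0 _ _.
have {}H : \int[lebesgue_measure]_(s in `[0, t]) (- x * (b s + G s)) = G t - G 0.
  apply: H => s /andP[s0 _]; first exact: DG.
  apply: cvgM; first exact: cvg_cst.
  by apply: cvgD; [exact: cb|exact: (continuous_derive1 (DG s s0))].
have G0 : G 0 = z by rewrite /G mulr0 expR0 subrr mulr0 subr0 mul1r.
rewrite GE// -[G t](subrK (G 0)) -H G0 addrC; congr (_ + _).
have -> : \int[lebesgue_measure]_(s in `[0, t]) ou s x =
    \int[lebesgue_measure]_(s in `[0, t]) (b s + G s).
  apply: eq_Rintegral => s; rewrite inE/= in_itv/= => /andP[s0 _].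
  by rewrite ou_drift GE.
rewrite RintegralZl ?mulNr//.
have cG : {within `[0, t], continuous (fun s => b s + G s)}.
  apply: continuous_in_subspaceT => s; rewrite inE/= in_itv/= => /andP[s0 _].
  by apply: cvgD; [exact: cb|exact: (continuous_derive1 (DG s s0))].
apply: continuous_compact_integrable => //; exact: segment_compact.
Qed.

Lemma ou_integral t x : 0 <= t ->
  ou t x = z + b t - x * \int[lebesgue_measure]_(s in `[0, t]) ou s x.
Proof. by move=> t0; rewrite ou_drift drift_integral//; ring. Qed.

(** The integral term is at most m (e^(xt) - 1), and the prefactor e^(-xt) reduces it to m. The
    bound is thus uniform in x >= 0, as integration against the spectral measure requires. *)
Lemma ou_le (T m : R) t x : (forall s, 0 <= s <= T -> `|b s| <= m) ->
  0 <= t <= T -> 0 <= x -> `|ou t x| <= `|z| + 2 * m.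
Proof.
move=> bm /andP[t0 tT] x0.
have bt : `|b t| <= m by rewrite bm// t0.
have m0 : 0 <= m := le_trans (normr_ge0 _) bt.
rewrite ou_drift (le_trans (ler_normD _ _))//.
suff : `|drift x t| <= `|z| + m by move: bt; lra.
have cm : continuous (fun s : R => m * expR (x * s)).
  by move=> s; apply: cvgM; [exact: cvg_cst|exact: continuous_expRM].
have cx : continuous (fun s : R => x * expR (x * s)).
  by move=> s; apply: cvgM; [exact: cvg_cst|exact: continuous_expRM].
have I1 : \int[lebesgue_measure]_(s in `[0, t]) (x * expR (x * s)) = expR (x * t) - 1.
  rewrite (Rintegral_FTC2 t0 (fun s _ => is_derive_expRM x s) (fun s _ => cx s)).
  by rewrite mulr0 expR0.
have I2 : `|x * \int[lebesgue_measure]_(s in `[0, t]) (expR (x * s) * b s)|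
    <= m * (expR (x * t) - 1).
  rewrite normrM (ger0_norm x0) -I1.
  have B : `|\int[lebesgue_measure]_(s in `[0, t]) (expR (x * s) * b s)|
      <= \int[lebesgue_measure]_(s in `[0, t]) (m * expR (x * s)).
    apply: norm_Rintegral_le => //.
      by apply: measurable_funTS; apply: continuous_measurable_fun; exact: continuous_integrand.
    move=> s /andP[s0 st]; rewrite normrM ger0_norm ?expR_ge0// mulrC.
    by rewrite ler_wpM2r ?expR_ge0// bm// s0 (le_trans st).
  apply: (le_trans (ler_wpM2l x0 B)).
  rewrite RintegralZl//; last by apply: continuous_integrable; exact: continuous_expRM.
  rewrite [X in _ <= _ * X]RintegralZl//; first by rewrite mulrCA.
  by apply: continuous_integrable; exact: continuous_expRM.
rewrite /drift normrM mulNr (ger0_norm (expR_ge0 _)).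
have e : expR (- (x * t)) * expR (x * t) = 1 by rewrite -expRD addNr expR0.
have e0 : 0 <= expR (- (x * t)) by exact: expR_ge0.
have e1 : expR (- (x * t)) <= 1 by rewrite -expR0 ler_expR oppr_le0 mulr_ge0.
apply: (le_trans (ler_wpM2l e0 (le_trans (ler_normB _ _) (lerD (lexx _) I2)))).
rewrite mulrDr lerD//; first by rewrite ler_piMl.
rewrite mulrCA mulrBr e mulr1 ler_piMr//; lra.
Qed.

Lemma ou_measurable : measurable_fun setT (fun p : R * R => ou p.1 p.2).
Proof.
have mg : measurable_fun setT (fun p : R * R => expR (p.1 * p.2) * b p.2).
  apply: measurable_funM; first by apply: measurableT_comp => //; exact: measurable_funM.
  by apply: measurableT_comp => //; exact: continuous_measurable_fun.
have mI := measurable_Rintegral_itv mg.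
have ms : measurable_fun setT (fun p : R * R => (p.2, p.1)) by exact: measurable_fun_pair.
have mxt : measurable_fun setT (fun p : R * R => p.2 * p.1) by exact: measurable_funM.
apply: measurable_funM.
  by apply: measurableT_comp => //; exact: measurable_funN.
apply: measurable_funD => //; apply: measurable_funB.
  apply: measurable_funM; first exact: measurableT_comp.
  by apply: measurableT_comp => //; exact: continuous_measurable_fun.
apply: measurable_funM => //.
exact: (measurableT_comp mI ms).
Qed.

End ornstein_uhlenbeck.

(** * Tails of sequences in L2(w) *)

Section truncation.
Variables (R : realType) (w : nat -> R).
Hypothesis w_gt0 : forall k, (1 <= k)%N -> 0 < w k.

Definition tail_seq (n : nat) (x : nat -> R) (k : nat) : R := if (k < n)%N then 0 else x k.

Lemma tail_seq_L2 n x : L2 w x -> L2 w (tail_seq n x).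
Proof.
move=> [x0 xoo]; apply: (L2_dom w_gt0 ler01 (y := fun k => `|x k|)).
- by rewrite /tail_seq; case: ifP.
- by move=> k _; rewrite mul1r /tail_seq; case: ifP => //; rewrite normr0.
- apply: le_lt_trans xoo; rewrite -[leRHS]mul1e.
  have := L2sqnorm_le w_gt0 ler01 (x := fun k => `|x k|) (y := fun k => `|x k|).
  rewrite expr1n !mul1e => _; rewrite !L2sqnormE//.
  apply: lee_nneseries => k _ /=; first by rewrite lee_fin L2term_ge0.
  by case: k => [|k] /=; rewrite lee_fin// real_normK// num_real.
Qed.

Lemma cvg_tail_seq_norm x : L2 w x -> (fun n => L2norm w (tail_seq n x)) @ \oo --> (0 : R).
Proof.
move=> Lx; have [x0 xoo] := Lx.
have E n : L2sqnorm w (tail_seq n x) = (\sum_(n <= k <oo) (L2term w x k)%:E)%E.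
  rewrite L2sqnormE// [RHS]eseries_cond [RHS]eseries_mkcond.
  apply: eq_eseriesr => k _ /=; rewrite leqNgt /tail_seq.
  by case: k => [|k] /=; case: ifP => // _; rewrite expr0n mul0r.
have C : (fun n => L2sqnorm w (tail_seq n x)) @ \oo --> 0%E.
  under eq_fun do rewrite E.
  apply: nneseries_tail_cvg; first by rewrite -L2sqnormE.
  by move=> k _; rewrite lee_fin L2term_ge0.
rewrite -(sqrtr0 R); apply: (@cvg_comp _ _ _ (fun n => fine (L2sqnorm w (tail_seq n x)))
  Num.sqrt _ (nbhs (0 : R))); first exact: fine_cvg.
exact: sqrt_continuous.
Qed.

End truncation.

Section spectral_series.
Variables (R : realType) (alpha beta : R) (L : nat).
Variable psi : probability (measurableTypeR R) R.
Hypotheses (alpha_gt0 : 0 < alpha) (beta_gt0 : 0 < beta).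
Hypothesis L_ge1 : (1 <= L)%N.
Hypothesis psi_spectral : orthogonality_measure alpha beta L psi.
Notation b := (brate alpha beta L).
Notation dg := (diag_rate alpha beta L).
Notation tame := (tame b dg (fun=> beta)).
Notation bsolves := (bsolves b dg (fun=> beta)).
Notation pis := (pi_seq alpha beta L).
Variables (w : nat -> R) (lam lamp : R).
Hypothesis lam0 : 0 <= lam.
Hypothesis w_gt0 : forall k, (1 <= k)%N -> 0 < w k.
Hypothesis slow_tame : forall N, slow N -> tame lam (sqrt_weight w N).
Hypothesis tame_pi : tame lamp (sqrt_weight pis (fun=> 1)).

(** The sum of the first n entries solves the equation with F cut to coordinates 1 to n. Its
    distance to z is a solution whose forcing is dominated by the tail of m, and the norm of that
    tail tends to 0. *)
Lemma spectral_series (T : R) (F z : R -> nat -> R) (m C : nat -> R) (O : nat -> R -> R -> R) i :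
  0 <= T -> L2 w m -> bsolves lam T F z ->
  (forall t k, 0 <= t <= T -> `|F t k| <= m k) ->
  (forall j, 0 <= C j) ->
  (forall j, measurable_fun setT (fun p : R * R => O j p.1 p.2)) ->
  (forall j t x, 0 <= t <= T -> 0 <= x -> `|O j t x| <= C j) ->
  (forall j t x, 0 <= t <= T -> 0 <= x ->
    O j t x = F t j - x * \int[lebesgue_measure]_(s in `[0, t]) O j s x) ->
  (fun n => \sum_(1 <= j < n) spectral_entry alpha beta L psi j (O j) T i)
    @ \oo --> z T i.
Proof.
move=> T0 Lm bz Fm C0 mO OC OE.
(* The solution z is bounded by a sequence tame at rate [lam], the entries by one tame at rate
   [lamp]; the larger rate suits both and allows subtraction. *)
pose l := Num.max lam lamp.
have l0 : 0 <= l by rewrite le_max lam0.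
have st N : slow N -> tame l (sqrt_weight w N).
  by move=> sN; apply: tame_ge (slow_tame sN); rewrite le_max lexx.
have tp : tame l (sqrt_weight pis (fun=> 1)).
  by apply: tame_ge tame_pi; rewrite le_max lexx orbT.
have {}bz : bsolves l T F z.
  have [sz [M [W [M0 tW zW]]]] := bz; split=> //; exists M, W; split=> //.
  by apply: tame_ge tW; rewrite le_max lexx.
pose y j := spectral_entry alpha beta L psi j.+1 (O j.+1).
have by_ j : bsolves l T (fun t k => (k == j.+1)%:R * F t j.+1) (y j).
  exact: (spectral_entry_bsolves alpha_gt0 beta_gt0 L_ge1 psi_spectral
    (ltn0Sn j) (mO j.+1) (OC j.+1) (OE j.+1) (C0 j.+1) tp).
have bs n := bsolves_sum n (ex_intro _ _ (sqrt_weight_tame st)) by_.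
have bD n := bsolves_sub bz (bs n).
have tsw := sqrt_weight_tame st; have [sw0 _] := tsw.
have FD n t k : 0 <= t <= T ->
    `|F t k - \sum_(j < n) (k == j.+1)%:R * F t j.+1| <= majorant w (tail_seq n.+1 m) k.
  move=> ht; apply: (le_trans _ (le_trans (ler_norm _) (majorant_ge w_gt0 k (tail_seq_L2 w_gt0 n.+1 Lm)))).
  have m0 : m 0%N = 0 by case: Lm.
  have F0 : F t 0%N = 0 by apply/eqP; rewrite -normr_le0 -m0 Fm.
  case: k => [|k]; first by rewrite F0 big1 ?subr0 ?normr0// => j _; rewrite mul0r.
  rewrite /tail_seq ltnS; have [kn|nk] := ltnP k n.
    rewrite (bigD1 (Ordinal kn))//= eqxx mul1r big1 ?addr0 ?subrr ?normr0// => j jk.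
    by rewrite eqSS eq_sym; move: jk; rewrite -val_eqE/= => /negbTE->; rewrite mul0r.
  rewrite big1 ?subr0 ?Fm// => j _; rewrite eqSS gtn_eqF ?mul0r//.
  exact: leq_trans (ltn_ord j) nk.
have B n : `|z T i - \sum_(j < n) y j T i| <=
    expR (l * T) * (Num.sqrt 3 * L2norm w (tail_seq n.+1 m) * sqrt_weight w (fun=> 1) i).
  have Lt := tail_seq_L2 w_gt0 n.+1 Lm.
  have := bsolves_le l0 (bD n) (majorant_tame w_gt0 st Lt) (FD n) i.
  move=> /(_ T); rewrite T0 lexx => /(_ isT); move=> /le_trans; apply.
  rewrite ler_wpM2l ?expR_ge0//.
  have LM : L2 w (majorant w (tail_seq n.+1 m)).
    apply: (majorant_L2 w_gt0 ler01 Lt) => // k; rewrite mul1r ger0_norm//.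
    by have [? _] := majorant_tame w_gt0 st Lt.
  apply: (le_trans (le_trans (ler_norm _) (L2_le_weight w_gt0 i LM))).
  rewrite ler_wpM2r//; rewrite -[Num.sqrt 3]mul1r.
  apply: majorant_norm => // k; rewrite mul1r ger0_norm//.
  by have [? _] := majorant_tame w_gt0 st Lt.
have CB : (fun n => expR (l * T) * (Num.sqrt 3 * L2norm w (tail_seq n.+1 m) *
    sqrt_weight w (fun=> 1) i)) @ \oo --> (0 : R).
  rewrite [X in _ --> X](_ : 0 = expR (l * T) * (Num.sqrt 3 * 0 * sqrt_weight w (fun=> 1) i)); last first.
    by rewrite mulr0 mul0r mulr0.
  apply: cvgM; first exact: cvg_cst.
  apply: cvgM; last exact: cvg_cst.
  apply: cvgM; first exact: cvg_cst.
  by have := cvg_tail_seq_norm w_gt0 Lm; rewrite -(cvg_shiftS (fun n => L2norm w (tail_seq n m))).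
have : (fun n => \sum_(j < n) y j T i) @ \oo --> z T i.
  apply/cvgrPdist_le => eps eps0; move/cvgrPdist_le : CB => /(_ _ eps0).
  apply: filterS => n hn; apply: (le_trans (B n)); move: hn.
  by rewrite sub0r normrN; apply: le_trans; exact: ler_norm.
move=> CY; rewrite -(cvg_shiftS (fun n => \sum_(1 <= j < n)
  spectral_entry alpha beta L psi j (O j) T i)).
rewrite [X in X @ \oo --> _](_ : _ = (fun n => \sum_(j < n) y j T i))//.
by apply/funext => n /=; rewrite big_add1/= big_mkord.
Qed.

End spectral_series.

(** * The support carries the spectral measure *)

Section support.
Variables (R : realType) (psi : probability (measurableTypeR R) R).
Hypothesis psi_ge0 : psi `[0%R, +oo[%classic = 1%E.
Let S := measure_support psi.
Let D : set (measurableTypeR R) := [set` `[(0 : R), +oo[].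

Let null_ball (p : rat * rat) : set (measurableTypeR R) :=
  if psi (ball (ratr p.1 : R) (ratr p.2 : R)) == 0%E
  then ball (ratr p.1 : R) (ratr p.2 : R) else set0.

Let measurable_null_ball p : measurable (null_ball p).
Proof. by rewrite /null_ball; case: ifP => // _; exact: measurable_ball. Qed.

(** Inside a null ball of radius e around x there is a ball with rational centre within e/4 of x and
    rational radius between e/4 and e/2, which still contains x. The union is thus countable, which
    gives both measurability and nullity. *)
Lemma support_compl : ~` S = \bigcup_(p in [set: rat * rat]) null_ball p.
Proof.
apply/seteqP; split=> x.
  move=> /existsNP[e /not_implyP[e0 /negP]]; rewrite -leNgt => Pe.
  have [r1] : exists q : rat, ratr q \in `](e / 4), (e / 2)[.
    by apply: rat_in_itvoo; lra.
  rewrite in_itv/= => /andP[ra rb].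
  have [r2] : exists q : rat, ratr q \in `](x - e / 4), (x + e / 4)[.
    by apply: rat_in_itvoo; lra.
  rewrite in_itv/= => /andP[rc rd].
  exists (r2, r1) => //; rewrite /null_ball/= ifT.
    by rewrite /ball/= ltr_norml; apply/andP; split; lra.
  rewrite eq_le measure_ge0 andbT; apply: le_trans Pe.
  apply: le_measure; rewrite ?inE; [exact: measurable_ball|exact: measurable_ball|].
  by move=> y; rewrite /ball/= !ltr_norml => /andP[h1 h2]; apply/andP; split; lra.
move=> [p _]; rewrite /null_ball; case: ifPn => // /eqP p0 xp Sx.
have e0 : 0 < ratr p.2 - `|ratr p.1 - x| by rewrite subr_gt0; exact: xp.
have := Sx _ e0; rewrite ltNge => /negP; apply.
rewrite -p0; apply: le_measure; rewrite ?inE; [exact: measurable_ball|exact: measurable_ball|].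
move=> y; rewrite /ball/= => h.
have := ler_normD (ratr p.1 - x) (x - y).
have -> : ratr p.1 - x + (x - y) = ratr p.1 - y by ring.
by move: h; lra.
Qed.

Lemma measurable_support : measurable S.
Proof.
rewrite -[S]setCK support_compl; apply: measurableC.
by apply: countable_bigcupT_measurable => //.
Qed.

Lemma support_compl_null : psi (~` S) = 0%E.
Proof.
pose G (n : nat) : set (measurableTypeR R) := if unpickle n is Some p then null_ball p else set0.
have E : ~` S = \bigcup_n G n.
  rewrite support_compl; apply/seteqP; split=> [x [p _ xp]|x [n _]].
    by exists (pickle p); [|rewrite /G pickleK].
  by rewrite /G; case: (unpickle n) => [p xp|//]; exists p.
apply/negligibleP; first by apply: measurableC; exact: measurable_support.
rewrite E; apply: negligible_bigcup => n; rewrite /G.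
case: (unpickle n) => [p|]; last exact: negligible_set0.
rewrite /null_ball; case: ifPn => [/eqP p0|_]; last exact: negligible_set0.
by apply/negligibleP => //; exact: measurable_ball.
Qed.

Lemma support_sub : S `<=` D.
Proof.
move=> x Sx; rewrite /D/= in_itv/= andbT leNgt; apply/negP => x0.
have e0 : 0 < - x by rewrite oppr_gt0.
have := Sx _ e0; rewrite ltNge => /negP; apply.
have mD : measurable D by exact: measurable_itv.
have D0 : psi (~` D) = 0%E by rewrite probability_setC// psi_ge0 subee.
rewrite -D0; apply: le_measure; rewrite ?inE; [exact: measurable_ball|exact: measurableC|].
move=> y; rewrite /ball/= ltr_norml => /andP[h1 h2].
by rewrite /setC/= /D/= in_itv/= andbT => y0; move: h1 h2; lra.
Qed.

Lemma Rintegral_support (f : R -> R) : psi.-integrable D (EFin \o f) ->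
  psi.-integrable S (EFin \o f) /\
  \int[psi]_(x in S) f x = \int[psi]_(x in D) f x.
Proof.
move=> fi; have mD : measurable D by exact: measurable_itv.
have mS := measurable_support.
split; first exact: (integrableS mD mS support_sub fi).
rewrite /Rintegral; congr fine; apply/esym.
rewrite (@negligible_integral _ _ _ psi D (~` S))//; last exact: support_compl_null.
  by rewrite setDE setCK setIC setIidl//; exact: support_sub.
exact: measurableC.
Qed.

End support.

(** * Brownian paths *)

Lemma ge0_integral_normal_prob (R : realType) (m s : R) (f : R -> \bar R) :
  (forall x, (0 <= f x)%E) -> measurable_fun setT f ->
  (\int[normal_prob m s]_x f x =
   \int[lebesgue_measure]_x (f x * (normal_pdf m s x)%:E))%E.
Proof.
move=> f0 mf.
have dom := @normal_prob_dominates R m s.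
rewrite -(Radon_Nikodym_SigmaFinite.change_of_variables dom f0 measurableT mf).
apply: ae_eq_integral => //.
- apply: emeasurable_funM => //.
  exact: measurable_int (Radon_Nikodym_SigmaFinite.f_integrable dom).
- by apply: emeasurable_funM => //; apply/measurable_EFinP; exact: measurable_normal_pdf.
- have H : ae_eq lebesgue_measure setT (Radon_Nikodym_SigmaFinite.f (normal_prob m s) lebesgue_measure)
      (fun x => (normal_pdf m s x)%:E); last by apply: filterS H => x + _; move=> ->.
  apply: integral_ae_eq => //.
  + exact: Radon_Nikodym_SigmaFinite.f_integrable.
  + by apply/measurable_EFinP; exact: measurable_normal_pdf.
  + by move=> E _ mE; rewrite -Radon_Nikodym_SigmaFinite.f_integral.
Qed.

(** Domination by a wider Gaussian density: with y = x^2 / (4 s^2), x^4 times the density of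
    deviation s is at most a constant times the density of deviation sqrt 2 s. The constant is 16
    (from x^4 = 16 s^4 y^2) times 4 (bound of y^2 e^(-y)) times 2 (above sqrt 2). *)
Lemma normal_fourth_moment (R : realType) (s : R) : 0 < s ->
  (\int[normal_prob 0%R s]_x (x ^+ 4)%:E <= (128 * s ^+ 4)%:E)%E.
Proof.
move=> s0; have sN0 : s != 0 by rewrite gt_eqF.
pose s' := Num.sqrt 2 * s.
have s'0 : 0 < s' by rewrite mulr_gt0// sqrtr_gt0.
have s'N0 : s' != 0 by rewrite gt_eqF.
have s'E : s' ^+ 2 = 2 * s ^+ 2 by rewrite exprMn sqr_sqrtr.
rewrite ge0_integral_normal_prob; last 2 first.
  by move=> x; rewrite lee_fin exprn_even_ge0.
  by apply/measurable_EFinP; exact: measurable_funX.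
have B x : x ^+ 4 * normal_pdf 0 s x <= 128 * s ^+ 4 * normal_pdf 0 s' x.
  rewrite !normal_pdfE// /normal_fun !subr0 s'E.
  have pE : normal_peak s = Num.sqrt 2 * normal_peak s'.
    rewrite /normal_peak s'E (_ : 2 * s ^+ 2 * pi *+ 2 = 2 * (s ^+ 2 * pi *+ 2)); last by ring.
    have q2 : Num.sqrt 2 != 0 :> R by rewrite gt_eqF// sqrtr_gt0.
    by rewrite sqrtrM// invfM mulrA divff// mul1r.
  rewrite pE.
  set y := x ^+ 2 / (4 * s ^+ 2).
  have y0 : 0 <= y by rewrite divr_ge0 ?sqr_ge0// mulr_ge0// sqr_ge0.
  have e1 : - x ^+ 2 / (s ^+ 2 *+ 2) = - y + - y by rewrite /y -mulr_natr; field; rewrite gt_eqF.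
  have e2 : - x ^+ 2 / (2 * s ^+ 2 *+ 2) = - y by rewrite /y -mulr_natr; field; rewrite gt_eqF.
  rewrite e1 e2 expRD.
  have x4 : x ^+ 4 = 16 * s ^+ 4 * y ^+ 2 by rewrite /y; field; rewrite gt_eqF.
  (* This is the square of 1 + y/2 <= e^(y/2). *)
  have y2 : y ^+ 2 * expR (- y) <= 4.
    have h := expR_ge1Dx (y / 2).
    have e : expR (- y) = (expR (y / 2) ^+ 2)^-1.
      by rewrite -expRM_natl expRN; congr (expR _)^-1; field.
    rewrite e ler_pdivrMr ?exprn_gt0 ?expR_gt0//.
    have h0 : 0 <= 1 + y / 2 by rewrite addr_ge0// divr_ge0.
    have : (1 + y / 2) ^+ 2 <= expR (y / 2) ^+ 2 by rewrite lerXn2r// nnegrE expR_ge0.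
    by move: y0; clear; nra.
  have q2 : Num.sqrt 2 <= 2 :> R.
    by rewrite -[leRHS](@ger0_norm R 2)// -sqrtr_sqr ler_wsqrtr//; lra.
  rewrite x4.
  have k0 : 0 <= normal_peak s' * expR (- y) * s ^+ 4.
    by rewrite mulr_ge0 ?exprn_ge0 ?(ltW s0)// mulr_ge0 ?normal_peak_ge0 ?expR_ge0.
  have : Num.sqrt 2 * (y ^+ 2 * expR (- y)) <= 2 * 4.
    by rewrite ler_pM// ?sqrtr_ge0// mulr_ge0 ?sqr_ge0 ?expR_ge0.
  move=> /(ler_wpM2l k0) h.
  have -> : 16 * s ^+ 4 * y ^+ 2 * (Num.sqrt 2 * normal_peak s' * (expR (- y) * expR (- y))) =
     16 * (normal_peak s' * expR (- y) * s ^+ 4 * (Num.sqrt 2 * (y ^+ 2 * expR (- y)))) by ring.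
  by apply: le_trans (ler_wpM2l _ h) _ => //; rewrite le_eqVlt; apply/orP; left; apply/eqP; ring.
apply: (@le_trans _ _ (\int[lebesgue_measure]_x ((128 * s ^+ 4)%:E * (normal_pdf 0 s' x)%:E)))%E.
  apply: le_integral_nomeas => x _.
    by rewrite mule_ge0// lee_fin ?exprn_even_ge0// normal_pdf_ge0.
  by rewrite -!EFinM lee_fin.
rewrite ge0_integralZl//.
- by rewrite integral_normal_pdf mule1.
- by apply/measurable_EFinP; exact: measurable_normal_pdf.
- by move=> x _; rewrite lee_fin normal_pdf_ge0.
- by rewrite lee_fin mulr_ge0// exprn_ge0// (ltW s0).
Qed.

(** * Dyadic chaining of a continuous function *)

Section chaining.
Variables (R : realType) (q : R).
Hypotheses (q0 : 0 < q) (q1 : q < 1).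

Definition dyadic (t : R) (n m : nat) : R := t * m%:R / 2 ^+ n.

Definition dyadic_inc (f : R -> R) (t : R) (l j : nat) : R :=
  f (dyadic t l j.+1) - f (dyadic t l j).

Definition inc4 (f : R -> R) (t : R) (l : nat) : R :=
  \sum_(j < (2 ^ l)%N) dyadic_inc f t l j ^+ 4.

(* From a^2 q^-l <= (a^4 q^-(3l) / v + v q^l) / 2, where a^4 is at most the sum of the fourth
   powers of all dyadic increments of level l, so that no supremum needs to be controlled.
   For a Brownian motion of variance v and q^4 = 1/2 its expectation is at most C v q^l. *)
Definition chain_term (v : R) (f : R -> R) (t : R) (l : nat) : R :=
  (2 * (1 - q))^-1 * (inc4 f t l * q^-1 ^+ (3 * l) / v + v * q ^+ l).

Definition chain (v : R) (f : R -> R) (t : R) (n : nat) : \bar R :=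
  (\sum_(n.+1 <= l <oo) (chain_term v f t l)%:E)%E.

(** For t = 0 the quotient is 0 by convention and so is the index; the lemmas on it include this
    case. *)
Definition dyadic_floor (t : R) (n : nat) (s : R) : nat := Num.truncn (2 ^+ n * s / t).

Lemma inc4_ge0 f t l : 0 <= inc4 f t l.
Proof. by apply: sumr_ge0 => j _; rewrite exprn_even_ge0. Qed.

Lemma chain_term_ge0 v f t l : 0 < v -> 0 <= chain_term v f t l.
Proof.
move=> v0; rewrite mulr_ge0// ?invr_ge0 ?mulr_ge0 ?subr_ge0 ?(ltW q1)//.
rewrite addr_ge0 ?mulr_ge0 ?inc4_ge0 ?exprn_ge0 ?invr_ge0 ?(ltW q0) ?(ltW v0)//.
Qed.

Lemma chain_ge0 v f t n : 0 < v -> (0 <= chain v f t n)%E.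
Proof. by move=> v0; apply: nneseries_ge0 => l _ _; rewrite lee_fin chain_term_ge0. Qed.

(** Cauchy-Schwarz with weights q^i, whose sum is at most 1/(1 - q); in the induction the gap is the
    square of q a_0 - (1 - q) S. *)
Lemma weighted_sum_sqr (a : nat -> R) m : (forall i, 0 <= a i) ->
  (\sum_(i < m) a i) ^+ 2 <= (1 - q)^-1 * \sum_(i < m) q^-1 ^+ i * a i ^+ 2.
Proof.
have q1' : 0 < 1 - q by rewrite subr_gt0.
elim: m a => [|m IH] a a0; first by rewrite !big_ord0 expr0n mulr0.
rewrite !big_ord_recl /= expr0 mul1r mulrDr.
have := IH (fun i => a i.+1) (fun i => a0 i.+1).
set S := \sum_(i < m) _; set Q := \sum_(i < m) _ => H.
have -> : \sum_(i < m) q^-1 ^+ bump 0 i * a (bump 0 i) ^+ 2 = q^-1 * Q.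
  by rewrite mulr_sumr; apply: eq_bigr => i _; rewrite /bump/= add1n exprS mulrA.
rewrite [(1 - q)^-1 * (q^-1 * Q)]mulrCA.
have {}H : q^-1 * S ^+ 2 <= q^-1 * ((1 - q)^-1 * Q) by rewrite ler_wpM2l// invr_ge0 ltW.
apply: le_trans (lerD (lexx _) H).
rewrite -(@ler_pM2l _ (q * (1 - q))) ?mulr_gt0//.
have -> : q * (1 - q) * ((1 - q)^-1 * a 0%N ^+ 2 + q^-1 * S ^+ 2) =
   q * a 0%N ^+ 2 + (1 - q) * S ^+ 2 by field; rewrite !gt_eqF.
rewrite -subr_ge0 (_ : _ - _ = (q * a 0%N - (1 - q) * S) ^+ 2); last by ring.
exact: sqr_ge0.
Qed.

Lemma dyadic_floor_le t n s : 0 <= s -> s <= t -> (dyadic_floor t n s <= 2 ^ n)%N.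
Proof.
move=> s0 st; rewrite -(@ler_nat R) natrX.
have t0 := le_trans s0 st.
have x0 : 0 <= 2 ^+ n * s / t by rewrite !mulr_ge0// ?exprn_ge0// invr_ge0.
have /andP[h _] := truncn_itv x0; apply: (le_trans h).
move: t0; rewrite le_eqVlt => /predU1P[<-|t0]; first by rewrite invr0 mulr0 exprn_ge0.
by rewrite ler_pdivrMr// ler_wpM2l// exprn_ge0.
Qed.

Lemma dyadic_floorS t n s : 0 <= s -> s <= t ->
  dyadic_floor t n.+1 s = (dyadic_floor t n s).*2 \/
  dyadic_floor t n.+1 s = (dyadic_floor t n s).*2.+1.
Proof.
move=> s0 st; have t0 := le_trans s0 st.
have x0 k : 0 <= 2 ^+ k * s / t by rewrite !mulr_ge0// ?exprn_ge0// invr_ge0.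
have /andP[a1 a2] := truncn_itv (x0 n); have /andP[b1 b2] := truncn_itv (x0 n.+1).
rewrite /dyadic_floor; set i := Num.truncn (2 ^+ n * s / t) in a1 a2 *.
set j := Num.truncn (2 ^+ n.+1 * s / t) in b1 b2 *.
have E : 2 ^+ n.+1 * s / t = 2 * (2 ^+ n * s / t) by rewrite exprS !mulrA.
rewrite E in b1 b2.
have h1 : (i.*2 < j.+1)%N.
  rewrite -(@ltr_nat R) -muln2 natrM; apply: le_lt_trans b2; rewrite mulrC ler_wpM2l//.
have h2 : (j < i.+1.*2)%N.
  rewrite -(@ltr_nat R) -muln2 natrM; apply: le_lt_trans b1 _; rewrite mulrC ltr_pM2r//.
by clear -h1 h2; lia.
Qed.

Lemma dyadic_floor_close t n s : 0 <= s -> s <= t ->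
  `|s - dyadic t n (dyadic_floor t n s)| <= t / 2 ^+ n.
Proof.
move=> s0 st; have t0 := le_trans s0 st.
have x0 k : 0 <= 2 ^+ k * s / t by rewrite !mulr_ge0// ?exprn_ge0// invr_ge0.
have /andP[a1 a2] := truncn_itv (x0 n).
have p0 : 0 < 2 ^+ n :> R by rewrite exprn_gt0.
move: t0; rewrite le_eqVlt => /predU1P[t0|t0].
  have -> : s = 0 by apply/eqP; rewrite eq_le s0 andbT t0.
  by rewrite /dyadic -t0 !mul0r subr0 normr0.
rewrite /dyadic -/(dyadic_floor t n s) in a1 a2 *; set i := (dyadic_floor t n s)%:R in a1 a2 *.
have -> : s - t * i / 2 ^+ n = (2 ^+ n * s / t - i) * (t / 2 ^+ n).
  by field; rewrite !gt_eqF.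
rewrite normrM [`|t / _|]ger0_norm ?divr_ge0 ?(ltW t0) ?(ltW p0)//.
rewrite ler_piMl ?divr_ge0 ?(ltW t0) ?(ltW p0)// ger0_norm ?subr_ge0//.
by move: a2; rewrite -/(dyadic_floor t n s) -natr1 -/i; lra.
Qed.

(** The dyadic points below s of levels l and l+1 coincide or are neighbours on the finer grid, so a
    single increment of level l+1 is involved, and [inc4] contains its fourth power. *)
Lemma chain_step v f t l s : 0 < v -> 0 <= s -> s <= t ->
  q^-1 ^+ l.+1 * (f (dyadic t l.+1 (dyadic_floor t l.+1 s)) - f (dyadic t l (dyadic_floor t l s))) ^+ 2
   <= (1 - q) * chain_term v f t l.+1.
Proof.
move=> v0 s0 st; set a := _ - _.
have q1' : 0 < 1 - q by rewrite subr_gt0.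
have a4 : a ^+ 4 <= inc4 f t l.+1.
  have E : dyadic t l (dyadic_floor t l s) = dyadic t l.+1 (dyadic_floor t l s).*2.
    by rewrite /dyadic -muln2 natrM exprS; field; rewrite gt_eqF// exprn_gt0.
  rewrite /a E; have := dyadic_floor_le l.+1 s0 st.
  have [->|->] := dyadic_floorS l s0 st; first by rewrite subrr expr0n inc4_ge0.
  move=> h; rewrite /inc4 (bigD1 (Ordinal h))//= -[leLHS]addr0 lerD//.
  by apply: sumr_ge0 => j _; rewrite exprn_even_ge0.
rewrite /chain_term.
have -> : (1 - q) * ((2 * (1 - q))^-1 * (inc4 f t l.+1 * q^-1 ^+ (3 * l.+1) / v + v * q ^+ l.+1))
  = 2^-1 * (inc4 f t l.+1 * q^-1 ^+ (3 * l.+1) / v + v * q ^+ l.+1).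
  by field; rewrite !gt_eqF.
have p0 : 0 < q ^+ l.+1 by rewrite exprn_gt0.
have -> : q^-1 ^+ (3 * l.+1) = (q ^+ l.+1)^-1 ^+ 3 by rewrite mulnC exprM exprVn.
rewrite exprVn; set p := q ^+ l.+1 in p0 *.
have h : a ^+ 4 * p^-1 ^+ 3 / v <= inc4 f t l.+1 * p^-1 ^+ 3 / v.
  by rewrite ler_pM2r ?invr_gt0// ler_wpM2r// exprn_ge0// invr_ge0 ltW.
apply: (@le_trans _ _ (2^-1 * (a ^+ 4 * p^-1 ^+ 3 / v + v * p))); last first.
  by rewrite ler_wpM2l// lerD2r.
have -> : 2^-1 * (a ^+ 4 * p^-1 ^+ 3 / v + v * p) =
   p^-1 * a ^+ 2 + 2^-1 * (v * p) * (a ^+ 2 * p^-1 ^+ 2 / v - 1) ^+ 2.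
  by field; rewrite !gt_eqF.
rewrite lerDl; apply: mulr_ge0; last exact: sqr_ge0.
by rewrite mulr_ge0// mulr_ge0 ?(ltW v0) ?(ltW p0).
Qed.

(** Continuity at s makes f(s) the limit of its values at the dyadic points below s. The increments
    from level n on telescope, and their squared sum is split by [weighted_sum_sqr] into terms
    handled by [chain_step]. *)
Lemma chaining (v : R) (f : R -> R) (t : R) (n : nat) (s : R) : 0 < v -> 0 <= s -> s <= t -> {for s, continuous f} ->
  (((f s - f (dyadic t n (dyadic_floor t n s))) ^+ 2)%:E <= chain v f t n)%E.
Proof.
move=> v0 s0 st cf; have q1' : 0 < 1 - q by rewrite subr_gt0.
pose c l := dyadic t l (dyadic_floor t l s).
have cc : (fun m => c (n + m)%N) @ \oo --> s.
  have C : (fun m => t / 2 ^+ (n + m)) @ \oo --> (0 : R).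
    rewrite (_ : (fun m => t / 2 ^+ (n + m)) = geometric (t / 2 ^+ n) 2^-1).
      by apply: cvg_geometric; rewrite ger0_norm//; lra.
    by apply/funext => m; rewrite /geometric/= exprD invfM mulrA exprVn.
  apply/cvgrPdist_le => eps eps0; move/cvgrPdist_le : C => /(_ _ eps0).
  apply: filterS => m hm; apply: (le_trans (dyadic_floor_close (n + m) s0 st)).
  by move: hm; rewrite sub0r normrN; apply: le_trans; exact: ler_norm.
have cfc : (fun m => ((f (c (n + m)%N) - f (c n)) ^+ 2)%:E) @ \oo --> ((f s - f (c n)) ^+ 2)%:E.
  apply: cvg_EFin; first by apply: nearW.
  have C1 : (fun m => f (c (n + m)%N) - f (c n)) @ \oo --> f s - f (c n).
    by apply: cvgB; [exact: (cvg_comp _ _ cc cf)|exact: cvg_cst].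
  exact: (cvgM C1 C1).
rewrite -(cvg_lim _ cfc)//; apply: lime_le; first exact: cvgP cfc.
apply: nearW => m.
pose a i := `|f (c (n + i).+1) - f (c (n + i)%N)|.
have tel : `|f (c (n + m)%N) - f (c n)| <= \sum_(i < m) a i.
  elim: m => [|m IH]; first by rewrite addn0 subrr normr0 big_ord0.
  rewrite big_ord_recr/= addnS; apply: le_trans (lerD IH (lexx _)).
  have -> : f (c (n + m).+1) - f (c n) =
    (f (c (n + m)%N) - f (c n)) + (f (c (n + m).+1) - f (c (n + m)%N)) by ring.
  exact: ler_normD.
apply: (@le_trans _ _ (\sum_(i < m) chain_term v f t (n + i).+1)%:E).
  rewrite lee_fin -real_normK ?num_real//.
  apply: (@le_trans _ _ ((\sum_(i < m) a i) ^+ 2)).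
    have S0 : 0 <= \sum_(i < m) a i by apply: sumr_ge0 => i _; exact: normr_ge0.
    by rewrite lerXn2r// nnegrE.
  apply: (le_trans (@weighted_sum_sqr a m (fun i => normr_ge0 _))).
  rewrite ler_pdivrMl// mulr_sumr; apply: ler_sum => i _.
  rewrite real_normK ?num_real//; apply: le_trans (chain_step f (n + i) v0 s0 st).
  rewrite ler_wpM2r ?sqr_ge0// -addSn exprD ler_peMl ?exprn_ge0 ?invr_ge0 ?(ltW q0)//.
  by rewrite exprn_ege1// invf_ge1// ltW.
have := @nneseries_lim_ge R (fun l => (chain_term v f t l)%:E) xpredT n.+1 (n.+1 + m)%N.
move=> h; apply: le_trans (h _); last by move=> *; rewrite lee_fin chain_term_ge0.
rewrite -sumEFin -(big_mkord xpredT (fun i => (chain_term v f t (n + i).+1)%:E)).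
rewrite -{1}[n.+1]add0n big_addn addKn.
by under [leRHS]eq_bigr do rewrite addnC addSn.
Qed.

End chaining.

(** Only g is measurable. Raising g to infinity on a measurable null set containing the exceptional
    points preserves its integral and makes the comparison hold everywhere. *)
Lemma ae_le_integral_nomeas d (T : measurableType d) (R : realType)
    (mu : {measure set T -> \bar R}) (D : set T) (f g : T -> \bar R) :
  measurable D -> measurable_fun D g ->
  (forall x, D x -> (0 <= f x)%E) -> (forall x, D x -> (0 <= g x)%E) ->
  {ae mu, forall x, D x -> (f x <= g x)%E} ->
  (\int[mu]_(x in D) f x <= \int[mu]_(x in D) g x)%E.
Proof.
move=> mD mg f0 g0 [N [mN N0 fgN]].
pose g' x := if x \in N then +oo%E else g x.
have gg' x : ~ N x -> g x = g' x by move=> Nx; rewrite /g' memNset.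
have -> : (\int[mu]_(x in D) g x = \int[mu]_(x in D) g' x)%E.
  apply: ge0_ae_eq_integral => //.
  - have mb : measurable_fun setT (fun x => x \in N).
      apply: (measurable_fun_bool true); rewrite setTI (_ : _ @^-1` _ = N)//.
      by apply/seteqP; split=> x; [exact: set_mem|exact: mem_set].
    apply: measurable_fun_if => //; first exact: measurable_funTS.
    apply: measurable_funS mg => //; exact: subIsetl.
  - by move=> x Dx; rewrite /g'; case: ifP => // _; exact: g0.
  - exists N; split=> // x /= H; apply: contrapT => Nx; apply: H => _; exact: gg'.
apply: le_integral_nomeas => // x Dx.
have [Nx|Nx] := pselect (N x); first by rewrite /g' mem_set// leey.
rewrite -gg'//; apply: contrapT => h; apply: Nx; apply: fgN => /= H.
by apply: h; exact: H.
Qed.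

Lemma lipschitz_continuous (R : realType) (g : R -> R) (C : R) :
  (forall s r, `|g s - g r| <= C * `|s - r|) -> continuous g.
Proof.
move=> gC x; apply/cvgrPdist_le => eps eps0; near=> y.
apply: (le_trans (gC x y)).
apply: (@le_trans _ _ ((`|C| + 1) * `|x - y|)).
  by rewrite ler_wpM2r// (le_trans (ler_norm _))// lerDl.
rewrite mulrC -ler_pdivlMr//; near: y.
by apply/nbhs_ballP; exists (eps / (`|C| + 1)) => /=; [rewrite divr_gt0|move=> y /ltW].
Unshelve. all: by end_near. Qed.

Definition clamp (R : realType) (T s : R) : R := Num.max 0 (Num.min s T).

Lemma clamp_itv (R : realType) (T s : R) : 0 <= T -> 0 <= clamp T s <= T.
Proof. by move=> T0; rewrite /clamp le_max lexx ge_max T0 ge_min lexx orbT. Qed.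

Lemma clamp_id (R : realType) (T s : R) : 0 <= s <= T -> clamp T s = s.
Proof. by move=> /andP[s0 sT]; rewrite /clamp min_l// max_r. Qed.

Lemma clamp_lipschitz (R : realType) (T s r : R) : 0 <= T -> `|clamp T s - clamp T r| <= `|s - r|.
Proof.
move=> T0; rewrite /clamp ![Num.max 0 _]maxEle ![Num.min _ T]minEle.
have := ler_norm (s - r); have := ler_norm (r - s); rewrite [`|r - s|]distrC.
set n := `|s - r|; rewrite ler_norml => a b.
by case: (leP s T) => h1; case: (leP r T) => h2; rewrite ?T0;
  case: (leP 0 s) => h3; case: (leP 0 r) => h4;
  apply/andP; split; lra.
Qed.

Lemma Rintegral_shift (R : realType) (G : R -> R) (sigma t : R) :
  continuous G -> 0 <= sigma -> sigma <= t ->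
  \int[lebesgue_measure]_(s in `[0, t]) ((sigma <= s)%R%:R * G (s - sigma)) =
  \int[lebesgue_measure]_(s in `[0, t - sigma]) G s.
Proof.
move=> cG s0 st.
transitivity (\int[lebesgue_measure]_(s in `[sigma, t]) G (s - sigma)).
  rewrite Rintegral_mkcond [RHS]Rintegral_mkcond; apply: eq_Rintegral => s _.
  rewrite !patchE; case: ifPn; case: ifPn; rewrite ?inE/= ?notin_setE/= ?in_itv/=.
  - by move=> /andP[-> _] _; rewrite mul1r.
  - move=> /negP/nandP h /andP[h1 h2]; case: h => /negbTE h; first by rewrite h mul0r.
    by rewrite h2 in h.
  - by move=> /andP[h1 h2] /negP/nandP[]; rewrite ?h2// (le_trans s0 h1).
  - by [].
have F' : derive1 (fun x : R => x - sigma) = cst 1.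
  apply/funext => x; rewrite derive1E; have D : is_derive x (1 : R) (fun x => x - sigma) 1.
    by apply: is_derive_eq; rewrite subr0.
  exact: derive_val.
have := @integration_by_substitution_increasing R (fun x => x - sigma) G sigma t st.
rewrite F' subrr /Rintegral => ->.
- by congr fine; apply: eq_integral => x _; rewrite /= mulr1.
- by move=> x y _ _ xy; rewrite ltrD2r.
- by move=> x _; exact: cvg_cst.
- exact: is_cvg_cst.
- exact: is_cvg_cst.
- have cF : continuous (fun x : R => x - sigma).
    by move=> x; apply: cvgB; [exact: cvg_id|exact: cvg_cst].
  split; [|by apply: cvg_at_right_filter; exact: cF|by apply: cvg_at_left_filter; exact: cF].
  by move=> x _; exact: derivableB.
- exact: continuous_subspaceT.
Qed.

(** * Solutions started at a later time *)

Section shift.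
Variables (R : realType) (a c e : nat -> R) (lam : R).
Notation A := (tri a c e).
Notation tame := (tame a c e lam).
Hypothesis lam0 : 0 <= lam.

Lemma bsolves_lipschitz T x z m s t k : bsolves a c e lam T (fun=> x) z -> tame m ->
  (forall k, `|x k| <= m k) -> 0 <= s <= T -> 0 <= t <= T ->
  `|z s k - z t k| <= `|s - t| * (lam * expR (lam * T)) * m k.
Proof.
move=> bz tm xm hs ht.
wlog st : s t hs ht / s <= t.
  move=> H; have [st|/ltW ts] := leP s t; first exact: H.
  by rewrite distrC [`|s - t|]distrC; exact: H.
have /andP[s0 sT] := hs; have /andP[t0 tT] := ht; have [sz _] := bz; have [_ ek] := sz k.
rewrite distrC [`|s - t|]distrC [`|t - s|]ger0_norm ?subr_ge0//.
have H r : s <= r <= t -> `|A (z r) k - 0| <= lam * expR (lam * T) * m k.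
  move=> /andP[sr rt]; rewrite subr0; apply: tame_normZ => // j.
  have hr : 0 <= r <= T by rewrite (le_trans s0 sr) (le_trans rt).
  apply: (le_trans (bsolves_le lam0 bz tm (fun _ j _ => xm j) j hr)).
  have [m0 _] := tm; have /andP[_ rT] := hr.
  by rewrite ler_wpM2r// ler_expR ler_wpM2l.
have := Rintegral_increment s0 st (bsolves_integrable k bz tT) H.
rewrite mulr0 subr0 !mulrA; apply: le_trans.
by rewrite (ek t ht) (ek s hs) le_eqVlt; apply/orP; left; apply/eqP; congr (`|_|); ring.
Qed.

(** Time invariance: a forcing that jumps from 0 to x at time sigma produces the solution started
    from x, delayed by sigma. Superposing such solutions handles noise frozen on dyadic
    intervals. *)
Lemma bsolves_shift T x z m sigma : 0 <= T -> bsolves a c e lam T (fun=> x) z -> tame m ->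
  (forall k, `|x k| <= m k) -> 0 <= sigma ->
  bsolves a c e lam T (fun t k => (sigma <= t)%R%:R * x k)
    (fun t k => (sigma <= t)%R%:R * z (t - sigma) k).
Proof.
move=> T0 bz tm xm s0; have [sz [M [W [M0 tW zW]]]] := bz.
have shift t : 0 <= t <= T -> sigma <= t -> 0 <= t - sigma <= T.
  by move=> /andP[t0 tT] st; apply/andP; split; lra.
split; last first.
  exists M, W; split=> // t k ht; case: (leP sigma t) => st; last first.
    by rewrite mulr0n mul0r normr0 mulr_ge0//; have [? _] := tW.
  by rewrite mulr1n mul1r zW// shift.
move=> k.
(* Clamping the time to [[0, T]] gives an integrand continuous on the whole line, as the change of
   variables in [Rintegral_shift] requires. *)
pose G s := A (z (clamp T s)) k.
have cG : continuous G.
  have [m0 _] := tm.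
  apply: (@lipschitz_continuous _ _ (lam * (lam * expR (lam * T)) * m k)) => s r.
  rewrite /G -triB.
  apply: (@le_trans _ _ (lam * (`|s - r| * (lam * expR (lam * T))) * m k)); last first.
    by rewrite le_eqVlt; apply/orP; left; apply/eqP; ring.
  apply: tame_normZ => //; first by rewrite mulr_ge0// mulr_ge0// expR_ge0.
  move=> j; apply: (le_trans (bsolves_lipschitz j bz tm xm (clamp_itv s T0) (clamp_itv r T0))).
  by rewrite ler_wpM2r// ler_wpM2r ?mulr_ge0 ?expR_ge0// clamp_lipschitz.
have GE s : 0 <= s <= T -> A (fun k => (sigma <= s)%R%:R * z (s - sigma) k) k =
    (sigma <= s)%R%:R * G (s - sigma).
  move=> hs; rewrite triZ; case: (leP sigma s) => st; last by rewrite mulr0n !mul0r.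
  by rewrite /G clamp_id// shift.
split.
  apply: (@eq_measurable_fun _ _ _ _ _ (fun s => (sigma <= s)%R%:R * G (s - sigma))).
    by move=> s; rewrite inE/= in_itv/= => hs; rewrite GE.
  apply: measurable_funTS; apply: measurable_funM.
    apply: (@measurableT_comp _ _ _ _ _ _ (fun b : bool => b%:R : R)) => //.
    exact: measurable_fun_ler.
  apply: measurableT_comp; first exact: continuous_measurable_fun.
  exact: measurable_funB.
move=> t ht; have /andP[t0 tT] := ht.
rewrite [X in _ = _ + X](_ : _ =
  \int[lebesgue_measure]_(s in `[0, t]) ((sigma <= s)%R%:R * G (s - sigma))); last first.
  apply: eq_Rintegral => s; rewrite inE/= in_itv/= => /andP[s0' st].
  by rewrite GE// s0' (le_trans st).
have [st|st] := leP sigma t; last first.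
  rewrite mulr0n !mul0r add0r [X in _ = X](_ : _ = \int[lebesgue_measure]_(s in `[0, t]) (cst 0) s).
    by rewrite Rintegral_itv_cst// mul0r.
  apply: eq_Rintegral => s; rewrite inE/= in_itv/= => /andP[s0' st'].
  by rewrite leNgt (le_lt_trans st' st) mulr0n mul0r.
rewrite Rintegral_shift// mulr1n !mul1r; have [_ ek] := sz k; rewrite ek ?shift//; congr (_ + _).
apply: eq_Rintegral => s; rewrite inE/= in_itv/= => /andP[s0' st'].
by rewrite /G clamp_id// s0'/= (le_trans st')//; lra.
Qed.

End shift.

(** * Expectation of the chaining bound for one Brownian motion *)

Section brownian_moments.
Context (R : realType) (d : measure_display) (Omega : measurableType d).
Variables (P : probability Omega R) (v : R) (W : R -> Omega -> R).
Hypotheses (v0 : 0 < v) (BW : brownian P v W).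

Lemma brownian_fourth_moment (s t : R) : 0 <= s -> s <= t ->
  (\int[P]_om ((W t om - W s om) ^+ 4)%:E <= (128 * (v * (t - s)) ^+ 2)%:E)%E.
Proof.
have [mW _ _ NW _] := BW.
move=> s0; rewrite le_eqVlt => /predU1P[<-|st].
  rewrite integral0_eq => [|om _]; last by rewrite subrr expr0n.
  by rewrite lee_fin mulr_ge0// sqr_ge0.
have mX : measurable_fun setT (fun om => W t om - W s om : measurableTypeR R).
  by apply: measurable_funB; apply: mW => //; rewrite (le_trans s0)// ltW.
pose Xm := isMeasurableFun.Build _ _ _ _ _ mX.
pose X : {RV P >-> measurableTypeR R} := HB.pack (fun om => W t om - W s om) Xm.
have mf : measurable_fun setT (fun y : measurableTypeR R => ((y : R) ^+ 4)%:E).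
  by apply/measurable_EFinP; exact: measurable_funX.
have f0 (y : R) : (0 <= (y ^+ 4)%:E)%E by rewrite lee_fin exprn_even_ge0.
have -> : (\int[P]_om ((W t om - W s om) ^+ 4)%:E = \int[distribution P X]_y (y ^+ 4)%:E)%E.
  by rewrite ge0_integral_distribution.
have -> : (\int[distribution P X]_y (y ^+ 4)%:E =
    \int[normal_prob 0%R (Num.sqrt (v * (t - s)))]_y (y ^+ 4)%:E)%E.
  by apply: eq_measure_integral => A mA _; exact: NW.
have vt : 0 < v * (t - s) by rewrite mulr_gt0// subr_gt0.
apply: le_trans (normal_fourth_moment _) _; first by rewrite sqrtr_gt0.
by rewrite lee_fin -[4%N]/(2 * 2)%N exprM sqr_sqrtr// ltW.
Qed.

Variable q : R.
Hypotheses (q0 : 0 < q) (q1 : q < 1) (q4 : q ^+ 4 = 2^-1).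

Lemma dyadic_ge0 (t : R) n m : 0 <= t -> 0 <= dyadic t n m.
Proof. by move=> t0; rewrite divr_ge0 ?exprn_ge0// mulr_ge0. Qed.

Lemma dyadicS (t : R) n m : dyadic t n m.+1 - dyadic t n m = t / 2 ^+ n.
Proof. by rewrite /dyadic -natr1; ring. Qed.

Lemma le_dyadic (t : R) n m p : 0 <= t -> (m <= p)%N -> dyadic t n m <= dyadic t n p.
Proof.
move=> t0 mp; rewrite ler_pM2r ?invr_gt0 ?exprn_gt0// ler_wpM2l//.
by rewrite ler_nat.
Qed.

Lemma measurable_inc4 t l : 0 <= t -> measurable_fun setT (fun om => inc4 (W ^~ om) t l).
Proof.
have [mW _ _ _ _] := BW; move=> t0; apply: measurable_sum => j.
by apply: measurable_funX; apply: measurable_funB; apply: mW; exact: dyadic_ge0.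
Qed.

Lemma measurable_chain_term t l : 0 <= t ->
  measurable_fun setT (fun om => chain_term q v (W ^~ om) t l).
Proof.
move=> t0; apply: measurable_funM => //; apply: measurable_funD => //.
by apply: measurable_funM => //; apply: measurable_funM => //; exact: measurable_inc4.
Qed.

Lemma measurable_chain t n : 0 <= t ->
  measurable_fun setT (fun om => chain q v (W ^~ om) t n).
Proof.
move=> t0; under eq_fun do rewrite /chain eseries_cond.
apply: ge0_emeasurable_sum => [l om _ _|l _]; first by rewrite lee_fin chain_term_ge0.
by apply/measurable_EFinP; exact: measurable_chain_term.
Qed.

(** There are 2^l increments, each of fourth moment at most 128 (v t)^2 4^-l. The total is of order
    2^-l = q^(4l), which explains the choice q^4 = 1/2: against the factor q^(-3l) of [chain_term] a
    decay q^l is left. *)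
Lemma integral_inc4 t l : 0 <= t ->
  (\int[P]_om (inc4 (W ^~ om) t l)%:E <= (128 * (v * t) ^+ 2 * q ^+ (4 * l))%:E)%E.
Proof.
have [mW _ _ _ _] := BW; move=> t0.
have mI j : measurable_fun setT (fun om => (dyadic_inc (W ^~ om) t l j ^+ 4)%:E).
  apply/measurable_EFinP.
  by apply: measurable_funX; apply: measurable_funB; apply: mW; exact: dyadic_ge0.
under eq_integral do rewrite /inc4 -sumEFin.
rewrite ge0_integral_sum//; last by move=> j om _; rewrite lee_fin exprn_even_ge0.
apply: (@le_trans _ _ (\sum_(j < (2 ^ l)%N) (128 * (v * (t / 2 ^+ l)) ^+ 2)%:E)%E).
  apply: lee_sum => j _; rewrite -(dyadicS t l j).
  by apply: brownian_fourth_moment; [exact: dyadic_ge0|exact: le_dyadic].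
rewrite sumEFin lee_fin sumr_const card_ord -[X in X <= _]mulr_natr natrX exprM q4 exprVn.
by rewrite le_eqVlt; apply/orP; left; apply/eqP; field; rewrite gt_eqF// exprn_gt0.
Qed.

Definition chain_cst (t : R) : R :=
  (2 * (1 - q))^-1 * (128 * t ^+ 2 + 1) / (1 - q).

Lemma chain_cst_ge0 t : 0 <= chain_cst t.
Proof.
have q1' : 0 < 1 - q by rewrite subr_gt0.
apply: divr_ge0; last exact: ltW.
apply: mulr_ge0; first by rewrite invr_ge0 mulr_ge0// ltW.
by rewrite addr_ge0// mulr_ge0// sqr_ge0.
Qed.

(** Division by v in [chain_term] turns v^2 into v, so both of its parts are linear in v and decay
    like q^l; summing over the levels above n gives a multiple of q^n. *)
Lemma integral_chain t n : 0 <= t ->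
  (\int[P]_om chain q v (W ^~ om) t n <= (v * (chain_cst t * q ^+ n))%:E)%E.
Proof.
move=> t0; have q1' : 0 < 1 - q by rewrite subr_gt0.
under eq_integral do rewrite /chain eseries_cond eseries_mkcond.
rewrite integral_nneseries//; last 2 first.
- move=> l; case: (ltnP n l) => nl /=; last exact: measurable_cst.
  by apply/measurable_EFinP; exact: measurable_chain_term.
- by move=> l om _; case: (ltnP n l) => nl //=; rewrite lee_fin chain_term_ge0.
have E l : (\int[P]_om (if true && (n < l)%N then (chain_term q v (W ^~ om) t l)%:E else 0)
    <= if (n < l)%N then (((2 * (1 - q))^-1 * (128 * t ^+ 2 + 1) * v) * q ^+ l)%:E else 0)%E.
  case: (ltnP n l) => nl /=; last by rewrite integral0.
  have k0 : 0 <= (2 * (1 - q))^-1 by rewrite invr_ge0 mulr_ge0// ltW.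
  have p0 : 0 < q ^+ l by exact: exprn_gt0.
  rewrite /chain_term.
  under eq_integral do rewrite EFinM.
  have mq : measurable_fun setT (fun om => inc4 (W ^~ om) t l * (q^-1 ^+ (3 * l) / v)).
    by apply: measurable_funM => //; exact: measurable_inc4.
  have qv0 : 0 <= q^-1 ^+ (3 * l) / v.
    by rewrite divr_ge0 ?(ltW v0)// exprn_ge0// invr_ge0 ltW.
  have vq0 : 0 <= v * q ^+ l by rewrite mulr_ge0 ?(ltW v0) ?(ltW p0).
  under eq_integral do rewrite -[inc4 _ _ _ * _ / v]mulrA.
  rewrite ge0_integralZl//; last 2 first.
  - by apply/measurable_EFinP; apply: measurable_funD.
  - by move=> om _; rewrite lee_fin addr_ge0// mulr_ge0// inc4_ge0.
  rewrite -[((2 * (1 - q))^-1 * _ * _) * _]mulrA -mulrA EFinM lee_wpmul2l//.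
  under eq_integral do rewrite EFinD.
  rewrite ge0_integralD//; [|by move=> om _; rewrite lee_fin mulr_ge0// inc4_ge0|exact/measurable_EFinP].
  have -> : (\int[P]_om (v * q ^+ l)%:E = (v * q ^+ l)%:E)%E.
    rewrite -[RHS]mule1 -(@probability_setT _ _ _ P).
    exact: (integral_cst P measurableT).
  under eq_integral do rewrite mulrC EFinM.
  rewrite ge0_integralZl//; last 2 first.
  - by apply/measurable_EFinP; exact: measurable_inc4.
  - by move=> om _; rewrite lee_fin inc4_ge0.
  have h := integral_inc4 l t0.
  apply: (le_trans (leeD (lee_wpmul2l _ h) (lexx _))); first by rewrite lee_fin.
  rewrite -EFinM -EFinD lee_fin le_eqVlt; apply/orP; left; apply/eqP.
  have -> : q^-1 ^+ (3 * l) = (q ^+ l)^-1 ^+ 3 by rewrite mulnC exprM exprVn.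
  have -> : q ^+ (4 * l) = (q ^+ l) ^+ 4 by rewrite mulnC exprM.
  by field; rewrite !gt_eqF.
apply: le_trans (lee_nneseries _ (fun l _ => E l)) _.
  by move=> l _ _; apply: integral_ge0 => om _; case: (ltnP n l) => nl //=; rewrite lee_fin chain_term_ge0.
rewrite -(eseries_mkcond (P := fun l => (n < l)%N)).
have K0 : 0 <= (2 * (1 - q))^-1 * (128 * t ^+ 2 + 1) * v.
  rewrite mulr_ge0 ?(ltW v0)// mulr_ge0 ?invr_ge0 ?mulr_ge0 ?(ltW q1')//.
  by rewrite addr_ge0// mulr_ge0// sqr_ge0.
apply: lime_le.
  apply: is_cvg_nneseries => l _ _; rewrite lee_fin.
  by rewrite mulr_ge0// exprn_ge0// ltW.
apply: nearW => N; rewrite sumEFin lee_fin -mulr_sumr.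
have S : \sum_(0 <= l < N | (n < l)%N) q ^+ l <= q ^+ n / (1 - q).
  rewrite ler_pdivlMr//.
  have : (\sum_(0 <= l < N | (n < l)%N) q ^+ l) * (1 - q) <=
     q ^+ n.+1 - (if (n < N)%N then q ^+ N else q ^+ n.+1).
    elim: N => [|N IH]; first by rewrite big_nil mul0r subrr.
    rewrite big_mkcond big_nat_recr//= -big_mkcond/= mulrDl.
    apply: (le_trans (lerD IH (lexx _))); rewrite ltnS.
    have [nN|Nn] := ltnP n N; first by rewrite (ltnW nN) le_eqVlt; apply/orP; left; apply/eqP; rewrite [q ^+ N.+1]exprS; ring.
    rewrite mul0r subrr addr0; case: ifP => [nN|_]; last by rewrite subrr.
    have -> : n = N by apply/eqP; rewrite eqn_leq nN Nn.
    by rewrite subrr.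
  move=> /le_trans; apply; apply: (@le_trans _ _ (q ^+ n.+1)).
    by case: ifP => _; rewrite lerBlDr lerDl exprn_ge0// ltW.
  by rewrite exprS ler_piMl ?(ltW q1)// exprn_ge0// ltW.
apply: (le_trans (ler_wpM2l K0 S)).
by rewrite le_eqVlt; apply/orP; left; apply/eqP; rewrite /chain_cst; ring.
Qed.

End brownian_moments.

(** Brownian paths are continuous on nonnegative times only; they are extended by their value at
    0. *)
Lemma continuous_max0 (R : realType) (f : R -> R) :
  {within `[0, +oo[, continuous f} -> continuous (fun s : R => f (Num.max 0 s)).
Proof.
move=> /continuous_within_itvcyP[cf c0] x.
have [x0|x0|<-] := ltgtP 0 x.
- rewrite /prop_for /continuous_at max_r ?(ltW x0)//.
  have := cf x; rewrite in_itv/= andbT => /(_ x0).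
  apply: cvg_trans; apply: near_eq_cvg; near=> y.
  have y0 : 0 < y by near: y; exact: lt_nbhsr.
  by rewrite max_r// ltW.
- rewrite /prop_for /continuous_at max_l ?(ltW x0)//.
  apply/cvgrPdist_le => eps eps0; near=> y.
  have y0 : y < 0 by near: y; exact: lt_nbhsl.
  by rewrite max_l ?(ltW y0)// subrr normr0 ltW.
rewrite /prop_for /continuous_at maxxx.
apply/cvgrPdist_le => eps eps0.
move/cvgrPdist_le : c0 => /(_ _ eps0); rewrite near_withinE.
apply: filterS => y hy; have [y0|y0] := ltP 0 y; first exact: hy.
by rewrite subrr normr0 ltW.
Unshelve. all: by end_near. Qed.

(** * Domination of the noise paths in L2(w) *)

Section noise.
Context (R : realType) (d : measure_display) (Omega : measurableType d).
Variables (P : probability Omega R) (v w : nat -> R).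
Variables (B : nat -> R -> Omega -> R) (q : R).
Hypotheses (v0 : forall k, (1 <= k)%N -> 0 < v k) (w0 : forall k, (1 <= k)%N -> 0 < w k).
Hypothesis vw_sum : (\sum_(1 <= k <oo) (v k / w k)%:E < +oo)%E.
Hypothesis B0 : forall (t : R) om, 0 <= t -> B 0%N t om = 0.
Hypothesis BB : forall k, (1 <= k)%N -> brownian P (v k) (B k).
Hypotheses (q0 : 0 < q) (q1 : q < 1) (q4 : q ^+ 4 = 2^-1).

Definition noise_term (t : R) (n : nat) (om : Omega) (k : nat) : \bar R :=
  if k is 0%N then 0%E else (((w k)^-1)%:E * chain q (v k) (B k ^~ om) t n)%E.

(** Kept as an extended real so that it is measurable with an estimable expectation before any
    finiteness is known; where finite, it is the squared norm of [noise_bound]. *)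
Definition noise_energy (t : R) (n : nat) (om : Omega) : \bar R :=
  (\sum_(k <oo) noise_term t n om k)%E.

Definition noise_bound (t : R) (n : nat) (om : Omega) (k : nat) : R :=
  if k is 0%N then 0 else Num.sqrt (fine (chain q (v k) (B k ^~ om) t n)).

Lemma noise_term_ge0 t n om k : (0 <= noise_term t n om k)%E.
Proof.
case: k => [//|k] /=; rewrite mule_ge0// ?chain_ge0 ?v0//.
by rewrite lee_fin invr_ge0 ltW// w0.
Qed.

Lemma measurable_noise_energy t n : 0 <= t -> measurable_fun setT (noise_energy t n).
Proof.
move=> t0; apply: ge0_emeasurable_sum => [k om _ _|[|k] _]; first exact: noise_term_ge0.
  exact: measurable_cst.
by apply: measurable_funeM; apply: (measurable_chain (v0 _) (BB _)).
Qed.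

Lemma integral_noise_energy t n : 0 <= t ->
  (\int[P]_om noise_energy t n om <=
   (chain_cst q t * q ^+ n)%:E * \sum_(1 <= k <oo) (v k / w k)%:E)%E.
Proof.
move=> t0; rewrite integral_nneseries//; last 2 first.
- move=> [|k]; first exact: measurable_cst.
  by apply: measurable_funeM; apply: (measurable_chain (v0 _) (BB _)).
- by move=> k om _; exact: noise_term_ge0.
have c0 : 0 <= chain_cst q t * q ^+ n.
  by apply: mulr_ge0; [exact: chain_cst_ge0|exact: exprn_ge0 (ltW q0)].
rewrite [X in (_ <= _ * X)%E]eseries_cond [X in (_ <= _ * X)%E]eseries_mkcond.
rewrite -nneseriesZl; last first.
  by move=> [|k] _ //=; rewrite lee_fin divr_ge0// ltW// ?v0// w0.
apply: lee_nneseries => [k _ _|[|k] _ /=].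
- by apply: integral_ge0 => om _; exact: noise_term_ge0.
- by rewrite integral0 mule0.
have iw : (0 <= ((w k.+1)^-1)%:E :> \bar R)%E by rewrite lee_fin invr_ge0 ltW// w0.
rewrite ge0_integralZl//; last 2 first.
- exact: (measurable_chain (v0 _) (BB _)).
- by move=> om _; rewrite chain_ge0// v0.
apply: (le_trans (lee_wpmul2l iw (integral_chain (v0 _) (BB _) q0 q1 q4 n t0))) => //.
by rewrite -!EFinM lee_fin le_eqVlt; apply/orP; left; apply/eqP; ring.
Qed.

Lemma noise_energy_le t n om : (noise_energy t n om <= noise_energy t 0 om)%E.
Proof.
apply: lee_nneseries => [k _ _|[|k] _ //=]; first exact: noise_term_ge0.
apply: lee_wpmul2l; first by rewrite lee_fin invr_ge0 ltW// w0.
rewrite /chain eseries_cond [leRHS]eseries_cond.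
apply: subset_lee_nneseries => l //.
  by move=> _; rewrite lee_fin chain_term_ge0// v0.
by move=> /=; exact: leq_ltn_trans.
Qed.

Lemma chain_fin t n om k : (1 <= k)%N -> (noise_energy t n om < +oo)%E ->
  chain q (v k) (B k ^~ om) t n \is a fin_num.
Proof.
move=> k1 h; rewrite ge0_fin_numE ?chain_ge0 ?v0//.
have wk := w0 k1.
have h2 : (noise_term t n om k < +oo)%E.
  apply: le_lt_trans h.
  have := @nneseries_lim_ge R (noise_term t n om) xpredT 0 k.+1.
  rewrite big_nat_recr//= => H; apply: le_trans (H _); last by move=> *; exact: noise_term_ge0.
  by rewrite -[leLHS]add0e leeD// sume_ge0// => i _; exact: noise_term_ge0.
case: k k1 wk h2 => [//|k] _ wk /= h2.
rewrite ltNge leye_eq; apply/negP => /eqP e; move: h2; rewrite e.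
by rewrite gt0_muley ?ltxx// lte_fin invr_gt0.
Qed.

Lemma noise_bound_sqnorm t n om : (noise_energy t n om < +oo)%E ->
  L2sqnorm w (noise_bound t n om) = noise_energy t n om.
Proof.
move=> h; rewrite L2sqnormE.
apply: eq_eseriesr => -[|k] _ //=.
rewrite sqr_sqrtr; last by rewrite fine_ge0// chain_ge0// v0.
by rewrite EFinM fineK ?chain_fin// muleC.
Qed.

Lemma noise_bound_L2 t n om : (noise_energy t n om < +oo)%E -> L2 w (noise_bound t n om).
Proof. by move=> h; split=> //; rewrite noise_bound_sqnorm. Qed.

Lemma ae_noise_energy_fin t : 0 <= t -> {ae P, forall om, (noise_energy t 0 om < +oo)%E}.
Proof.
move=> t0.
have i : P.-integrable setT (noise_energy t 0).
  apply/integrableP; split; first exact: measurable_noise_energy.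
  rewrite (eq_integral (noise_energy t 0)); last first.
    by move=> om _; rewrite gee0_abs//; apply: nneseries_ge0 => k _ _; exact: noise_term_ge0.
  apply: le_lt_trans (integral_noise_energy 0 t0) _.
  by rewrite lte_mul_pinfty// lee_fin expr0 mulr1 chain_cst_ge0.
have := integrable_ae measurableT i; apply: filterS => om /(_ Logic.I).
by rewrite fin_numElt => /andP[].
Qed.

Definition regular_path (om : Omega) : Prop :=
  forall k, (1 <= k)%N -> B k 0 om = 0 /\ {within `[0, +oo[, continuous (fun t => B k t om)}.

Lemma ae_regular_path : {ae P, forall om, regular_path om}.
Proof.
have : {ae P, forall om, forall k, B k.+1 0 om = 0 /\
    {within `[0, +oo[, continuous (fun t => B k.+1 t om)}}.
  apply/ae_foralln => k; have [_ h1 h2 _ _] := BB (ltn0Sn k).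
  by apply: filterS2 h1 h2 => om.
by apply: filterS => om H [//|k] _; exact: H.
Qed.

Lemma noise_chaining (t : R) n om k (s : R) : regular_path om -> (noise_energy t n om < +oo)%E ->
  0 <= s -> s <= t ->
  `|B k s om - B k (dyadic t n (dyadic_floor t n s)) om| <= noise_bound t n om k.
Proof.
move=> reg h s0 st; have t0 := le_trans s0 st.
case: k => [|k]; first by rewrite !B0// ?dyadic_ge0// subrr normr0.
have k1 := ltn0Sn k; have [_ cB] := reg _ k1.
pose f (r : R) := B k.+1 (Num.max 0 r) om.
have fE (r : R) : 0 <= r -> f r = B k.+1 r om by move=> r0; rewrite /f max_r.
have cE : chain q (v k.+1) f t n = chain q (v k.+1) (B k.+1 ^~ om) t n.
  apply: eq_eseriesr => l _; congr (_%:E); rewrite /chain_term; congr (_ * (_ * _ / _ + _)).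
  by apply: eq_bigr => j _; rewrite /dyadic_inc !fE ?dyadic_ge0.
have cf : {for s, continuous f} by move: s {s0 st}; exact: (continuous_max0 cB).
have := chaining q0 q1 n (v0 k1) s0 st cf; rewrite cE !fE ?dyadic_ge0//.
rewrite -[X in (_ <= X)%E]fineK ?chain_fin// lee_fin => H.
by rewrite -sqrtr_sqr /=; exact: ler_wsqrtr.
Qed.

(** Chaining from level 0, where for s < t the dyadic point below s is 0 and the noise vanishes. At
    s = t that point would be t itself, hence the strict inequality. *)
Lemma noise_le_bound (t : R) om k (s : R) : regular_path om -> (noise_energy t 0 om < +oo)%E ->
  0 <= s -> s < t -> `|B k s om| <= noise_bound t 0 om k.
Proof.
move=> reg h s0 st; have t0 := le_lt_trans s0 st.
have := noise_chaining k reg h s0 (ltW st).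
rewrite /dyadic_floor expr0 mul1r.
have -> : Num.truncn (s / t) = 0%N.
  have st0 : 0 <= s / t by exact: divr_ge0 s0 (ltW t0).
  by apply/eqP; rewrite truncn_eq// st0 /= ltr_pdivrMr// mul1r.
rewrite /dyadic mulr0 mul0r.
case: k => [|k]; first by rewrite (B0 om (lexx 0)) subr0.
by have [-> _] := reg _ (ltn0Sn k); rewrite subr0.
Qed.

(** Integer horizons suffice for all times and keep the exceptional events countable in number. *)
Definition good_path (om : Omega) : Prop :=
  regular_path om /\ forall N : nat, (noise_energy N%:R 0 om < +oo)%E.

Lemma ae_good_path : {ae P, forall om, good_path om}.
Proof.
have : {ae P, forall om, forall N : nat, (noise_energy N%:R 0 om < +oo)%E}.
  by apply/ae_foralln => N; exact: ae_noise_energy_fin.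
by have := ae_regular_path; apply: filterS2 => om ? ?; split.
Qed.

Lemma good_path_bound (tau : R) om : good_path om -> exists2 m, L2 w m &
  forall s k, 0 <= s -> s <= tau -> `|B k s om| <= m k.
Proof.
move=> [reg h]; have [N hN] : exists N : nat, tau < N%:R.
  have [tau0|tau0] := leP 0 tau; last by exists 0%N.
  by exists (Num.truncn tau).+1; have /andP[] := truncn_itv tau0.
exists (noise_bound N%:R 0 om); first exact: noise_bound_L2.
by move=> s k s0 st; apply: noise_le_bound => //; exact: le_lt_trans hN.
Qed.

Lemma good_path_L2 om (s : R) : good_path om -> 0 <= s -> L2 w (fun k => B k s om).
Proof.
move=> g s0; have [m [m0 moo] mB] := good_path_bound s g.
apply: (L2_dom w0 ler01 (y := m)) => //; first exact: B0.
by move=> k _; rewrite mul1r mB.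
Qed.

End noise.

(** * Stochastic integrals *)

Lemma L2sqnorm_unit_seq (R : realType) (w : nat -> R) j :
  (forall k, (1 <= k)%N -> 0 < w k) -> (1 <= j)%N ->
  L2sqnorm w (unit_seq R j) = ((w j)^-1)%:E.
Proof.
move=> w0 j1; rewrite L2sqnormE (@nneseriesD1 _ _ j)//; last first.
  by move=> k _; rewrite lee_fin L2term_ge0.
rewrite eseries0 ?adde0; last first.
  by case=> [|i] _ //= ij; rewrite /unit_seq (negPf ij) expr0n mul0r.
by case: j j1 => // j _ /=; rewrite /unit_seq eqxx expr1n mul1r.
Qed.

Lemma telescope_lt (R : realType) (f : nat -> R) N fl :
  \sum_(m < N) ((m < fl)%N%:R * (f m.+1 - f m)) = f (minn N fl) - f 0%N.
Proof.
elim: N => [|N IH]; first by rewrite big_ord0 min0n subrr.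
rewrite big_ord_recr /= IH; case: ltnP => h.
  by rewrite mul1r (minn_idPl h); ring.
by rewrite mul0r addr0 (minn_idPr (leqW h)).
Qed.

Lemma dyadic_cover (R : realType) (t r : R) n : 0 < r -> r <= t ->
  exists2 m, (m < 2 ^ n)%N & dyadic t n m < r <= dyadic t n m.+1.
Proof.
move=> r0 rt; have dt : dyadic t n (2 ^ n) = t.
  by rewrite /dyadic natrX mulfK// expf_neq0.
have ex : exists p, r <= dyadic t n p by exists (2 ^ n)%N; rewrite dt.
have [[|p] hp minp] := ex_minnP ex.
  by move: hp; rewrite /dyadic mulr0 mul0r leNgt r0.
exists p.
  by have := minp (2 ^ n)%N; rewrite dt => /(_ rt).
by rewrite hp andbT ltNge; apply/negP => /minp; rewrite ltnn.
Qed.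

(** Exactly one of the intervals open on the left and closed on the right contains r, and its right
    end is within t 2^-n of r. Time 0 lies in none of them. *)
Lemma step_op_dyadic (R : realType) (t r : R) n A : 0 < r -> r <= t ->
  exists m, [/\ (m < 2 ^ n)%N, `|dyadic t n m.+1 - r| <= t / 2 ^+ n, dyadic t n m.+1 <= t &
    forall x k, step_op (2 ^ n) (dyadic t n) A r x k = A m x k].
Proof.
move=> r0 rt; have t0 : 0 <= t := le_trans (ltW r0) rt.
have [m mN /andP[h1 h2]] := dyadic_cover n r0 rt.
have dt : dyadic t n (2 ^ n) = t by rewrite /dyadic natrX mulfK// expf_neq0.
exists m; split => //.
- by have := dyadicS t n m => <-; rewrite ger0_norm ?subr_ge0// lerD2l lerN2 ltW.
- by rewrite -[leRHS]dt; exact: le_dyadic.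
move=> x k; rewrite /step_op (bigD1 (Ordinal mN))//= big1 ?addr0.
  by rewrite indicE mem_set ?mul1r//= in_itv/= h1 h2.
move=> i im; rewrite indicE memNset ?mul0r//= in_itv/= => /andP[i1 i2].
have {im} : (i : nat) != m by [].
rewrite neq_ltn => /orP[im|mi].
  by have := le_lt_trans (le_trans i2 (le_dyadic n t0 im)) h1; rewrite ltxx.
by have := lt_le_trans i1 (le_trans h2 (le_dyadic n t0 mi)); rewrite ltxx.
Qed.

(** * Convergence of dyadic step integrals *)

Section integral.
Context (R : realType) (d : measure_display) (Omega : measurableType d).
Variables (P : probability Omega R) (v w : nat -> R).
Variables (B : nat -> R -> Omega -> R) (a c e : nat -> R) (lam : R).
Variables (kap t : R) (E : R -> (nat -> R) -> nat -> R).
Hypotheses (v0 : forall k, (1 <= k)%N -> 0 < v k) (w0 : forall k, (1 <= k)%N -> 0 < w k).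
Hypothesis vw_sum : (\sum_(1 <= k <oo) (v k / w k)%:E < +oo)%E.
Hypothesis B0 : forall (t : R) om, 0 <= t -> B 0%N t om = 0.
Hypothesis BB : forall k, (1 <= k)%N -> brownian P (v k) (B k).
Hypotheses (lam0 : 0 <= lam) (t0 : 0 <= t).
Hypothesis tame_majorant : forall x, L2 w x -> tame a c e lam (majorant w x).
Hypothesis E_solves : forall x, L2 w x -> bsolves a c e lam t (fun=> x) (fun tau => E tau x).
Hypothesis E_bounded : forall tau, 0 <= tau -> bounded_op w (E tau).

(* The maximum makes this a bounded operator for the irrelevant m >= 2^n too. *)
Definition dyadic_op (n m : nat) : (nat -> R) -> nat -> R :=
  fun x k => kap * E (Num.max 0 (t - dyadic t n m.+1)) x k.

(** On a unit vector the time-Lipschitz bound of E gives an error at most C times its majorant, of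
    squared norm at most 3 C^2 / w j; summing against v j gives the result. The scalar [kap] will be
    1 for the semigroup of K and e^(xt) for the scalar integrals. *)
Lemma HS_dyadic_le n r : 0 < r -> r <= t ->
  (HS_sqdist w v (step_op (2 ^ n) (dyadic t n) (dyadic_op n) r)
     (fun x k => (kap * E (t - r) x k)%R) <=
   (3 * (`|kap| * (t / 2 ^+ n * (lam * expR (lam * t)))) ^+ 2)%:E *
     \sum_(1 <= k <oo) (v k / w k)%:E)%E.
Proof.
move=> r0 rt; have [m [mN cl dt hs]] := step_op_dyadic n (dyadic_op n) r0 rt.
set C := `|kap| * _; have C0 : 0 <= C.
  by apply: mulr_ge0 => //; apply: mulr_ge0; apply: mulr_ge0 => //; exact: expR_ge0.
rewrite /HS_sqdist eseries_cond [X in (_ <= _ * X)%E]eseries_cond.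
rewrite eseries_mkcond [X in (_ <= _ * X)%E]eseries_mkcond.
rewrite -nneseriesZl; last first.
  by move=> [|k] _ //=; rewrite lee_fin divr_ge0// ltW// ?v0// w0.
apply: lee_nneseries => [[|j] _ _ //=|[|j] _ /=].
- by apply: mule_ge0; [rewrite lee_fin ltW// v0|exact: L2sqnorm_ge0].
- by rewrite mule0.
have Lu : L2 w (unit_seq R j.+1).
  by split => //; rewrite (L2sqnorm_unit_seq w0)// ltry.
have tm := tame_majorant Lu.
have H : (L2sqnorm w (fun k => (step_op (2 ^ n) (dyadic t n) (dyadic_op n) r (unit_seq R j.+1) k -
    kap * E (t - r) (unit_seq R j.+1) k)%R) <= (C ^+ 2)%:E * (3%:E * ((w j.+1)^-1)%:E))%E.
  apply: le_trans (L2sqnorm_le w0 C0 (y := majorant w (unit_seq R j.+1)) _) _.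
    move=> k _; rewrite hs /dyadic_op max_r ?subr_ge0// -mulrBr normrM /C -[leRHS]mulrA.
    rewrite ler_wpM2l//.
    have := bsolves_lipschitz lam0 (s := t - dyadic t n m.+1) (t := t - r) k (E_solves Lu) tm
      (fun k => majorant_ge w0 k Lu).
    rewrite !subr_ge0 !gerBl dt rt (ltW r0) dyadic_ge0// => /(_ isT isT).
    move=> h; apply: (le_trans h); have [mj0 _] := tm.
    apply: ler_wpM2r => //; apply: ler_wpM2r; first by rewrite mulr_ge0// expR_ge0.
    rewrite (_ : t - _ - _ = - (dyadic t n m.+1 - r)); last by ring.
    by rewrite normrN.
  apply: lee_wpmul2l; first by rewrite lee_fin sqr_ge0.
  rewrite -(L2sqnorm_unit_seq w0)//; apply: majorant_sqnorm => //; by case: Lu.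
apply: le_trans (lee_wpmul2l _ H) _; first by rewrite lee_fin ltW// v0.
by rewrite -!EFinM lee_fin le_eqVlt; apply/orP; left; apply/eqP; ring.
Qed.

Lemma cvg_HS_dyadic :
  (fun n => \int[lebesgue_measure]_(r in `[0%R, t])
     HS_sqdist w v (step_op (2 ^ n) (dyadic t n) (dyadic_op n) r)
       (fun x k => (kap * E (t - r) x k)%R))%E @ \oo --> (0 : \bar R)%E.
Proof.
pose S := fine (\sum_(1 <= k <oo) (v k / w k)%:E)%E.
have SE : (\sum_(1 <= k <oo) (v k / w k)%:E = S%:E)%E.
  rewrite fineK// ge0_fin_numE// eseries_cond; apply: nneseries_ge0 => k _ k1.
  by rewrite lee_fin divr_ge0// ltW// ?v0// w0.
pose D n := 3 * (`|kap| * (t / 2 ^+ n * (lam * expR (lam * t)))) ^+ 2 * S.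
have HS0 n r : (0 <= HS_sqdist w v (step_op (2 ^ n) (dyadic t n) (dyadic_op n) r)
       (fun x k => (kap * E (t - r) x k)%R))%E.
  rewrite /HS_sqdist eseries_cond; apply: nneseries_ge0 => j _ j1.
  by apply: mule_ge0; [rewrite lee_fin ltW// v0|exact: L2sqnorm_ge0].
have D0 n : 0 <= D n.
  apply: mulr_ge0; first by rewrite mulr_ge0// sqr_ge0.
  rewrite -lee_fin -SE eseries_cond; apply: nneseries_ge0 => k _ k1.
  by rewrite lee_fin divr_ge0// ltW// ?v0// w0.
apply: (@squeeze_cvge _ _ _ _ (cst 0%E) _ (fun n => (D n * t)%:E)).
- apply: nearW => n; apply/andP; split; first by apply: integral_ge0 => r _; exact: HS0.
  apply: le_trans (ae_le_integral_nomeas (g := cst (D n)%:E) _ _ _ _ _) _ => //.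
  + by move=> r _; rewrite lee_fin.
  (* [HS_dyadic_le] is stated for r > 0; the single time 0 is a null set. *)
  + exists [set 0]; split; [exact: measurable_set1|exact: lebesgue_measure_set1|].
    move=> r /= H; apply/eqP; rewrite eq_le; apply/andP; split.
      rewrite leNgt; apply/negP => r0; apply: H; rewrite in_itv/= => /andP[_ rt].
      by rewrite /D EFinM -SE; exact: HS_dyadic_le.
    by rewrite leNgt; apply/negP => r0; apply: H; rewrite in_itv/= leNgt r0.
  + rewrite integral_cst// [X in (_ * X <= _)%E](_ : _ = t%:E) ?EFinM//.
    have := @lebesgue_measure_itv R `[0, t]; rewrite /= lte_fin => ->.
    by case: (ltgtP 0 t) t0 => // [_ _|<- _]; rewrite ?oppr0 ?adde0.
- exact: cvg_cst.
- apply: cvg_EFin; first by exact: nearW.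
  rewrite (_ : _ \o _ = fun n => (3 * (`|kap| * (t * (lam * expR (lam * t)))) ^+ 2 * S * t) *
     (4^-1) ^+ n); last first.
    apply/funext => n /=; rewrite /D (_ : (4^-1 : R) = (2^-1) ^+ 2); last by rewrite exprVn; lra.
    by rewrite -exprM mulnC exprM exprVn; ring.
  rewrite -[X in _ --> X](mulr0 (3 * (`|kap| * (t * (lam * expR (lam * t)))) ^+ 2 * S * t)).
  by apply: cvgM; [exact: cvg_cst|apply: cvg_expr; rewrite ger0_norm ?invr_ge0// invf_lt1// ltr1n].
Qed.
Variable q : R.
Hypotheses (q0 : 0 < q) (q1 : q < 1) (q4 : q ^+ 4 = 2^-1).

Lemma dyadic_increments n om k s : regular_path B om -> 0 <= s -> s <= t ->
  \sum_(m < (2 ^ n)%N) ((dyadic t n m.+1 <= s)%R%:R *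
     (B k (dyadic t n m.+1) om - B k (dyadic t n m) om))
  = B k (dyadic t n (dyadic_floor t n s)) om.
Proof.
move=> reg s0 st.
have b0 : B k 0 om = 0.
  by case: k => [|k]; [exact: B0|have [->] := reg _ (ltn0Sn k)].
have fN := dyadic_floor_le n s0 st.
case: (ltgtP 0 t) t0 => // [tp|tz] _; last first.
  by rewrite /dyadic -tz !mul0r b0 big1// => m _; rewrite !mul0r subrr mulr0.
have d0 : dyadic t n 0 = 0 by rewrite /dyadic mulr0 mul0r.
have := telescope_lt (fun m => B k (dyadic t n m) om) (2 ^ n) (dyadic_floor t n s).
rewrite (minn_idPr fN) d0 b0 subr0 => <-; apply: eq_bigr => m _; congr (_%:R * _).
rewrite /dyadic_floor truncn_gt_nat ler_pdivlMr// /dyadic ler_pdivrMr ?exprn_gt0//.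
by rewrite mulrC [s * _]mulrC.
Qed.

(* The step integral is the value at t of the solution driven by the noise frozen on dyadic
   intervals, so the error is that of a solution with forcing bounded by noise_bound. *)
Lemma step_integral_le n om (y : R -> nat -> R) k : good_path v w B q om ->
  (noise_energy v w B q t 0 om < +oo)%E ->
  bsolves a c e lam t (fun s k => B k s om) y ->
  `|step_integral B (2 ^ n) (dyadic t n) (dyadic_op n) om k - kap * y t k| <=
    (`|kap| * expR (lam * t)) * majorant w (noise_bound v B q t n om) k.
Proof.
move=> gom h by_; have hn := le_lt_trans (noise_energy_le B v0 w0 q0 q1 t n om) h.
have Lb := noise_bound_L2 v0 w0 q0 q1 hn; have tb := tame_majorant Lb.
have LB (s : R) : 0 <= s -> L2 w (fun j => B j s om).
  by move=> s0; exact: (good_path_L2 v0 w0 B0 q0 q1 gom).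
pose D m j := B j (dyadic t n m.+1) om - B j (dyadic t n m) om.
have LD m : L2 w (D m) by apply: (L2_sub w0); apply: LB; exact: dyadic_ge0.
pose Z m (s : R) k := (dyadic t n m.+1 <= s)%R%:R * E (s - dyadic t n m.+1) (D m) k.
have bZ m : bsolves a c e lam t (fun s k => (dyadic t n m.+1 <= s)%R%:R * D m k) (Z m).
  apply: (bsolves_shift lam0 t0 (E_solves (LD m)) (tame_majorant (LD m))).
    by move=> j; exact: majorant_ge.
  exact: dyadic_ge0.
have bS := bsolves_sum (2 ^ n) (ex_intro _ _ tb) bZ.
have bd := bsolves_sub bS by_.
have Zt m : (m < 2 ^ n)%N -> kap * Z m t k = dyadic_op n m (D m) k.
  move=> mN; have st : dyadic t n m.+1 <= t.
    have dt : dyadic t n (2 ^ n) = t by rewrite /dyadic natrX mulfK// expf_neq0.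
    by rewrite -[leRHS]dt; exact: le_dyadic.
  by rewrite /Z /dyadic_op st mul1r max_r// subr_ge0.
rewrite (_ : _ - _ = kap * (\sum_(m < (2 ^ n)%N) Z m t k - y t k)); last first.
  by rewrite mulrBr mulr_sumr; congr (_ - _); apply: eq_bigr => m _; rewrite Zt.
rewrite normrM -mulrA ler_wpM2l//.
apply: (bsolves_le lam0 bd tb); last by rewrite t0 lexx.
move=> s j /andP[s0 st]; rewrite (dyadic_increments n j (proj1 gom) s0 st) distrC.
apply: le_trans (noise_chaining v0 w0 B0 q0 q1 j (proj1 gom) hn s0 st) _.
by apply: le_trans (ler_norm _) _; exact: majorant_ge.
Qed.

(** The dyadic operators serve as approximations for both limits: [cvg_HS_dyadic] for the integrand,
    and for the integral the pathwise error of [step_integral_le], whose expected square decays like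
    q^n by [integral_noise_energy]. *)
Lemma stochastic_integral_dyadic (y : Omega -> R -> nat -> R) (Y : Omega -> nat -> R) :
  (forall k, measurable_fun setT (fun om => Y om k)) ->
  {ae P, forall om, L2 w (Y om)} ->
  {ae P, forall om, bsolves a c e lam t (fun s k => B k s om) (y om)} ->
  {ae P, forall om, forall k, Y om k = kap * y om t k} ->
  stochastic_integral P w v B t (fun s x k => kap * E (t - s) x k) Y.
Proof.
move=> mY LY ys Yy; split => //.
exists (fun n => 2 ^ n)%N, (fun n => dyadic t n), dyadic_op; split.
- move=> n; split; first by rewrite /dyadic mulr0 mul0r.
    by rewrite /dyadic natrX mulfK// expf_neq0.
  by move=> m p mp; exact: le_dyadic.
- move=> n m; have [E1 E2 [C E3]] : bounded_op w (E (Num.max 0 (t - dyadic t n m.+1))).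
    by apply: E_bounded; rewrite le_max lexx.
  split.
  + move=> x Lx; have := L2_lin w0 kap 0 (E1 _ Lx) Lx.
    by under eq_fun do rewrite mul0r addr0.
  + move=> r x z Lx Lz; apply/funext => k; rewrite /dyadic_op E2//; ring.
  exists (`|kap| * C) => x Lx; rewrite -mulrA.
  apply: le_trans (_ : _ <= `|kap| * 1 * L2norm w (E (Num.max 0 (t - dyadic t n m.+1)) x)) _.
    apply: (L2norm_dom w0 (y := fun k => `|E (Num.max 0 (t - dyadic t n m.+1)) x k|)) => //.
    * by move=> k _; rewrite /dyadic_op normrM.
    * by rewrite expr1n mul1e /L2sqnorm; under eq_eseriesr do rewrite real_normK ?num_real//.
    * by case: (E1 _ Lx).
  by rewrite mulr1; apply: ler_wpM2l => //; exact: E3.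
- exact: cvg_HS_dyadic.
pose S := fine (\sum_(1 <= k <oo) (v k / w k)%:E)%E.
have SE : (\sum_(1 <= k <oo) (v k / w k)%:E = S%:E)%E.
  rewrite fineK// ge0_fin_numE// eseries_cond; apply: nneseries_ge0 => k _ k1.
  by rewrite lee_fin divr_ge0// ltW// ?v0// w0.
(* The square of the factor in [step_integral_le], times the 3 of [majorant_sqnorm]. *)
pose K := (`|kap| * expR (lam * t)) ^+ 2 * 3.
have K0 : 0 <= K by rewrite mulr_ge0// sqr_ge0.
apply: (@squeeze_cvge _ _ _ _ (cst 0%E) _
  (fun n => (K * (chain_cst q t * q ^+ n * S))%:E)).
- apply: nearW => n; apply/andP; split; first by apply: integral_ge0 => r _; exact: L2sqnorm_ge0.
  have mN := measurable_noise_energy v0 w0 BB q0 q1 n t0.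
  apply: le_trans (ae_le_integral_nomeas
     (g := fun om => (K%:E * noise_energy v w B q t n om)%E) _ _ _ _ _) _ => //.
  + exact: measurable_funeM.
  + by move=> om _; exact: L2sqnorm_ge0.
  + move=> om _; apply: mule_ge0; first by rewrite lee_fin.
    by apply: nneseries_ge0 => k _ _; exact: noise_term_ge0.
  + have G := ae_good_path v0 w0 vw_sum BB q0 q1 q4.
    have H := ae_noise_energy_fin v0 w0 vw_sum BB q0 q1 q4 t0.
    have GH : {ae P, forall om, good_path v w B q om /\ (noise_energy v w B q t 0 om < +oo)%E}.
      by apply: filterS2 G H => om.
    have ysY : {ae P, forall om, bsolves a c e lam t (fun s k => B k s om) (y om) /\
        (forall k, Y om k = kap * y om t k)} by apply: filterS2 ys Yy => om.
    apply: filterS2 GH ysY => om [g h] [b Yo] _.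
    have hn := le_lt_trans (noise_energy_le B v0 w0 q0 q1 t n om) h.
    have C0 : 0 <= `|kap| * expR (lam * t) by rewrite mulr_ge0// expR_ge0.
    apply: le_trans (L2sqnorm_le w0 C0 (y := majorant w (noise_bound v B q t n om)) _) _.
      by move=> k _; rewrite Yo; exact: step_integral_le.
    rewrite /K (EFinM (_ ^+ 2) 3) -muleA; apply: lee_wpmul2l; first by rewrite lee_fin sqr_ge0.
    rewrite -(noise_bound_sqnorm v0 w0 q0 q1 hn); apply: majorant_sqnorm => //.
    by rewrite (noise_bound_sqnorm v0 w0 q0 q1 hn).
  rewrite ge0_integralZl//; last first.
    by move=> om _; apply: nneseries_ge0 => k _ _; exact: noise_term_ge0.
  rewrite (EFinM K); apply: lee_wpmul2l; first by rewrite lee_fin.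
  by rewrite (EFinM _ S) -SE; exact: integral_noise_energy.
- exact: cvg_cst.
- apply: cvg_EFin; first by exact: nearW.
  rewrite (_ : _ \o _ = fun n => (K * chain_cst q t * S) * q ^+ n); last first.
    by apply/funext => n /=; ring.
  rewrite -[X in _ --> X](mulr0 (K * chain_cst q t * S)).
  by apply: cvgM; [exact: cvg_cst|apply: cvg_expr; rewrite ger0_norm// ltW].
Qed.

End integral.

Lemma ae_measurable_subset d (T : measurableType d) (R : realType) (mu : {measure set T -> \bar R})
    (G : T -> Prop) : {ae mu, forall x, G x} ->
  exists2 D : set T, measurable D & D `<=` G /\ {ae mu, forall x, D x}.
Proof.
move=> [N [mN N0 GN]]; exists (~` N); first exact: measurableC.
split; first by move=> x Nx; apply: contrapT => /GN.
by exists N; split => // x /= h; exact: contrapT.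
Qed.

Lemma exists_fourth_root_half (R : realType) : exists q : R, [/\ 0 < q, q < 1 & q ^+ 4 = 2^-1].
Proof.
have h0 : 0 < 2^-1 :> R by rewrite invr_gt0.
exists (Num.sqrt (Num.sqrt 2^-1)).
have q0 : 0 < Num.sqrt (Num.sqrt 2^-1) :> R by rewrite !sqrtr_gt0.
have q4 : Num.sqrt (Num.sqrt 2^-1) ^+ 4 = 2^-1 :> R.
  by rewrite (exprM _ 2 2) !sqr_sqrtr ?sqrtr_ge0 ?(ltW h0).
split => //; rewrite -(@ltr_pXn2r _ 4) ?nnegrE ?(ltW q0)// q4 expr1n invf_lt1// ltr1n//.
Qed.

(** * Regular versions of the data *)

Section modification.
Context (R : realType) (d : measure_display) (Omega : measurableType d).
Variables (P : probability Omega R) (v w : nat -> R).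
Variables (B : nat -> R -> Omega -> R) (Z0 : Omega -> nat -> R).
Hypotheses (v0 : forall k, (1 <= k)%N -> 0 < v k) (w0 : forall k, (1 <= k)%N -> 0 < w k).
Hypothesis vw_sum : (\sum_(1 <= k <oo) (v k / w k)%:E < +oo)%E.
Hypothesis B0 : forall (t : R) om, 0 <= t -> B 0%N t om = 0.
Hypothesis BB : forall k, (1 <= k)%N -> brownian P (v k) (B k).
Hypothesis mZ0 : forall k, measurable_fun setT (fun om => Z0 om k).
Hypothesis Z0_L2 : {ae P, forall om, L2 w (Z0 om)}.

(* Versions of the noise and of the initial value for which all paths are good: the originals
   are only measurable in om for fixed times, and regular almost surely. *)
Definition regular_data (Bp : Omega -> R -> nat -> R) (Zp : Omega -> nat -> R) : Prop :=
  [/\ (forall k, measurable_fun setT (fun p : Omega * R => Bp p.1 p.2 k)),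
      (forall om k, continuous (fun s => Bp om s k)),
      (forall om (tau : R), exists2 m, L2 w m &
        forall s k, 0 <= s <= tau -> `|Bp om s k| <= m k),
      (forall k, measurable_fun setT (fun om => Zp om k)) /\ (forall om, L2 w (Zp om)) &
      {ae P, forall om, (forall s k, 0 <= s -> Bp om s k = B k s om) /\ Zp om = Z0 om}].

(** The data are multiplied by the indicator of a measurable event of full probability on which all
    paths are good, and time is cut at 0. Continuity in time and measurability at fixed times give
    joint measurability. *)
Lemma exists_regular_data : exists Bp Zp, regular_data Bp Zp.
Proof.
have [q [q0 q1 q4]] := exists_fourth_root_half R.
have G := ae_good_path v0 w0 vw_sum BB q0 q1 q4.
have GL : {ae P, forall om, good_path v w B q om /\ L2 w (Z0 om)}.
  by apply: filterS2 G Z0_L2 => om.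
have [D mD [DG aD]] := ae_measurable_subset GL.
pose Bp om (s : R) k := if k is j.+1 then \1_D om * B k (Num.max 0 s) om else 0.
have BpD om s k : D om -> 0 <= s -> Bp om s k = B k s om.
  move=> Do s0; case: k => [|k]; first by rewrite B0.
  by rewrite /Bp indicE mem_set// mul1r max_r.
have BpN om s k : ~ D om -> Bp om s k = 0.
  by move=> Do; case: k => [//|k]; rewrite /Bp indicE memNset// mul0r.
have cB om k : continuous (fun s => Bp om s k).
  have [Do|Do] := pselect (D om); last first.
    rewrite (_ : (fun s => _) = cst 0); last by apply/funext => s; rewrite BpN.
    by move=> s; exact: cvg_cst.
  case: k => [|k]; first by move=> s; exact: cvg_cst.
  rewrite (_ : (fun s => _) = (fun s => B k.+1 (Num.max 0 s) om)); last first.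
    by apply/funext => s; rewrite /Bp indicE mem_set// mul1r.
  have [[reg _] _] := DG _ Do; have [_ cBk] := reg _ (ltn0Sn k).
  exact: (@continuous_max0 _ (fun s => B k.+1 s om) cBk).
exists Bp, (fun om k => \1_D om * Z0 om k); split => //.
- move=> k; apply: (measurable_caratheodory (f := fun om s => Bp om s k)) => // s.
  case: k => [|k]; first exact: measurable_cst.
  apply: measurable_funM; first exact: measurable_indic.
  by have [mB _ _ _ _] := BB (ltn0Sn k); apply: mB; rewrite le_max lexx.
- move=> om tau; have [Do|Do] := pselect (D om).
    have [m Lm mB] := good_path_bound v0 w0 B0 q0 q1 tau (proj1 (DG _ Do)).
    by exists m => // s k /andP[s0 st]; rewrite BpD// mB.
  exists (fun=> 0); last by move=> s k _; rewrite BpN// normr0.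
  split => //; rewrite L2sqnormE eseries0// => k _ _.
  by case: k => //= k; rewrite expr0n mul0r.
- split=> [k|om]; first by apply: measurable_funM => //; exact: measurable_indic.
  have [Do|Do] := pselect (D om).
    by rewrite indicE mem_set//; under eq_fun do rewrite mul1r; case: (DG _ Do).
  rewrite indicE memNset//; split; first by rewrite mul0r.
  rewrite L2sqnormE eseries0// => k _ _.
  by case: k => //= k; rewrite mul0r expr0n mul0r.
apply: filterS aD => om Do; split; first by move=> s k s0; exact: BpD.
by apply/funext => k; rewrite indicE mem_set// mul1r.
Qed.

End modification.

(** * Existence for the SDE and variation of constants *)

Section linear_sde.
Context (R : realType) (d : measure_display) (Omega : measurableType d).
Variables (P : probability Omega R) (v w : nat -> R).
Variables (B : nat -> R -> Omega -> R) (Z0 : Omega -> nat -> R).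
Variables (a c e : nat -> R) (lam : R).
Notation A := (tri a c e).
Hypotheses (v0 : forall k, (1 <= k)%N -> 0 < v k) (w0 : forall k, (1 <= k)%N -> 0 < w k).
Hypothesis vw_sum : (\sum_(1 <= k <oo) (v k / w k)%:E < +oo)%E.
Hypothesis B0 : forall (t : R) om, 0 <= t -> B 0%N t om = 0.
Hypothesis BB : forall k, (1 <= k)%N -> brownian P (v k) (B k).
Hypothesis lam0 : 0 <= lam.
Hypothesis slow_tame : forall N, slow N -> tame a c e lam (sqrt_weight w N).
Variables (Bp : Omega -> R -> nat -> R) (Zp : Omega -> nat -> R).
Hypothesis BZ : regular_data P w B Z0 Bp Zp.

(** A forcing dominated in L2(w) on bounded intervals bounds the norm of the solution by a constant
    there, which yields Bochner integrability of A z. *)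
Lemma bsolves_L2_path F z :
  (forall tau : R, exists2 m, L2 w m & forall s k, 0 <= s <= tau -> `|F s k| <= m k) ->
  (forall T, bsolves a c e lam T F z) -> L2_path w a c e F z.
Proof.
move=> FB bz t t0; have [m Lm mF] := FB t; have tm := majorant_tame w0 slow_tame Lm.
have [sz _] := bz t.
have C0 : 0 <= expR (lam * t) := expR_ge0 _.
have zm s k : 0 <= s <= t -> `|z s k| <= expR (lam * t) * majorant w m k.
  move=> /andP[s0 st]; have Fm r j : 0 <= r <= s -> `|F r j| <= majorant w m j.
    move=> /andP[r0 rs]; apply: le_trans (le_trans (ler_norm _) (majorant_ge w0 j Lm)).
    by apply: mF; rewrite r0 (le_trans rs).
  have := bsolves_le lam0 (bz s) tm Fm k (t := s); rewrite s0 lexx => /(_ isT) h.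
  apply: (le_trans h); have [mj _] := tm; rewrite ler_wpM2r// ler_expR.
  by rewrite ler_wpM2l.
have Lz s : 0 <= s <= t -> L2 w (z s).
  move=> hs; apply: (majorant_L2 w0 C0 Lm) => [|k]; last exact: zm.
  by apply/eqP; rewrite -normr_le0; have := zm s 0%N hs; rewrite mulr0.
have [AL _ [C AC]] := tri_bounded lam0 w0 slow_tame.
have tt : 0 <= t <= t by rewrite t0 lexx.
split; first exact: Lz.
  split.
  - by move=> s; rewrite /= in_itv/= => hs; apply/AL/Lz.
  - by move=> k; have [] := sz k.
  apply: (@le_lt_trans _ _ (\int[lebesgue_measure]_(s in `[0%R, t])
      (cst (`|C| * (expR (lam * t) * Num.sqrt 3 * L2norm w m))%:E s))%E).
    apply: le_integral_nomeas => s.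
      by move=> _; rewrite lee_fin sqrtr_ge0.
    rewrite /= in_itv/= => hs; rewrite lee_fin.
    apply: le_trans (AC _ (Lz s hs)) _.
    apply: (@le_trans _ _ (`|C| * L2norm w (z s))).
      by rewrite ler_wpM2r ?sqrtr_ge0// ler_norm.
    by rewrite ler_wpM2l//; apply: (majorant_norm w0 C0 Lm) => k; exact: zm.
  have i : lebesgue_measure.-integrable `[0, t]
      (EFin \o cst (`|C| * (expR (lam * t) * Num.sqrt 3 * L2norm w m))).
    by apply: (integrable_le_cst (M := `| (`|C| * (expR (lam * t) * Num.sqrt 3 * L2norm w m))|)).
  by apply: integrable_lty i.
by move=> k; have [_ ->] := sz k.
Qed.

Let F om s k := Zp om k + Bp om s k.

Lemma L2_abs x : L2 w x -> L2 w (fun k => `|x k|).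
Proof.
move=> [x0 xoo]; split; first by rewrite x0 normr0.
by rewrite /L2sqnorm; under eq_eseriesr do rewrite real_normK ?num_real//.
Qed.

Lemma data_bound om (tau : R) : exists2 m, L2 w m &
  forall s k, 0 <= s <= tau -> `|F om s k| <= m k.
Proof.
have [_ _ Bb [_ LZ] _] := BZ; have [m Lm mB] := Bb om tau.
exists (fun k => `|Zp om k| + m k); first by apply: L2_add => //; exact: L2_abs.
by move=> s k hs; rewrite (le_trans (ler_normD _ _))// lerD2l mB.
Qed.

Lemma data_measurable k : measurable_fun setT (fun p : Omega * R => F p.1 p.2 k).
Proof.
have [mB _ _ [mZ _] _] := BZ; apply: measurable_funD; last exact: mB.
exact: (measurableT_comp (mZ k) (@measurable_fst _ _ Omega _)).
Qed.

Lemma tame_bound (G : Omega -> R -> nat -> R) :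
  (forall om (tau : R), exists2 m, L2 w m & forall s k, 0 <= s <= tau -> `|G om s k| <= m k) ->
  forall om (tau : R), exists2 m, tame a c e lam m &
    forall s k, 0 <= s <= tau -> `|G om s k| <= m k.
Proof.
move=> H om tau; have [m Lm mG] := H om tau.
exists (majorant w m); first exact: majorant_tame.
move=> s k hs; apply: le_trans (le_trans (ler_norm _) (majorant_ge w0 k Lm)).
exact: mG.
Qed.

Lemma sde_exists : sde_solution P w A B Z0 (fun t om => picard a c e F om t).
Proof.
have FB := tame_bound data_bound; split.
  move=> t k _.
  exact: (measurableT_comp (picard_measurable lam0 data_measurable FB k) (pair2_measurable t)).
have [_ _ _ _] := BZ; apply: filterS => om [BE ZE] t t0.
have := @bsolves_L2_path (F om) (picard a c e F om) (data_bound om)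
  (fun T => picard_bsolves lam0 om T data_measurable FB).
move=> /(_ t t0)[h1 h2 h3]; split => // k.
by rewrite h3 /F -BE// ZE; ring.
Qed.

(** The stochastic convolution is the solution driven by the noise alone, started from 0. Adding the
    semigroup applied to the initial value gives a solution for the full data, and pathwise
    uniqueness identifies it with Z. *)
Lemma sde_convolution (Z : R -> Omega -> nat -> R) t : 0 <= t ->
  sde_solution P w A B Z0 Z ->
  exists Y, stochastic_integral P w v B t (fun s => op_exp (fun y k => (t - s) * A y k)) Y /\
    {ae P, forall om, Z t om = (fun k => op_exp (fun y k => t * A y k) (Z0 om) k + Y om k)}.
Proof.
move=> t0 [_ sZ]; have [mB cB Bb [_ LZ] aeB] := BZ.
have BbT := tame_bound Bb.
have bB om T := picard_bsolves lam0 om T mB BbT.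
have pB om := bsolves_L2_path (Bb om) (bB om).
exists (fun om => picard a c e Bp om t); split.
  have [q [q0 q1 q4]] := exists_fourth_root_half R.
  rewrite (_ : (fun s => _) = (fun s x k => 1 * op_exp (fun y k => (t - s) * A y k) x k)).
    apply: (@stochastic_integral_dyadic _ _ _ _ _ _ _ a c e lam 1 t
      (fun tau => op_exp (fun y k => tau * A y k)) v0 w0 vw_sum B0 BB lam0 t0 _ _ _ q q0 q1 q4
      (picard a c e Bp)).
    - by move=> x Lx; exact: majorant_tame.
    - by move=> x Lx; exact: (exp_bsolves lam0 w0 slow_tame t Lx).
    - by move=> tau tau0; exact: (exp_bounded lam0 w0 slow_tame tau0).
    - move=> k.
      exact: (measurableT_comp (picard_measurable lam0 mB BbT k) (pair2_measurable t)).
    - by apply: filterE => om; have [] := pB om t t0.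
    - apply: filterS aeB => om [BE _]; have [sb bb] := bB om t; split => // k.
      have [ms es] := sb k; split => // s hs; rewrite es// BE//.
      by case/andP: hs.
    - by apply: filterE => om k; rewrite mul1r.
  by apply/funext => s; apply/funext => x; apply/funext => k; rewrite mul1r.
apply: filterS2 aeB sZ => om [BE ZE] sZ.
have := @L2_path_unique R w a c e lam lam0 w0 slow_tame (F om) (Z ^~ om)
  (fun s k => op_exp (fun y k => s * A y k) (Zp om) k + picard a c e Bp om s k).
move=> /(_ _ _ t t0); rewrite -ZE; apply.
  move=> s s0; have [h1 h2 h3] := sZ s s0; split => // k.
  by rewrite h3 /F BE// ZE; ring.
apply: (bsolves_L2_path (data_bound om)) => T.
have := bsolves_lin 1 1 (exp_bsolves lam0 w0 slow_tame T (LZ om)) (bB om T).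
by under eq_fun do under eq_fun do rewrite !mul1r;
  under [X in bsolves _ _ _ _ _ _ X]eq_fun do under eq_fun do rewrite !mul1r.
Qed.

End linear_sde.

(** With a zero driving path the Ornstein-Uhlenbeck solution is e^(-xt) z, so the spectral form of
    the semigroup is a special case of the one for the SDE. *)
Lemma ou_cst0 (R : realType) (z t x : R) : ou (cst 0) z t x = expR (- (x * t)) * z.
Proof.
rewrite /ou /exp_pairing /= mulr0 sub0r.
rewrite (eq_Rintegral lebesgue_measure (g := cst 0)); last by move=> s _; rewrite mulr0.
by rewrite Rintegral_cst// mul0r mulr0 oppr0 addr0.
Qed.

(** * The diagonal generator -x *)

Section diagonal.
Variables (R : realType) (x : R).
Notation D := (tri (fun=> 0) (fun=> - x) (fun=> 0)).
Notation tameD := (tame (fun=> 0) (fun=> - x) (fun=> 0) `|x|).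

Lemma diag_tame m : (forall k, 0 <= m k) -> tameD m.
Proof.
move=> m0; split => // -[|k] /=; first by rewrite mulr_ge0.
by rewrite !normr0 !mul0r add0r addr0 normrN.
Qed.

Lemma diag_bsolves (T : R) (F z : R -> nat -> R) (m : nat -> R) :
  (forall k, measurable_fun `[0, T] (fun s => z s k)) ->
  (forall t, 0 <= t <= T -> z t 0%N = F t 0%N) ->
  (forall t k, 0 <= t <= T -> z t k = F t k - x * \int[lebesgue_measure]_(s in `[0, t]) z s k) ->
  (forall t k, 0 <= t <= T -> `|z t k| <= m k) ->
  bsolves (fun=> 0) (fun=> - x) (fun=> 0) `|x| T F z.
Proof.
move=> mz z0 zE zm; split; last first.
  exists 1, (fun k => `|m k|); split => //; first exact: diag_tame.
  by move=> t k ht; rewrite mul1r (le_trans (zm t k ht))// ler_norm.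
have DE s k : D (z s) k.+1 = - x * z s k.+1 by rewrite /= !mul0r add0r addr0.
move=> [|k]; split.
- exact: measurable_cst.
- by move=> t ht; rewrite Rintegral_cst//= mul0r addr0 z0.
- rewrite (_ : (fun s => _) = (fun s => - x * z s k.+1)); last exact/funext.
  exact: measurable_funM.
move=> t ht; rewrite zE//; congr (_ + _).
rewrite -mulNr -RintegralZl//; first by apply: eq_Rintegral => s _; rewrite DE.
apply: (integrable_le_cst (M := m k.+1)); last first.
  by move=> s /andP[s0 st]; apply: zm; case/andP: ht => _ tT; rewrite s0 (le_trans st).
apply: measurable_funS (mz k.+1) => //; apply: subset_itvl; rewrite bnd_simp.
by case/andP: ht.
Qed.
End diagonal.

(** * Stochastic integrals of e^(xs) *)

Section scalar_integral.
Context (R : realType) (d : measure_display) (Omega : measurableType d).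
Variables (P : probability Omega R) (v w : nat -> R).
Variables (B : nat -> R -> Omega -> R) (Z0 : Omega -> nat -> R).
Hypotheses (v0 : forall k, (1 <= k)%N -> 0 < v k) (w0 : forall k, (1 <= k)%N -> 0 < w k).
Hypothesis vw_sum : (\sum_(1 <= k <oo) (v k / w k)%:E < +oo)%E.
Hypothesis B0 : forall (t : R) om, 0 <= t -> B 0%N t om = 0.
Hypothesis BB : forall k, (1 <= k)%N -> brownian P (v k) (B k).
Variables (Bp : Omega -> R -> nat -> R) (Zp : Omega -> nat -> R).
Hypothesis BZ : regular_data P w B Z0 Bp Zp.

Lemma measurable_exp_pairing t j :
  measurable_fun [set: (measurableTypeR R * Omega)%type]
    (fun p => exp_pairing (fun s => Bp p.2 s j) p.1 t).
Proof.
have [mB _ _ _ _] := BZ.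
have mg : measurable_fun setT
    (fun p : (measurableTypeR R * Omega) * R => expR (p.1.1 * p.2) * Bp p.1.2 p.2 j).
  apply: measurable_funM.
    apply: measurableT_comp => //; apply: measurable_funM => //.
    exact: (measurableT_comp measurable_fst measurable_fst).
  have ms : measurable_fun setT (fun p : (measurableTypeR R * Omega) * R => (p.1.2, p.2)).
    apply: measurable_fun_pair => //.
    exact: (measurableT_comp measurable_snd measurable_fst).
  exact: (measurableT_comp (mB j) ms).
have mI := measurable_Rintegral_itv mg.
apply: measurable_funB.
  apply: measurable_funM; last first.
    have ms : measurable_fun setT (fun p : measurableTypeR R * Omega => (p.2, t)).
      exact: measurable_fun_pair.
    exact: (measurableT_comp (mB j) ms).
  by apply: measurableT_comp => //; exact: measurable_funM.
apply: measurable_funM => //.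
exact: (measurable_fun_pair1 t mI).
Qed.

(* e^(xs) = e^(xt) e^(-x(t-s)), where e^(-xt) is the semigroup of a diagonal generator. *)
Lemma scalar_stochastic_integral (x t : R) : 0 <= x -> 0 <= t ->
  stochastic_integral P w v B t (fun s y k => expR (x * s) * y k)
    (fun om j => exp_pairing (fun s => Bp om s j) x t).
Proof.
move=> x0 t0; have [mB cB Bb _ aeB] := BZ.
have [q [q0 q1 q4]] := exists_fourth_root_half R.
have ouE om k : exp_pairing (fun s => Bp om s k) x t =
    expR (x * t) * ou (fun s => Bp om s k) 0 t x.
  by rewrite /ou add0r mulrA -expRD subrr expR0 mul1r.
have Bp0 om s : 0 <= s -> Bp om s 0%N = 0.
  move=> s0; have [m [m0 _] mBp] := Bb om s; apply/eqP; rewrite -normr_le0 -m0.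
  by apply: mBp; rewrite s0 lexx.
have oub om m : (forall s k, 0 <= s <= t -> `|Bp om s k| <= m k) -> forall s k, 0 <= s <= t ->
    `|ou (fun s => Bp om s k) 0 s x| <= 2 * m k.
  move=> mBp s k hs; have := ou_le 0 (cB om k) (T := t) (m := m k) _ hs x0.
  by rewrite normr0 add0r; apply=> r hr; exact: mBp.
have PE : (fun (s : R) (y : nat -> R) k => expR (x * s) * y k) =
    (fun s y k => expR (x * t) * (expR (- (x * (t - s))) * y k)).
  apply/funext => s; apply/funext => y; apply/funext => k.
  by rewrite mulrA -expRD; congr (expR _ * _); ring.
rewrite PE.
apply: (@stochastic_integral_dyadic _ _ _ _ _ _ _ (fun=> 0) (fun=> - x) (fun=> 0) `|x|
  (expR (x * t)) t (fun tau y k => expR (- (x * tau)) * y k)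
  v0 w0 vw_sum B0 BB (normr_ge0 x) t0 _ _ _ q q0 q1 q4
  (fun om s k => ou (fun r => Bp om r k) 0 s x)).
- move=> y Ly; apply: diag_tame => k.
  by apply: le_trans (majorant_ge w0 k Ly).
- move=> y Ly; have c0 : continuous (cst (0 : R) : R -> R) by move=> ?; exact: cvg_cst.
  apply: (diag_bsolves (m := fun k => `|y k|)) => //.
  + move=> k; apply: measurable_funM => //; apply: measurableT_comp => //.
    apply: measurable_funN; exact: measurable_funM.
  + by move=> s _; case: Ly => -> _; rewrite mulr0.
  + move=> s k /andP[s0 _]; rewrite -!ou_cst0 (ou_integral (y k) c0)//= addr0; congr (_ - _ * _).
    by apply: eq_Rintegral => r _; rewrite ou_cst0.
  + move=> s k /andP[s0 _]; rewrite normrM ger0_norm ?expR_ge0// ler_piMl//.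
    by rewrite -expR0 ler_expR oppr_le0 mulr_ge0.
- move=> tau tau0; split.
  + move=> y Ly; have := L2_lin w0 (expR (- (x * tau))) 0 Ly Ly.
    by under eq_fun do rewrite mul0r addr0.
  + by move=> r y z _ _; apply/funext => k; ring.
  exists 1 => y Ly; rewrite mul1r.
  have e1 : expR (- (x * tau)) <= 1.
    by rewrite -expR0 ler_expR oppr_le0 mulr_ge0.
  apply: (L2norm_le w0); first exact: sqrtr_ge0.
  rewrite -(L2sqnorm_fin w0) ?(proj2 Ly)//.
  rewrite !L2sqnormE; apply: lee_nneseries => [k _ _|[|k] _ //=].
    by rewrite lee_fin (L2term_ge0 w0).
  rewrite lee_fin ler_pM2r ?invr_gt0 ?w0// exprMn ler_piMl ?sqr_ge0//.
  by rewrite expr_le1 ?expR_ge0.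
- by move=> k; exact: (measurable_fun_pair2 x (measurable_exp_pairing t k)).
- apply: filterE => om; have [m Lm mBp] := Bb om t.
  apply: (L2_dom w0 (y := m) (C := expR (x * t) * 2)).
  + by rewrite mulr_ge0 ?expR_ge0.
  + rewrite ouE; apply/eqP; rewrite mulf_eq0 gt_eqF ?expR_gt0//= -normr_le0.
    have := oub om m mBp t 0%N; rewrite (proj1 Lm) mulr0; apply.
    by rewrite t0 lexx.
  + move=> k _; rewrite ouE normrM ger0_norm ?expR_ge0// -mulrA ler_wpM2l ?expR_ge0//.
    by apply: oub => //; rewrite t0 lexx.
  + by case: Lm.
- apply: filterS aeB => om [BE _]; have [m Lm mBp] := Bb om t.
  apply: (diag_bsolves (m := fun k => 2 * m k)).
  + move=> k.
    apply: measurable_funTS; exact: (measurable_fun_pair1 x (@ou_measurable _ _ 0 (cB om k))).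
  + move=> s hs; have /andP[s0 st] := hs; rewrite -BE// Bp0//; apply/eqP.
    by rewrite -normr_le0; have := oub om m mBp s 0%N hs; rewrite (proj1 Lm) mulr0.
  + by move=> s k /andP[s0 st]; rewrite -BE// (ou_integral 0 (cB om k))// add0r.
  + exact: oub.
- by apply: filterE => om k; exact: ouE.
Qed.

End scalar_integral.

(** * The birth and death operator *)

Section conclusions.
Context (R : realType) (d : measure_display) (Omega : measurableType d).
Variables (alpha beta : R) (L : nat) (psi : probability (measurableTypeR R) R).
Variables (P : probability Omega R).
Variables (B : nat -> R -> Omega -> R) (Z0 : Omega -> nat -> R) (w : nat -> R).
Hypotheses (alpha_gt0 : 0 < alpha) (beta_gt0 : 0 < beta).
Hypotheses (rho_lt1 : rho alpha beta < 1) (L_ge1 : (1 <= L)%N).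
Hypothesis psi_spectral : orthogonality_measure alpha beta L psi.
Hypothesis w_growth : weight_growth alpha beta L w.
Hypothesis pi_growth : weight_growth alpha beta L (pi_seq alpha beta L).
Notation b := (brate alpha beta L).
Notation dg := (diag_rate alpha beta L).
Notation pis := (pi_seq alpha beta L).
Notation v := (v_tilde alpha beta L).

Lemma expKE t : expK alpha beta L t = op_exp (fun y k => t * tri b dg (fun=> beta) y k).
Proof. by rewrite /expK KopE. Qed.

Lemma conclusion_a_holds : conclusion_a alpha beta L psi P B Z0 w.
Proof.
have [lam lam0 slow_tame] := growth_tame alpha_gt0 beta_gt0 rho_lt1 w_growth.
have [lamp _ tame_pi] := growth_tame alpha_gt0 beta_gt0 rho_lt1 pi_growth.
have [w0 _] := w_growth.
rewrite /conclusion_a; split.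
- by rewrite KopE; exact: (tri_bounded lam0 w0 slow_tame).
- by move=> t t0; rewrite KopE; exact: (exp_norm_cvg lam0 w0 slow_tame t0).
- move=> z0 Lz0; rewrite !expKE; split.
  + rewrite KopE (_ : (fun t => expK alpha beta L t z0) =
      (fun t => op_exp (fun y k => t * tri b dg (fun=> beta) y k) z0)); last first.
      by apply/funext => t; rewrite expKE.
    exact: (exp_ode lam0 w0 slow_tame Lz0).
  + exact: (exp0 lam0 w0 slow_tame Lz0).
  move=> z; rewrite KopE => zo <- t t0; rewrite expKE.
  exact: (ode_unique lam0 w0 slow_tame zo).
- move=> t t0.
  have c0 : continuous (cst (0 : R) : R -> R) by move=> ?; exact: cvg_cst.
  have tt : 0 <= t <= t by rewrite t0 lexx.
  have pE i j y (x : R) : pstar_fun alpha beta L t i j x * y =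
      (Qpoly alpha beta L i).[x] * (Qpoly alpha beta L j).[x] * ou (cst 0) y t x.
    by rewrite ou_cst0 /pstar_fun; ring.
  have mO y : measurable_fun setT (fun p : R * R => ou (cst 0) y p.1 p.2).
    exact: (@ou_measurable _ _ y c0).
  have OC y (s x : R) : 0 <= s <= t -> 0 <= x -> `|ou (cst 0) y s x| <= `|y|.
    move=> hs x0; have := ou_le y c0 (T := t) (m := 0) (t := s) (x := x) _ hs x0.
    by rewrite mulr0 addr0; apply=> r _ /=; rewrite normr0.
  have mQ i j : measurable_fun setT
      (fun x : R => (Qpoly alpha beta L i).[x] * (Qpoly alpha beta L j).[x]).
    by apply: measurable_funM; exact: Qeval_measurable.
  have ip i j : psi.-integrable `[0, +oo[ (EFin \o pstar_fun alpha beta L t i j).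
    have := mul_O_integrable (mO 1) (OC 1) tt (mQ i j) (QQ_integrable psi_spectral i j).
    rewrite (_ : (fun x => _) = pstar_fun alpha beta L t i j)//.
    by apply/funext => x; rewrite -pE mulr1.
  split=> [i j _ _|x i Lx i1]; first exact: ip.
  rewrite expKE.
  have H := @spectral_series _ _ _ _ _ alpha_gt0 beta_gt0 L_ge1 psi_spectral _ _ _ lam0 w0
    slow_tame (sqrt_weight_tame tame_pi) t (fun=> x) (fun s => op_exp (fun y k => s * tri b dg (fun=> beta) y k) x)
    (fun k => `|x k|) (fun k => `|x k|) (fun j => ou (cst 0) (x j)) i t0 (L2_abs Lx)
    (exp_bsolves lam0 w0 slow_tame t Lx).
  rewrite (_ : (fun n => _) = fun n => \sum_(1 <= j < n)
      spectral_entry alpha beta L psi j (ou (cst 0) (x j)) t i).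
    apply: H => //.
    + by move=> j; exact: OC.
    + by move=> j s y /andP[s0 _] y0; rewrite (ou_integral (x j) c0) //= addr0.
  apply/funext => n; apply: eq_bigr => j _.
  rewrite /spectral_entry /pstar -mulrA -RintegralZr//.
  by congr (_ * _); apply: eq_Rintegral => y _; rewrite pE.
by rewrite KopE; exact: (sde_unique lam0 w0 slow_tame).
Qed.

Hypothesis noise : driving_noise P v B Z0.
Hypothesis v0 : forall k, (1 <= k)%N -> 0 < v k.
Hypothesis vw_sum : (\sum_(1 <= k <oo) (v k / w k)%:E < +oo)%E.

(** The version J is [exp_pairing]. The factor e^(-xt) times the initial value plus J is an
    Ornstein-Uhlenbeck path, so the matrix formula is [spectral_series], the integral over the
    half-line being equal to that over the support. *)
Lemma spectral_formula_holds (Bp : Omega -> R -> nat -> R) (Zp : Omega -> nat -> R)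
    (Z : Omega -> nat -> R) (lam t : R) (z : Omega -> R -> nat -> R) :
  0 <= lam -> (forall N, slow N -> tame b dg (fun=> beta) lam (sqrt_weight w N)) ->
  0 <= t -> regular_data P w B Z0 Bp Zp ->
  (forall om, bsolves b dg (fun=> beta) lam t (fun s k => Zp om k + Bp om s k) (z om)) ->
  {ae P, forall om, Z om = z om t} ->
  spectral_formula alpha beta L psi P B Z0 w t Z.
Proof.
move=> lam0 slow_tame t0 BZ bz Zz; have [mB cB Bb [_ LZ] aeB] := BZ.
have [lamp _ tame_pi] := growth_tame alpha_gt0 beta_gt0 rho_lt1 pi_growth.
have [w0 _] := w_growth; have [psi1 _ _] := psi_spectral.
have [B0 BB _ _ _] := noise.
have tt : 0 <= t <= t by rewrite t0 lexx.
exists (fun x om j => exp_pairing (fun s => Bp om s j) x t); split.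
- exact: (measurable_exp_pairing BZ).
- move=> x /(support_sub psi1); rewrite /= in_itv/= andbT => x0.
  exact: (scalar_stochastic_integral v0 w0 vw_sum B0 BB BZ x0 t0).
apply: filterS2 aeB Zz => om [_ <-] -> i i1.
have [m Lm mBp] := Bb om t.
pose O j (s x : R) := ou (fun r => Bp om r j) (Zp om j) s x.
have pE j (x : R) : pstar_fun alpha beta L t i j x * (Zp om j + exp_pairing (fun s => Bp om s j) x t) =
    (Qpoly alpha beta L i).[x] * (Qpoly alpha beta L j).[x] * O j t x.
  by rewrite /O /ou /pstar_fun; ring.
have mO j : measurable_fun setT (fun p : R * R => O j p.1 p.2).
  exact: (@ou_measurable _ _ (Zp om j) (cB om j)).
have m0 k : 0 <= m k.
  by apply: le_trans (mBp 0 k _) => //; rewrite lexx t0.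
have OC j (s x : R) : 0 <= s <= t -> 0 <= x -> `|O j s x| <= `|Zp om j| + 2 * m j.
  by move=> hs x0; apply: (ou_le _ (cB om j) (T := t)) => // r hr; exact: mBp.
have mQ j : measurable_fun setT
    (fun x : R => (Qpoly alpha beta L i).[x] * (Qpoly alpha beta L j).[x]).
  by apply: measurable_funM; exact: Qeval_measurable.
have iO j := mul_O_integrable (mO j) (OC j) tt (mQ j) (QQ_integrable psi_spectral i j).
have fE j : (fun x => pstar_fun alpha beta L t i j x *
    (Zp om j + exp_pairing (fun s => Bp om s j) x t)) =
    (fun x => (Qpoly alpha beta L i).[x] * (Qpoly alpha beta L j).[x] * O j t x).
  by apply/funext => x; exact: pE.
split=> [j j1|].
  by rewrite fE; have [] := Rintegral_support psi1 (iO j).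
have Lmz := L2_add w0 (L2_abs (LZ om)) Lm.
have H := @spectral_series _ _ _ _ _ alpha_gt0 beta_gt0 L_ge1 psi_spectral _ _ _ lam0 w0
  slow_tame (sqrt_weight_tame tame_pi) t (fun s k => Zp om k + Bp om s k) (z om) _
  (fun j => `|Zp om j| + 2 * m j) O i t0 Lmz (bz om).
rewrite (_ : (fun n => _) = fun n => \sum_(1 <= j < n) spectral_entry alpha beta L psi j (O j) t i).
  apply: H => //.
  + by move=> s k hs; rewrite (le_trans (ler_normD _ _))// lerD2l mBp.
  + by move=> j; rewrite addr_ge0// mulr_ge0.
  + by move=> j s x /andP[s0 _] x0; rewrite /O (ou_integral _ (cB om j)).
apply/funext => n; apply: eq_bigr => j _; rewrite /spectral_entry fE.
by have [_ ->] := Rintegral_support psi1 (iO j).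
Qed.

Lemma conclusion_b_holds : conclusion_b alpha beta L psi P B Z0 w.
Proof.
move=> LZ0.
have [lam lam0 slow_tame] := growth_tame alpha_gt0 beta_gt0 rho_lt1 w_growth.
have [w0 _] := w_growth; have [B0 BB _ mZ0 _] := noise.
have [Bp [Zp BZ]] := exists_regular_data v0 w0 vw_sum B0 BB mZ0 LZ0.
have ex := sde_exists w0 lam0 slow_tame BZ.
have un := @sde_unique _ _ _ _ _ _ lam0 w0 slow_tame _ _ P B Z0.
rewrite KopE; split => //; first by eexists; exact: ex.
move=> Z sZ t t0; split.
  have [Y [sY ZY]] := sde_convolution v0 w0 vw_sum B0 BB lam0 slow_tame BZ t0 sZ.
  exists Y; split; last by rewrite expKE.
  rewrite (_ : (fun s => expK _ _ _ _) =
    (fun s => op_exp (fun y k => (t - s) * tri b dg (fun=> beta) y k)))//.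
  by apply/funext => s; rewrite expKE.
have FB := tame_bound w0 slow_tame (data_bound w0 BZ).
apply: (spectral_formula_holds lam0 slow_tame t0 BZ).
  by move=> om; exact: (picard_bsolves lam0 om t (data_measurable BZ) FB).
by apply: filterS (un _ _ sZ ex) => om /(_ t t0).
Qed.

End conclusions.

Lemma eseries_dominated (R : realType) (f g : nat -> R) (C : R) : 0 <= C ->
  (forall k, (1 <= k)%N -> 0 <= f k <= C * g k) -> (forall k, (1 <= k)%N -> 0 <= g k) ->
  (\sum_(1 <= k <oo) (g k)%:E < +oo)%E -> (\sum_(1 <= k <oo) (f k)%:E < +oo)%E.
Proof.
move=> C0 fg g0; rewrite eseries_cond [X in _ -> (X < _)%E]eseries_cond => goo.
apply: (@le_lt_trans _ _ (C%:E * \sum_(k <oo | (1 <= k)%N) (g k)%:E)%E); last first.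
  by rewrite lte_mul_pinfty.
rewrite -nneseriesZl; last by move=> k k1; rewrite lee_fin g0.
apply: lee_nneseries => [k _ k1|k k1]; first by rewrite lee_fin; case/andP: (fg _ k1).
by rewrite -EFinM lee_fin; case/andP: (fg _ k1).
Qed.

Lemma geometric_summable (R : realType) (f : nat -> R) (C q : R) : 0 <= C -> 0 <= q -> q < 1 ->
  (forall k, (1 <= k)%N -> 0 <= f k <= C * q ^+ k) ->
  (\sum_(1 <= k <oo) (f k)%:E < +oo)%E.
Proof.
move=> C0 q0 q1 fq; have q1' : 0 < 1 - q by rewrite subr_gt0.
apply: (@le_lt_trans _ _ (C / (1 - q))%:E); last exact: ltry.
apply: lime_le; first by apply: is_cvg_nneseries => k k1 _; rewrite lee_fin; case/andP: (fq _ k1).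
apply: nearW => n; rewrite sumEFin lee_fin.
have H : \sum_(0 <= k < n) q ^+ k <= (1 - q)^-1.
  rewrite -(ler_pM2l q1') mulfV ?gt_eqF//.
  have -> : (1 - q) * \sum_(0 <= k < n) q ^+ k = 1 - q ^+ n.
    elim: n => [|n IH]; first by rewrite big_nil mulr0 expr0 subrr.
    by rewrite big_nat_recr//= mulrDr IH exprS; ring.
  by rewrite gerBl exprn_ge0.
apply: le_trans (ler_wpM2l C0 H).
case: n {H} => [|n]; first by rewrite big_geq// big_geq// mulr0.
rewrite [in leRHS]big_nat_recl// mulrDr mulr_sumr big_add1 /=.
rewrite big_nat [in leRHS]big_nat; apply: ler_wpDl; first by rewrite mulr_ge0// expr0.
by apply: ler_sum => k _; case/andP: (fq k.+1 (ltn0Sn k)).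
Qed.

(** * The weights pi and theta^k *)

Section weights.
Variables (R : realType) (alpha beta : R) (L : nat).
Hypotheses (alpha_gt0 : 0 < alpha) (beta_gt0 : 0 < beta).
Hypotheses (rho_lt1 : rho alpha beta < 1) (L_ge1 : (1 <= L)%N).
Notation r := (rho alpha beta).
Notation u := (u_tilde alpha beta L).
Notation pis := (pi_seq alpha beta L).
Notation v := (v_tilde alpha beta L).

Let r0 : 0 < r := rho_gt0 alpha_gt0 beta_gt0.

Let Lk_gt0 k : (0 < L ^ k)%N. Proof. by rewrite expn_gt0 L_ge1. Qed.

Let inv_rX_ge1 n : 1 <= r ^- n.
Proof. by rewrite -[leLHS]invr1 lef_pV2 ?posrE ?exprn_gt0// exprn_ile1// ltW. Qed.

Lemma pi_growth : weight_growth alpha beta L pis.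
Proof.
have p0 k := pi_seq_gt0 alpha_gt0 beta_gt0 L_ge1 k.
have L0 : 0 < L%:R :> R by rewrite ltr0n.
split=> [k _|]; first exact: p0.
(* The ratio of pi k to pi k.+1 equals rho^(-L^k) / L, which lies between 1/L and rho^(-2 L^k). *)
exists L%:R^-1, 1; split=> [||k k1]; rewrite ?invr_gt0//.
have E : pis k.+1 = L%:R * r ^+ (L ^ k) * pis k.
  apply: (mulfI (lt0r_neq0 beta_gt0)); rewrite (pi_seqS alpha beta L k1) /brate; ring.
rewrite E mul1r; apply/andP; split.
  rewrite -mulrA mulrA mulVf ?gt_eqF// mul1r ler_piMl ?(ltW (p0 _))//.
  by rewrite exprn_ile1// ltW.
rewrite mulrA ler_peMl ?(ltW (p0 _))// mulrCA.
have L1 : 1 <= L%:R :> R by rewrite ler1n.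
apply: mulr_ege1 => //; rewrite mulnC exprM expr2 invfM -mulrA mulVf ?mulr1//.
by rewrite gt_eqF// exprn_gt0.
Qed.

Lemma geom_growth theta : 0 < theta -> weight_growth alpha beta L (geom_seq theta).
Proof.
move=> t0; split=> [k _|]; first exact: exprn_gt0.
(* The ratio of consecutive weights is exactly 1/theta, and the power of rho in the upper bound is
   at least 1. *)
exists theta^-1, theta^-1; split=> [||k k1]; rewrite ?invr_gt0//.
have tn : theta != 0 by rewrite gt_eqF.
rewrite /geom_seq exprS mulrA mulVf// mul1r lexx /=.
rewrite (mulrC theta^-1) -mulrA (mulrA theta^-1) mulVf// mul1r ler_peMl//.
exact: exprn_ge0 (ltW t0).
Qed.

Lemma u_tildeS k : u k.+1 = u k * r ^+ (L ^ k).
Proof. by rewrite /u_tilde big_nat_recr//= exprD. Qed.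

Lemma u_tilde_gt0 k : 0 < u k. Proof. exact: exprn_gt0. Qed.

Lemma v_tilde_gt0 k : 0 < v k.
Proof.
rewrite /v_tilde !mulr_gt0// subr_gt0 u_tildeS gtr_pMr ?u_tilde_gt0//.
by rewrite exprn_ilt1// -?lt0n// ltW.
Qed.

Lemma v_tilde_summable w : (forall k, (1 <= k)%N -> 0 < w k) ->
  weight_summable alpha beta L w -> (\sum_(1 <= k <oo) (v k / w k)%:E < +oo)%E.
Proof.
move=> w0; apply: (@eseries_dominated _ _ _ (2 * beta)) => [|k k1|k k1].
- by rewrite mulr_ge0// ltW.
- rewrite divr_ge0 ?(ltW (v_tilde_gt0 _)) ?(ltW (w0 _ _))//= mulrA ler_pM2r ?invr_gt0 ?w0//.
  by rewrite ler_wpM2l ?mulr_ge0 ?(ltW beta_gt0)// gerBl ltW// u_tilde_gt0.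
by rewrite divr_ge0// ltW// ?u_tilde_gt0// w0.
Qed.

(** The ratio of u k to pi k is rho / L^(k-1), which is geometric as soon as L is at least 2. *)
Lemma pi_summable : (2 <= L)%N -> weight_summable alpha beta L pis.
Proof.
move=> L2'; apply: (@geometric_summable _ _ (2 * r) 2^-1) => //.
- by rewrite mulr_ge0// ltW.
- by rewrite invf_lt1// ltr1n.
case=> // k _; have L0 : 0 < (L ^ k)%:R :> R by rewrite ltr0n.
have -> : u k.+1 / pis k.+1 = r / (L ^ k)%:R.
  rewrite /u_tilde /pi_seq /= big_ltn// expn0 exprD expr1 invfM.
  by rewrite mulrACA mulfV ?mulr1// gt_eqF// exprn_gt0.
rewrite divr_ge0 ?(ltW r0)//= exprS mulrACA mulfV// mul1r ler_wpM2l ?(ltW r0)//.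
rewrite exprVn lef_pV2 ?posrE ?exprn_gt0//.
by rewrite -natrX ler_nat; case: k {L0} => // k; rewrite leq_exp2r.
Qed.

Lemma geom_summable1 theta : L = 1%N -> r < theta ->
  weight_summable alpha beta L (geom_seq theta).
Proof.
move=> L1 rt; have t0 := lt_trans r0 rt.
apply: (@geometric_summable _ _ 1 (r / theta)) => // [||k _].
- by rewrite divr_ge0// ltW.
- by rewrite ltr_pdivrMr// mul1r.
rewrite divr_ge0 ?exprn_ge0 ?(ltW r0) ?(ltW t0)//= mul1r /u_tilde /geom_seq (expr_div_n r theta) L1.
rewrite (eq_bigr (fun=> 1%N)) ?sum_nat_const_nat ?subn0 ?muln1//.
by move=> i _; rewrite exp1n.
Qed.

(** For L at least 2 the sequence u decays faster than any geometric one: its ratio rho^(L^k) is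
    below s = min(1, theta/2) once k reaches N, and the factor s^N absorbs the first N indices. Then
    u k / theta^k is at most s^-N (s/theta)^k, with s < theta. *)
Lemma geom_summable theta : (2 <= L)%N -> 0 < theta ->
  weight_summable alpha beta L (geom_seq theta).
Proof.
move=> L2' t0; pose s := Num.min 1 (theta / 2).
have s0 : 0 < s by rewrite lt_min ltr01 divr_gt0.
have s1 : s <= 1 by rewrite ge_min lexx.
have [N rN] : exists N, r ^+ N <= s.
  have : (fun n => r ^+ n) @ \oo --> (0 : R) by apply: cvg_expr; rewrite gtr0_norm.
  move=> /cvgrPdist_le /(_ _ s0)[N _ /(_ N (leqnn N))].
  by rewrite sub0r normrN ger0_norm ?exprn_ge0 ?(ltW r0)//; exists N.
have uN k : u k * s ^+ N <= s ^+ k.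
  elim: k => [|k IH].
    by rewrite /u_tilde big_geq// expr0 mul1r exprn_ile1// ltW.
  rewrite u_tildeS; have [Nk|kN] := leqP N k.
    rewrite mulrAC exprSr; apply: ler_pM => //.
    - exact: mulr_ge0 (ltW (u_tilde_gt0 k)) (exprn_ge0 N (ltW s0)).
    - by rewrite exprn_ge0 ?(ltW r0).
    apply: le_trans rN; rewrite ler_wiXn2l ?(ltW r0) ?(ltW rho_lt1)//.
    by apply: leq_trans Nk _; exact: ltnW (ltn_expl _ L2').
  rewrite -u_tildeS; apply: (@le_trans _ _ (1 * s ^+ N)).
    by rewrite ler_wpM2r ?exprn_ge0 ?(ltW s0)// exprn_ile1// ltW.
  by rewrite mul1r ler_wiXn2l// ltW.
apply: (@geometric_summable _ _ (s ^- N) (s / theta)).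
- by rewrite invr_ge0 exprn_ge0 ?(ltW s0).
- by rewrite divr_ge0// ltW.
- rewrite ltr_pdivrMr// mul1r; apply: (@le_lt_trans _ _ (theta / 2)).
    by rewrite ge_min lexx orbT.
  by rewrite ltr_pdivrMr// ltr_pMr// ltr1n.
move=> k _; rewrite /geom_seq.
rewrite (divr_ge0 (ltW (u_tilde_gt0 k)) (exprn_ge0 k (ltW t0))) /=.
rewrite (expr_div_n s) mulrA ler_pM2r ?invr_gt0 ?exprn_gt0//.
by rewrite mulrC ler_pdivlMr ?exprn_gt0.
Qed.

End weights.

Unset Implicit Arguments.

Theorem theorem2p4 (R : realType) (alpha beta : R) (L : nat)
    (psi : probability (measurableTypeR R) R)
    (d : measure_display) (Omega : measurableType d)
    (P : probability Omega R)
    (B : nat -> R -> Omega -> R) (Z0 : Omega -> nat -> R)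
    (alpha_gt0 : 0 < alpha) (beta_gt0 : 0 < beta)
    (rho_lt1 : rho alpha beta < 1) (L_ge1 : (1 <= L)%N)
    (psi_spectral : orthogonality_measure alpha beta L psi)
    (noise : driving_noise P (v_tilde alpha beta L) B Z0) :
  [/\ (forall w : nat -> R, weight_growth alpha beta L w ->
         conclusion_a alpha beta L psi P B Z0 w),
      ((weight_growth alpha beta L (pi_seq alpha beta L) /\
        conclusion_a alpha beta L psi P B Z0 (pi_seq alpha beta L)) /\
       (forall theta : R, 0 < theta ->
          weight_growth alpha beta L (geom_seq theta) /\
          conclusion_a alpha beta L psi P B Z0 (geom_seq theta))),
      (forall w : nat -> R, weight_growth alpha beta L w ->
         weight_summable alpha beta L w ->
         conclusion_b alpha beta L psi P B Z0 w),
      ((2 <= L)%N ->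
         [/\ weight_growth alpha beta L (pi_seq alpha beta L),
             weight_summable alpha beta L (pi_seq alpha beta L) &
             conclusion_b alpha beta L psi P B Z0 (pi_seq alpha beta L)] /\
         (forall theta : R, 0 < theta ->
            [/\ weight_growth alpha beta L (geom_seq theta),
                weight_summable alpha beta L (geom_seq theta) &
                conclusion_b alpha beta L psi P B Z0 (geom_seq theta)])) &
      (L = 1%N -> forall theta : R, rho alpha beta < theta ->
         [/\ weight_growth alpha beta L (geom_seq theta),
             weight_summable alpha beta L (geom_seq theta) &
             conclusion_b alpha beta L psi P B Z0 (geom_seq theta)])].
Proof.
have vs (w : nat -> R) := v_tilde_summable alpha_gt0 beta_gt0 rho_lt1 L_ge1 (w := w).
have v0 k (_ : (1 <= k)%N) := v_tilde_gt0 alpha_gt0 beta_gt0 rho_lt1 L_ge1 k.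
have pg := pi_growth alpha_gt0 beta_gt0 rho_lt1 L_ge1.
have gg (theta : R) := geom_growth L alpha_gt0 beta_gt0 rho_lt1 (theta := theta).
have ca (w : nat -> R) wg := conclusion_a_holds P B Z0 alpha_gt0 beta_gt0 rho_lt1 L_ge1 psi_spectral (w := w) wg pg.
have cb (w : nat -> R) wg (ws : weight_summable alpha beta L w) :=
  conclusion_b_holds alpha_gt0 beta_gt0 rho_lt1 L_ge1 psi_spectral (w := w) wg pg noise v0
    (vs w (proj1 wg) ws).
split=> [||//|L2|L1 theta rt]; first exact: ca.
- by split=> [|theta t0]; split; [|exact: ca|exact: gg|apply/ca/gg].
- have ps := pi_summable alpha_gt0 beta_gt0 L_ge1 L2.
  split=> [|theta t0]; first by split => //; exact: cb.
  have gs := geom_summable alpha_gt0 beta_gt0 rho_lt1 L2 t0.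
  by split => //; [exact: gg|apply: cb => //; exact: gg].
have t0 := lt_trans (rho_gt0 alpha_gt0 beta_gt0) rt.
have gs := geom_summable1 alpha_gt0 beta_gt0 L1 rt.
by split => //; [exact: gg|apply: cb => //; exact: gg].
Qed.
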